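(* Assume that $\frac{\omega}{2}\le h<\frac23\omega$ and let $\Phi=(\varphi_1,\varphi_2,\varphi_3,\varphi_4)$ with $\varphi_j\in B_\omega$, $j=1,\dots,4$. Suppose that there exist positive constants $\delta,\gamma,\sigma,\eta$ such that $\delta\le\sum_{j=1}^4|\widehat{\varphi_j}|^2\le\gamma$ a.e. in $(-\omega,\omega)$, $[J_{\Phi,t_o}]_3\ge\sigma$ a.e. in $I_-\cup I_+$, and $|\det J_{\Phi,t_o}|\ge\eta$ a.e. in $I$ (i.e. that $E_{\Phi,t_o}$ is a frame for $B_\omega$). Then the Fourier transform of the vector of dual generators $\Phi^*=(\varphi_1^*,\varphi_2^*,\varphi_3^*,\varphi_4^* )$ is given on $(0,\omega)$ by $$\widehat{\Phi^*}=\begin{cases} E\ \tau_{-h}\overline{\widehat\Phi}\times\big(\tau_{-h}\widehat\Phi\times\widehat\Phi\times\tau_h\widehat\Phi\big)\times\tau_h\overline{\widehat\Phi} & \text{in }(0,2h-\omega),\\ D\ \tau_{-2h}\overline{\widehat\Phi}\times\tau_{-h}\overline{\widehat\Phi}\times\tau_h\overline{\widehat\Phi} & \text{in }(2h-\omega,\omega-h),\\ E\ \tau_{-2h}\overline{\widehat\Phi}\times\tau_{-h}\overline{\widehat\Phi}\times\big(\tau_{-2h}\widehat\Phi\times\tau_{-h}\widehat\Phi\times\widehat\Phi\big) & \text{in }(\omega-h,3h-\omega),\\ -D\ \tau_{-3h}\overline{\widehat\Phi}\times\tau_{-2h}\overline{\widehat\Phi}\times\tau_{-h}\overline{\widehat\Phi}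 & \text{in }(3h-\omega,\omega),\end{cases}$$ where $E=h^2(\det\mathbb J_{\Phi,t_o}\mathbb J_{\Phi,t_o}^* )^{-1}$ and $D=h\,(\det\overline{J_{\Phi,t_o}})^{-1}$. The expression of $\widehat{\Phi^*}$ in $(-\omega,0)$ is obtained by reflecting each of these intervals around zero and replacing each $\tau_{jh}$ by $\tau_{-jh}$ in the expression of $\widehat{\Phi^*}$ in the reflected interval (leaving the functions $D$ and $E$ unchanged). If $h=\frac\omega2$ the first and third intervals are empty.
   Context: Conventions: $\hat f(\xi)=\frac{1}{\sqrt{2\pi}}\int f(t)e^{-it\xi}\,dt$ (extended to $L^2(\mathbb R)$); $\tau_a f(x)=f(x+a)$, applied componentwise to vectors; bar denotes complex conjugation. Fix $\omega>0$ and $B_\omega=\{f\in L^2(\mathbb R):\operatorname{supp}\hat f\subset[-\omega,\omega]\}$; $t_o>0$ and $h=2\pi/t_o$. $\widehat\Phi=(\widehat{\varphi_1},\dots,\widehat{\varphi_4})$. For $U_1,U_2,U_3\in\mathbb C^4$, the ternary cross product $U_1\times U_2\times U_3\in\mathbb C^4$ is the formal determinant of the $4\times4$ matrix with first row $(\mathbf e_1,\mathbf e_2,\mathbf e_3,\mathbf e_4)$ (canonical basis of $\mathbb C^4$) and following rows $U_1,U_2,U_3$ (no conjugation). $E_{\Phi,t_o}=\{\tau_{nt_o}\varphi_j:n\in\mathbb Z,\ 1\le j\le4\}$ is a frame for $B_\omega$ if there are $0<A\le B$ with $A\|f\|^2\le\sum_j\sum_n|\langle f,\tau_{nt_o}\varphi_j\rangle|^2\le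 B\|f\|^2$ for all $f\in B_\omega$. In that case the frame operator $Sf=\sum_j\sum_n\langle f,\tau_{nt_o}\varphi_j\rangle\tau_{nt_o}\varphi_j$ is invertible on $B_\omega$, and the dual generators are $\varphi_j^*=S^{-1}\varphi_j$. Intervals: $I_-=(0,2h-\omega)$, $I=(2h-\omega,\omega-h)$, $I_+=(\omega-h,h)$. The pre-Gramian $J_{\Phi,t_o}$ is the $h$-periodic $4\times4$ matrix-valued function given on $[0,h]$ by the rows, from top to bottom, $\sqrt h\,\tau_{-2h}\widehat\Phi,\ \sqrt h\,\tau_{-h}\widehat\Phi,\ \sqrt h\,\widehat\Phi,\ \sqrt h\,\tau_h\widehat\Phi$ (the first row vanishes on $I_-$ and the last on $I_+$). On $I_-\cup I_+$ (and translates by multiples of $h$), $\mathbb J_{\Phi,t_o}$ is the $3\times4$ matrix obtained from $J_{\Phi,t_o}$ by deleting the zero row. $^*$ on a matrix denotes conjugate transpose. Thus $D$ (on $I$ and translates) and $E$ (on $I_-\cup I_+$ and translates) are $h$-periodic functions. $[J]_n$ denotes the sum of the squares of the absolute values of the minors of order $n$ of $J$. Equalities hold almost everywhere.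
   Formalization: The expressions with E, on (0,2h−ω) and (ω−h,3h−ω) and their reflections, are stated with −E in place of E, since the printed sign is wrong (fibers e1, e2, e3 on I_- give −e2/h where the dual is e2/h). *)

(* Defs.v *)
From HB Require Import structures.
From mathcomp Require Import all_boot all_order all_algebra.
From mathcomp Require Import finmap complex.
From mathcomp Require Import all_classical all_reals all_analysis.
Import Order.TTheory GRing.Theory Num.Theory.
Import numFieldNormedType.Exports.
Import ComplexField.Normc.

Set Implicit Arguments.
Unset Strict Implicit.
Unset Printing Implicit Defensive.

Local Open Scope classical_set_scope.
Local Open Scope ring_scope.
Local Open Scope complex_scope.

Definition tau (R : realType) (T : Type) (a : R) (f : R -> T) : R -> T :=
  fun x => f (x + a).

(** ** Complex-valued functions on the line, integrated componentwise *)

Section L2.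
Context {R : realType}.
Implicit Types (f g : R -> R[i]).

Let mu := @lebesgue_measure R.

Definition cmeasurable f :=
  measurable_fun setT (fun x => complex.Re (f x)) /\
  measurable_fun setT (fun x => complex.Im (f x)).

Definition cintegral f : R[i] :=
  (\int[mu]_x complex.Re (f x)) +i* (\int[mu]_x complex.Im (f x)).

Definition norm2sq f : \bar R := (\int[mu]_x ((normc (f x)) ^+ 2)%:E)%E.

Definition L2 f := cmeasurable f /\ (norm2sq f < +oo)%E.

Definition inner f g : R[i] := cintegral (fun x => f x * (g x)^*).

Definition expi (theta : R) : R[i] := cos theta +i* sin theta.

Definition fourier_integral f (xi : R) : R[i] :=
  (Num.sqrt (2 * pi))^-1%:C * cintegral (fun t => f t * expi (- (t * xi))).

Definition truncate (n : nat) f : R -> R[i] :=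
  fun t => if t \in `[- n%:R, n%:R] then f t else 0.

(* [g] is the L^2 limit of the Fourier integrals of the truncations of [f],
   which are in L^1 and in L^2 when [f] is in L^2 *)
Definition is_fourier f g :=
  L2 g /\
  norm2sq (fun xi => fourier_integral (truncate n f) xi - g xi)
    @[n --> \oo] --> 0%E.

(* a representative, unique up to a.e. equality *)
Definition fourier f : R -> R[i] := xget (fun=> 0) [set g | is_fourier f g].

(* L^2 functions being defined up to a.e. equality, the inclusion of the
   support in the closed interval means vanishing a.e. outside of it *)
Definition bandlimited (omega : R) f :=
  L2 f /\
  {ae mu, forall xi, xi \notin `[- omega, omega] -> fourier f xi = 0}.

End L2.

(** ** Frames of translates *)

Section Frames.
Context {R : realType}.
Variables (omega t0 : R) (phi : 'I_4 -> R -> R[i]).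

Let mu := @lebesgue_measure R.

Definition translate (j : 'I_4) (n : int) : R -> R[i] :=
  tau (n%:~R * t0) (phi j).

Definition is_frame :=
  exists A B : R,
    [/\ 0 < A, A <= B &
      forall f, bandlimited omega f ->
        let s := (\sum_(j < 4) \esum_(n in [set: int])
                    ((normc (inner f (translate j n))) ^+ 2)%:E)%E in
        (A%:E * norm2sq f <= s)%E /\ (s <= B%:E * norm2sq f)%E].

(* unconditional convergence in L^2 of the series over the integers *)
Definition is_frame_operator (f g : R -> R[i]) :=
  L2 g /\
  forall e : R, 0 < e -> exists F0 : {fset int},
    forall F : {fset int}, (F0 `<=` F)%fset ->
      (norm2sq (fun x => ((\sum_(j < 4) \sum_(n <- F)
                 inner f (translate j n) * translate j n x) - g x)%R)
       <= e%:E)%E.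

Definition frame_operator (f : R -> R[i]) : R -> R[i] :=
  xget (fun=> 0) [set g | is_frame_operator f g].

(* the inverse image of [phi j] under the frame operator on the space of
   band-limited functions *)
Definition dual_generator (j : 'I_4) : R -> R[i] :=
  xget (fun=> 0)
    [set g | bandlimited omega g /\
             {ae mu, forall x, frame_operator g x = phi j x}].

End Frames.

(** ** Vectors and matrices *)

(* [cross U1 U2 U3] is the formal determinant with rows e, U1, U2, U3: its
   j-th coordinate is obtained by replacing e by the j-th basis vector *)
Definition cross (K : comNzRingType) (U1 U2 U3 : 'rV[K]_4) : 'rV[K]_4 :=
  \row_(j < 4)
    \det (col_mx (delta_mx 0 j : 'rV[K]_4)
            (col_mx U1 (col_mx U2 U3)) : 'M[K]_4).

Definition conj_entries (K : rcfType) m n (A : 'M[K[i]]_(m, n)) : 'M[K[i]]_(m, n) :=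
  map_mx conjc A.

Definition conj_trmx (K : rcfType) m n (A : 'M[K[i]]_(m, n)) : 'M[K[i]]_(n, m) :=
  (conj_entries A)^T.

Definition increasing_ffun k m (f : {ffun 'I_k -> 'I_m}) : bool :=
  [forall a : 'I_k, forall b : 'I_k, (a < b)%N ==> (f a < f b)%N].

Definition minors_sq (K : rcfType) (k m n : nat) (A : 'M[K[i]]_(m, n)) : K :=
  \sum_(r : {ffun 'I_k -> 'I_m} | increasing_ffun r)
  \sum_(c : {ffun 'I_k -> 'I_n} | increasing_ffun c)
    (normc (\det (mxsub r c A))) ^+ 2.

Definition fourier_vec (R : realType) (phi : 'I_4 -> R -> R[i]) (x : R) :
    'rV[R[i]]_4 :=
  \row_(j < 4) fourier (phi j) x.

Section PreGramian.
Context {R : realType}.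
Variables (omega t0 : R) (phi : 'I_4 -> R -> R[i]).

Definition step : R := 2 * pi / t0.

Let h := step.
Let Phi := fourier_vec phi.

(* the representative of [x] modulo [h] in [0, h) *)
Definition modstep (x : R) : R := x - (Num.floor (x / h))%:~R * h.

Definition preGramian (x : R) : 'M[R[i]]_4 :=
  let y := modstep x in
  (Num.sqrt h)%:C *:
    (col_mx (tau (- (2 * h)) Phi y)
       (col_mx (tau (- h) Phi y)
          (col_mx (Phi y) (tau h Phi y))) : 'M[R[i]]_4).

(* The deleted row is the one that vanishes a.e.: the first one when [x] is in
   (0, 2h - omega) modulo h, the last one when it is in (omega - h, h) modulo
   h. The value elsewhere is irrelevant. *)
Definition reduced_preGramian (x : R) : 'M[R[i]]_(3, 4) :=
  if modstep x < 2 * h - omega then row' ord0 (preGramian x)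
  else row' ord_max (preGramian x).

(* When U1, U2, U3 are the rows of [reduced_preGramian] without their factor
   sqrt h and N = U1 x U2 x U3, the determinant below is h^3 |N|^2. The vectors
   conj U1 x N x conj U3 and conj U1 x conj U2 x N lie in the span of U1, U2,
   U3, are orthogonal to all but one of these (U2, resp. U3), and their inner
   product with that one is - |N|^2: the dual vectors are thus - E times them,
   with a minus sign. *)
Definition dual_coefE (x : R) : R[i] :=
  (h ^+ 2)%:C *
  (\det (reduced_preGramian x *m conj_trmx (reduced_preGramian x)))^-1.

Definition dual_coefD (x : R) : R[i] :=
  h%:C * (\det (conj_entries (preGramian x)))^-1.

End PreGramian.

(* Main.v *)
(* Cut the Fourier transform [F] of a band-limited function into the four
   fibers F (y + (k - 2) h), for y in [0, h). The coefficients of [f] on the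
   translates of phi_j are the Fourier coefficients of
   P_j y = sum_k F (y + (k - 2) h) conj (hatphi_j (y + (k - 2) h)), so that, by
   Parseval, the frame inequality holds iff it holds for almost every fiber, and
   the frame operator acts on the fibers as the matrix h M M^*, where the rows of
   M are the values of hatPhi. The fibers X of the dual generators thus solve
   h M M^* X = M. If M is invertible, X is determined by X M^* = h^-1; if one row
   of M vanishes, the other rows of X are moreover orthogonal to the cross product
   of the other rows of M, and the formulas of the theorem are then checked by
   taking inner products with a basis of C^4. *)
Require Import Defs.
From mathcomp Require Import all_boot all_order all_algebra.
From mathcomp Require Import finmap perm complex ring lra zify.
From mathcomp Require Import all_classical all_reals all_analysis.
From mathcomp Require Import measurable_realfun.
Import Order.TTheory GRing.Theory Num.Theory.
Import numFieldNormedType.Exports.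
Import ComplexField.Normc.

Set Implicit Arguments.
Unset Strict Implicit.
Unset Printing Implicit Defensive.

Local Open Scope classical_set_scope.
Local Open Scope ring_scope.
Local Open Scope complex_scope.

(** * Complex-valued measurable functions *)

(** [fourier], [frame_operator] and [dual_generator] are picked by [xget] with default 0, so nothing
    can be said about them until an object with the defining property has been produced and shown
    unique up to null sets. This is why completeness of the square-integrable functions, Plancherel,
    surjectivity of the transform onto compactly supported functions and unconditional convergence
    of the frame series are all established. On the fibers everything rests on one uniform estimate:
    the entries of M are bounded by the square root of [gamma], and the determinant of its Gram
    matrix, completed by 1 at the index of a row outside the band, is bounded below by a constant
    made from [eta] and [sigma]. Cramer's rule bounds the inverse uniformly, which yields both the
    lower frame bound and the square-integrability of the dual fibers; the adjugate formula also
    makes these measurable. The expressions on the two half-lines come from different rows of the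
    same fiber equation. *)

Section ComplexNumbers.
Variable R : realType.
Implicit Types (z w : R[i]) (r : R).

Lemma cReD z w : complex.Re (z + w) = complex.Re z + complex.Re w.
Proof. by case: z; case: w. Qed.
Lemma cImD z w : complex.Im (z + w) = complex.Im z + complex.Im w.
Proof. by case: z; case: w. Qed.
Lemma cReN z : complex.Re (- z) = - complex.Re z. Proof. by case: z. Qed.
Lemma cImN z : complex.Im (- z) = - complex.Im z. Proof. by case: z. Qed.
Lemma cReM z w : complex.Re (z * w) =
  complex.Re z * complex.Re w - complex.Im z * complex.Im w.
Proof. by case: z; case: w. Qed.
Lemma cImM z w : complex.Im (z * w) =
  complex.Re z * complex.Im w + complex.Im z * complex.Re w.
Proof. by case: z; case: w. Qed.
Lemma cReJ z : complex.Re (conjc z) = complex.Re z. Proof. by case: z. Qed.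
Lemma cImJ z : complex.Im (conjc z) = - complex.Im z. Proof. by case: z. Qed.
Lemma cReC r : complex.Re r%:C = r. Proof. by []. Qed.
Lemma cImC r : complex.Im r%:C = 0. Proof. by []. Qed.
Lemma cRe0 : complex.Re (0 : R[i]) = 0. Proof. by []. Qed.
Lemma cIm0 : complex.Im (0 : R[i]) = 0. Proof. by []. Qed.

Definition reimE := (cReD, cImD, cReN, cImN, cReM, cImM, cReJ, cImJ, cReC, cImC, cRe0, cIm0).

Lemma complex_eqP z w :
  complex.Re z = complex.Re w -> complex.Im z = complex.Im w -> z = w.
Proof. by case: z => a b; case: w => c d /= -> ->. Qed.

Lemma conjD z w : (conjc (z + w)) = (conjc z) + (conjc w).
Proof. by case: z => a b; case: w => c d; congr Complex; exact: opprD. Qed.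
Lemma conjN z : conjc (- z) = - conjc z. Proof. by case: z. Qed.
Lemma conjM z w : conjc (z * w) = conjc z * conjc w.
Proof. by apply: complex_eqP; rewrite !reimE; ring. Qed.
Lemma conjB z w : conjc (z - w) = conjc z - conjc w.
Proof. by rewrite conjD conjN. Qed.
Lemma conj_sum I (s : seq I) (P : pred I) (F : I -> R[i]) :
  (conjc (\sum_(i <- s | P i) F i)) = \sum_(i <- s | P i) (conjc (F i)).
Proof. by elim/big_rec2: _ => [|i z w _ <-]; rewrite ?conjD// conjc0. Qed.

Lemma normc2E z : normc z ^+ 2 = complex.Re z ^+ 2 + complex.Im z ^+ 2.
Proof. by case: z => a b /=; rewrite sqr_sqrtr// addr_ge0 ?sqr_ge0. Qed.

Lemma normc_ge0 z : 0 <= normc z. Proof. by case: z => a b; exact: sqrtr_ge0. Qed.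

Lemma normc2_eq0 z : normc z ^+ 2 = 0 -> z = 0.
Proof. by move=> /eqP; rewrite sqrf_eq0 => /eqP /eq0_normc. Qed.

Lemma mulcJ z : z * (conjc z) = (normc z ^+ 2)%:C.
Proof.
by apply: complex_eqP; rewrite !reimE ?normc2E; ring.
Qed.

Lemma normcJ2 z : normc (conjc z) ^+ 2 = normc z ^+ 2.
Proof. by rewrite !normc2E !reimE sqrrN. Qed.

Lemma normcC r : normc r%:C = `|r|.
Proof. by rewrite /normc /= expr0n /= addr0 sqrtr_sqr. Qed.

(** By the parallelogram identity the two sides differ by |z - w|^2. This replaces the triangle
    inequality: distances are handled as squared norms, at the cost of a factor 2. *)
Lemma normc2D_le z w : normc (z + w) ^+ 2 <= 2 * normc z ^+ 2 + 2 * normc w ^+ 2.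
Proof.
rewrite !normc2E !reimE -subr_ge0.
have -> : forall a b c d : R, 2 * (a ^+ 2 + b ^+ 2) + 2 * (c ^+ 2 + d ^+ 2) -
  ((a + c) ^+ 2 + (b + d) ^+ 2) = (a - c) ^+ 2 + (b - d) ^+ 2 by move=> *; ring.
by rewrite addr_ge0 ?sqr_ge0.
Qed.

Lemma Re2_le_normc2 z : complex.Re z ^+ 2 <= normc z ^+ 2.
Proof. by rewrite normc2E lerDl sqr_ge0. Qed.
Lemma Im2_le_normc2 z : complex.Im z ^+ 2 <= normc z ^+ 2.
Proof. by rewrite normc2E lerDr sqr_ge0. Qed.

Lemma normr_Re_le z : `|complex.Re z| <= normc z.
Proof.
by rewrite -(@ler_pXn2r _ 2) ?nnegrE ?normr_ge0 ?normc_ge0// real_normK ?num_real// Re2_le_normc2.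
Qed.
Lemma normr_Im_le z : `|complex.Im z| <= normc z.
Proof.
by rewrite -(@ler_pXn2r _ 2) ?nnegrE ?normr_ge0 ?normc_ge0// real_normK ?num_real// Im2_le_normc2.
Qed.

Lemma expiD (a b : R) : expi (a + b) = expi a * expi b.
Proof. by apply: complex_eqP; rewrite !reimE /= (cosD, sinD); ring. Qed.
Lemma expi0 : expi (0 : R) = 1.
Proof. by rewrite /expi cos0 sin0. Qed.
Lemma expiN (a : R) : expi (- a) = (conjc (expi a)).
Proof. by rewrite /expi cosN sinN. Qed.
Lemma normc2_expi (a : R) : normc (expi a) ^+ 2 = 1.
Proof. by rewrite normc2E /= cos2Dsin2. Qed.
End ComplexNumbers.

Section AlmostEverywhere.
Variable R : realType.
Local Notation mu := (@lebesgue_measure R).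

(** These instances let [filterS] and its variants combine almost-everywhere statements, in both
    forms under which the filter is met. *)
#[global] Instance lebesgue_ae_filter : Filter (almost_everywhere mu).
Proof. exact: ae_filter_ringOfSetsType. Qed.
#[global] Instance lebesgue_ae_filter_nbhs : Filter (nbhs (almost_everywhere mu)).
Proof. exact: ae_filter_ringOfSetsType. Qed.

End AlmostEverywhere.

Section ComplexMeasurable.
Context {R : realType}.
Implicit Types (f g : R -> R[i]).

Lemma cmeasurable_cst (c : R[i]) : cmeasurable (fun=> c).
Proof. by split; exact: measurable_cst. Qed.

Lemma cmeasurableD f g : cmeasurable f -> cmeasurable g ->
  cmeasurable (fun x => f x + g x).
Proof.
move=> [f1 f2] [g1 g2]; split.
  by under eq_fun do rewrite cReD; exact: measurable_funD.
by under eq_fun do rewrite cImD; exact: measurable_funD.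
Qed.

Lemma cmeasurableN f : cmeasurable f -> cmeasurable (fun x => - f x).
Proof.
move=> [f1 f2]; split.
  by under eq_fun do rewrite cReN; exact: measurable_funN.
by under eq_fun do rewrite cImN; exact: measurable_funN.
Qed.

Lemma cmeasurableB f g : cmeasurable f -> cmeasurable g ->
  cmeasurable (fun x => f x - g x).
Proof. by move=> mf mg; apply: cmeasurableD => //; exact: cmeasurableN. Qed.

Lemma cmeasurableM f g : cmeasurable f -> cmeasurable g ->
  cmeasurable (fun x => f x * g x).
Proof.
move=> [f1 f2] [g1 g2]; split.
  under eq_fun do rewrite cReM.
  by apply: measurable_funB; exact: measurable_funM.
under eq_fun do rewrite cImM.
by apply: measurable_funD; exact: measurable_funM.
Qed.

Lemma cmeasurableJ f : cmeasurable f -> cmeasurable (fun x => (conjc (f x))).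
Proof.
move=> [f1 f2]; split.
  by under eq_fun do rewrite cReJ.
by under eq_fun do rewrite cImJ; exact: measurable_funN.
Qed.

Lemma cmeasurableC (u : R -> R) : measurable_fun setT u ->
  cmeasurable (fun x => (u x)%:C).
Proof. by move=> mu; split => //=; exact: measurable_cst. Qed.

Lemma cmeasurable_sum I (s : seq I) (P : pred I) (F : I -> R -> R[i]) :
  (forall i, P i -> cmeasurable (F i)) ->
  cmeasurable (fun x => \sum_(i <- s | P i) F i x).
Proof.
move=> mF; elim: s => [|i s IH].
  by under eq_fun do rewrite big_nil; exact: cmeasurable_cst.
under eq_fun do rewrite big_cons.
by case Pi : (P i) => //; apply: cmeasurableD => //; exact: mF.
Qed.

Lemma cmeasurable_prod I (s : seq I) (P : pred I) (F : I -> R -> R[i]) :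
  (forall i, P i -> cmeasurable (F i)) ->
  cmeasurable (fun x => \prod_(i <- s | P i) F i x).
Proof.
move=> mF; elim: s => [|i s IH].
  by under eq_fun do rewrite big_nil; exact: cmeasurable_cst.
under eq_fun do rewrite big_cons.
by case Pi : (P i) => //; apply: cmeasurableM => //; exact: mF.
Qed.

Lemma measurable_normc2 f : cmeasurable f ->
  measurable_fun setT (fun x => normc (f x) ^+ 2).
Proof.
move=> [f1 f2]; under eq_fun do rewrite normc2E.
by apply: measurable_funD; exact: measurable_funX.
Qed.

(** Inversion is continuous away from 0, and any function is measurable on the singleton of 0. *)
Lemma measurable_invr : measurable_fun setT (@GRing.inv R).
Proof.
have mD : measurable (~` [set (0 : R)]) by exact: measurableC.
have -> : [set: R] = [set 0] `|` ~` [set 0] by rewrite setUv.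
apply/(measurable_funU _ (measurable_set1 (0 : R)) mD).
split; first exact: measurable_fun_set1.
apply: open_continuous_measurable_fun.
  by apply: closed_openC; exact: accessible_closed_set1 (hausdorff_accessible (@Rhausdorff R)) _.
by move=> x /set_mem /= /eqP x0; exact: inv_continuous.
Qed.

Lemma cmeasurableV f : cmeasurable f -> cmeasurable (fun x => (f x)^-1).
Proof.
move=> mf.
(* This also holds where [f x] is 0, both sides being 0 by the convention on inverses. *)
have -> : (fun x => (f x)^-1) = (fun x => ((normc (f x) ^+ 2)^-1)%:C * (conjc (f x))).
  apply/funext => x; have [->|fx0] := eqVneq (f x) 0.
    by rewrite invr0 rmorph0 mulr0.
  apply: (mulfI fx0); rewrite divff// mulrCA mulcJ -rmorphM/= mulVf//.
  by apply: contra_neq fx0 => /normc2_eq0.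
apply: cmeasurableM; last exact: cmeasurableJ.
apply: cmeasurableC; apply: measurableT_comp; first exact: measurable_invr.
exact: measurable_normc2.
Qed.

Lemma measurable_cos : measurable_fun setT (@cos R).
Proof. by apply: continuous_measurable_fun; exact: continuous_cos. Qed.
Lemma measurable_sin : measurable_fun setT (@sin R).
Proof. by apply: continuous_measurable_fun; exact: continuous_sin. Qed.

Lemma cmeasurable_expi (u : R -> R) : measurable_fun setT u ->
  cmeasurable (fun x => expi (u x)).
Proof.
by move=> mu; split => /=; apply: measurableT_comp => //;
  [exact: measurable_cos | exact: measurable_sin].
Qed.

Lemma cmeasurable_indic (A : set R) : measurable A ->
  cmeasurable (fun x => (\1_A x)%:C).
Proof. by move=> mA; apply: cmeasurableC; exact: measurable_indic. Qed.

Lemma cmeasurable_shift a f : cmeasurable f -> cmeasurable (tau a f).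
Proof.
have ma : measurable_fun setT (fun x : R => x + a).
  by apply: measurable_funD => //; exact: measurable_cst.
move=> [f1 f2]; split.
  exact: (measurableT_comp f1 ma).
exact: (measurableT_comp f2 ma).
Qed.

End ComplexMeasurable.

(** * The space of square-integrable functions *)

Section L2Space.
Context {R : realType}.
Local Notation mu := (@lebesgue_measure R).
Implicit Types (f g k : R -> R[i]) (u : R -> R).

(** [fine] sends an infinite integral to 0, so this real number is meaningful for [L2] functions
    only. *)
Definition nsq f : R := fine (norm2sq f).

Definition cintegrable f :=
  mu.-integrable setT (EFin \o (fun x => complex.Re (f x))) /\
  mu.-integrable setT (EFin \o (fun x => complex.Im (f x))).

Lemma innerE f g : inner f g = cintegral (fun x => f x * conjc (g x)).
Proof. by []. Qed.

Lemma norm2sq_ge0 f : (0 <= norm2sq f)%E.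
Proof. by apply: integral_ge0 => x _; rewrite lee_fin sqr_ge0. Qed.

Lemma nsq_ge0 f : 0 <= nsq f.
Proof. by apply: fine_ge0; exact: norm2sq_ge0. Qed.

Lemma norm2sqE f : L2 f -> norm2sq f = (nsq f)%:E.
Proof.
move=> [_ lf]; rewrite /nsq fineK// ge0_fin_numE//; exact: norm2sq_ge0.
Qed.

Lemma integrable_ge0 u : measurable_fun setT u -> (forall x, 0 <= u x) ->
  (\int[mu]_x (u x)%:E < +oo)%E -> mu.-integrable setT (EFin \o u).
Proof.
move=> meas_u u0 ulty; apply/integrableP; split; first exact/measurable_EFinP.
by under eq_integral do rewrite /= ger0_norm//.
Qed.

Lemma L2_integrable f : L2 f ->
  mu.-integrable setT (EFin \o (fun x => normc (f x) ^+ 2)).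
Proof.
by move=> [mf lf]; apply: integrable_ge0 => //; [exact: measurable_normc2 |
  move=> x; exact: sqr_ge0].
Qed.

Lemma L2_dom f u : cmeasurable f -> mu.-integrable setT (EFin \o u) ->
  {ae mu, forall x, normc (f x) ^+ 2 <= u x} -> L2 f.
Proof.
move=> mf iu fu; split => //.
apply: le_lt_trans (integrable_lty measurableT (integrable_norm iu)).
apply: ae_ge0_le_integral => //.
- by move=> x _; rewrite lee_fin sqr_ge0.
- by apply/measurable_EFinP; exact: measurable_normc2.
- by move=> x _; rewrite lee_fin normr_ge0.
- apply/measurable_EFinP; apply: measurableT_comp => //.
  by have /integrableP[/measurable_EFinP] := iu.
- apply: filterS fu => x /= fux _; rewrite lee_fin (le_trans fux)//.
  exact: ler_norm.
Qed.

Lemma integrableZl' (c : R) u : mu.-integrable setT (EFin \o u) ->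
  mu.-integrable setT (EFin \o (fun x => c * u x)).
Proof.
move=> iu.
rewrite (_ : EFin \o _ = (fun x => c%:E * (EFin \o u) x)%E)//.
exact: integrableZl.
Qed.

Lemma integrableD' u v : mu.-integrable setT (EFin \o u) ->
  mu.-integrable setT (EFin \o v) ->
  mu.-integrable setT (EFin \o (fun x => u x + v x)).
Proof.
move=> iu iv.
rewrite (_ : EFin \o _ = ((EFin \o u) \+ (EFin \o v))%E)//.
exact: integrableD.
Qed.

Lemma L2_bounded_mul f g (M : R) : cmeasurable g ->
  {ae mu, forall x, normc (g x) ^+ 2 <= M} -> L2 f ->
  L2 (fun x => g x * f x).
Proof.
move=> mg gM lf.
apply: (@L2_dom _ (fun x => M * normc (f x) ^+ 2)).
- by apply: cmeasurableM => //; case: lf.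
- exact/integrableZl'/L2_integrable.
- apply: filterS gM => x gM; rewrite normcM exprMn ler_wpM2r// sqr_ge0//.
Qed.

Lemma L2Z f (c : R[i]) : L2 f -> L2 (fun x => c * f x).
Proof.
move=> lf; apply: (@L2_bounded_mul _ (fun=> c) (normc c ^+ 2)) => //.
exact: aeW.
Qed.

Lemma L2N f : L2 f -> L2 (fun x => - f x).
Proof.
by move=> lf; under eq_fun do rewrite -mulN1r; exact: L2Z.
Qed.

Lemma L2D f g : L2 f -> L2 g -> L2 (fun x => f x + g x).
Proof.
move=> lf lg.
apply: (@L2_dom _ (fun x => 2 * normc (f x) ^+ 2 + 2 * normc (g x) ^+ 2)).
- by apply: cmeasurableD; [case: lf|case: lg].
- by apply: integrableD'; apply: integrableZl'; exact: L2_integrable.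
- by apply: aeW => x; exact: normc2D_le.
Qed.

Lemma L2B f g : L2 f -> L2 g -> L2 (fun x => f x - g x).
Proof. by move=> lf lg; apply: L2D => //; exact: L2N. Qed.

Lemma L20 : L2 (fun=> 0 : R[i]).
Proof.
split; first exact: cmeasurable_cst.
rewrite /norm2sq; under eq_integral do rewrite normc0 expr0n /=.
by rewrite integral0.
Qed.

Lemma L2_sum I (s : seq I) (P : pred I) (F : I -> R -> R[i]) :
  (forall i, P i -> L2 (F i)) -> L2 (fun x => \sum_(i <- s | P i) F i x).
Proof.
move=> lF; elim: s => [|i s IH].
  by under eq_fun do rewrite big_nil; exact: L20.
under eq_fun do rewrite big_cons.
by case Pi : (P i) => //; apply: L2D => //; exact: lF.
Qed.

Lemma L2J f : L2 f -> L2 (fun x => (conjc (f x))).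
Proof.
move=> lf; apply: (L2_dom _ (L2_integrable lf)).
  by apply: cmeasurableJ; case: lf.
by apply: aeW => x; rewrite normcJ2.
Qed.

Lemma cintegrable_dom f u : cmeasurable f -> mu.-integrable setT (EFin \o u) ->
  (forall x, normc (f x) <= u x) -> cintegrable f.
Proof.
move=> [f1 f2] iu fu; split.
- apply: (le_integrable measurableT _ _ iu); first exact/measurable_EFinP.
  move=> x _ /=; rewrite lee_fin (le_trans (normr_Re_le _))//.
  by rewrite (le_trans (fu x))// ler_norm.
- apply: (le_integrable measurableT _ _ iu); first exact/measurable_EFinP.
  move=> x _ /=; rewrite lee_fin (le_trans (normr_Im_le _))//.
  by rewrite (le_trans (fu x))// ler_norm.
Qed.

Lemma L2_cintegrable f g : L2 f -> L2 g -> cintegrable (fun x => f x * (conjc (g x))).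
Proof.
move=> lf lg.
apply: (@cintegrable_dom _ (fun x => normc (f x) ^+ 2 + normc (g x) ^+ 2)).
- by apply: cmeasurableM; [case: lf | apply: cmeasurableJ; case: lg].
- by apply: integrableD'; exact: L2_integrable.
- move=> x.
  have -> : normc (f x * (conjc (g x))) = normc (f x) * normc (g x).
    rewrite normcM; congr (_ * _); apply: (@pexpIrn _ 2) => //;
      rewrite ?nnegrE ?normc_ge0//.
    by rewrite normcJ2.
  have := sqr_ge0 (normc (f x) - normc (g x)).
  have := normc_ge0 (f x); have := normc_ge0 (g x).
  move: (normc (f x)) (normc (g x)) => a b; nra.
Qed.

Lemma cintegrableD f g : cintegrable f -> cintegrable g ->
  cintegrable (fun x => f x + g x).
Proof.
move=> [f1 f2] [g1 g2]; split.
  by under [X in EFin \o X]eq_fun do rewrite cReD; exact: integrableD'.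
by under [X in EFin \o X]eq_fun do rewrite cImD; exact: integrableD'.
Qed.

Lemma cintegrableZ f (c : R[i]) : cintegrable f -> cintegrable (fun x => c * f x).
Proof.
move=> [f1 f2]; split.
  rewrite (_ : (fun x => _) = (fun x => complex.Re c * complex.Re (f x) +
    (- complex.Im c) * complex.Im (f x))); last first.
    by apply/funext => x; rewrite cReM mulNr.
  by apply: integrableD'; exact: integrableZl'.
rewrite (_ : (fun x => _) = (fun x => complex.Re c * complex.Im (f x) +
    complex.Im c * complex.Re (f x))); last first.
  by apply/funext => x; rewrite cImM.
by apply: integrableD'; exact: integrableZl'.
Qed.

Lemma cintegrable0 : cintegrable (fun=> 0).
Proof. by split => /=; exact: integrable0. Qed.

Lemma cintegralD f g : cintegrable f -> cintegrable g ->
  cintegral (fun x => f x + g x) = cintegral f + cintegral g.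
Proof.
move=> [f1 f2] [g1 g2]; apply: complex_eqP; rewrite !reimE /= -RintegralD//;
  by apply: eq_Rintegral => x _; rewrite !reimE.
Qed.

Lemma cintegralZ f (c : R[i]) : cintegrable f ->
  cintegral (fun x => c * f x) = c * cintegral f.
Proof.
move=> [f1 f2]; apply: complex_eqP; rewrite !reimE /= -!RintegralZl//.
- rewrite -RintegralB//; last 2 first.
  + exact: integrableZl'.
  + exact: integrableZl'.
  by apply: eq_Rintegral => x _; rewrite !reimE.
- rewrite -RintegralD//; last 2 first.
  + exact: integrableZl'.
  + exact: integrableZl'.
  by apply: eq_Rintegral => x _; rewrite !reimE.
Qed.

Lemma cintegral0 : cintegral (fun=> 0 : R[i]) = 0.
Proof.
by apply: complex_eqP => /=; rewrite /Rintegral integral0.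
Qed.

Lemma cintegrable_sum I (s : seq I) (P : pred I) (F : I -> R -> R[i]) :
  (forall i, P i -> cintegrable (F i)) ->
  cintegrable (fun x => \sum_(i <- s | P i) F i x).
Proof.
move=> lF; elim: s => [|i s IH].
  by under eq_fun do rewrite big_nil; exact: cintegrable0.
under eq_fun do rewrite big_cons.
by case Pi : (P i) => //; apply: cintegrableD => //; exact: lF.
Qed.

Lemma cintegral_sum I (s : seq I) (P : pred I) (F : I -> R -> R[i]) :
  (forall i, P i -> cintegrable (F i)) ->
  cintegral (fun x => \sum_(i <- s | P i) F i x) =
  \sum_(i <- s | P i) cintegral (F i).
Proof.
move=> lF; elim: s => [|i s IH].
  rewrite big_nil -[RHS]cintegral0; congr cintegral.
  by apply/funext => x; rewrite big_nil.
rewrite big_cons; under eq_fun do rewrite big_cons.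
case Pi : (P i) => //; rewrite -IH cintegralD//; first exact: lF.
exact: cintegrable_sum.
Qed.

Lemma cintegralJ f : cintegrable f ->
  cintegral (fun x => (conjc (f x))) = (conjc (cintegral f)).
Proof.
move=> [f1 f2]; apply: complex_eqP; rewrite !reimE /=.
  by apply: eq_Rintegral => x _; rewrite !reimE.
rewrite -[RHS]mulN1r -RintegralZl//.
by apply: eq_Rintegral => x _; rewrite !reimE mulN1r.
Qed.

Lemma cintegral_ae f g : cmeasurable f -> cmeasurable g ->
  {ae mu, forall x, f x = g x} -> cintegral f = cintegral g.
Proof.
move=> [f1 f2] [g1 g2] fg; apply: complex_eqP => /=; congr fine;
  apply: ae_eq_integral => //; try exact/measurable_EFinP.
- by apply: filterS fg => x /= ->.
- by apply: filterS fg => x /= ->.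
Qed.

Lemma norm2sq_ae f g : cmeasurable f -> cmeasurable g ->
  {ae mu, forall x, f x = g x} -> norm2sq f = norm2sq g.
Proof.
move=> mf mg fg; apply: ge0_ae_eq_integral => //.
- by apply/measurable_EFinP; exact: measurable_normc2.
- by apply/measurable_EFinP; exact: measurable_normc2.
- by move=> x _; rewrite lee_fin sqr_ge0.
- by move=> x _; rewrite lee_fin sqr_ge0.
- by apply: filterS fg => x /= ->.
Qed.

Lemma nsq_ae f g : cmeasurable f -> cmeasurable g ->
  {ae mu, forall x, f x = g x} -> nsq f = nsq g.
Proof. by move=> mf mg fg; rewrite /nsq (norm2sq_ae mf mg fg). Qed.

Lemma nsq_eq0 f : L2 f -> nsq f = 0 -> {ae mu, forall x, f x = 0}.
Proof.
move=> lf f0; have := norm2sqE lf; rewrite f0 /norm2sq => i0.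
have mf : measurable_fun setT (EFin \o (fun x => normc (f x) ^+ 2)).
  by apply/measurable_EFinP; apply: measurable_normc2; case: lf.
have : (\int[mu]_x `|(normc (f x) ^+ 2)%:E| = 0)%E.
  by rewrite -[RHS]i0; apply: eq_integral => x _ /=; rewrite ger0_norm ?sqr_ge0.
move/(ae_eq_integral_abs mu measurableT mf).
by apply: filterS => x /= /(_ I) [] /normc2_eq0.
Qed.

Lemma nsq0 : nsq (fun=> 0) = 0.
Proof.
rewrite /nsq /norm2sq; under eq_integral do rewrite normc0 expr0n /=.
by rewrite integral0.
Qed.

Lemma innerJ f g : L2 f -> L2 g -> inner g f = (conjc (inner f g)).
Proof.
move=> lf lg; rewrite !innerE -cintegralJ; last exact: L2_cintegrable.
by congr cintegral; apply/funext => x; rewrite conjM conjcK mulrC.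
Qed.

Lemma innerDl f g k : L2 f -> L2 g -> L2 k ->
  inner (fun x => f x + g x) k = inner f k + inner g k.
Proof.
move=> lf lg lk; rewrite !innerE -cintegralD; try exact: L2_cintegrable.
by congr cintegral; apply/funext => x; rewrite mulrDl.
Qed.

Lemma innerZl f g (c : R[i]) : L2 f -> L2 g ->
  inner (fun x => c * f x) g = c * inner f g.
Proof.
move=> lf lg; rewrite !innerE -cintegralZ; try exact: L2_cintegrable.
by congr cintegral; apply/funext => x; rewrite mulrA.
Qed.

Lemma innerDr f g k : L2 f -> L2 g -> L2 k ->
  inner k (fun x => f x + g x) = inner k f + inner k g.
Proof.
move=> lf lg lk; rewrite innerJ//; last exact: L2D.
by rewrite innerDl// conjD -innerJ// -innerJ.
Qed.

Lemma innerZr f g (c : R[i]) : L2 f -> L2 g ->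
  inner g (fun x => c * f x) = (conjc c) * inner g f.
Proof.
move=> lf lg; rewrite innerJ//; last exact: L2Z.
by rewrite innerZl// conjM -innerJ.
Qed.

Lemma innerBl f g k : L2 f -> L2 g -> L2 k ->
  inner (fun x => f x - g x) k = inner f k - inner g k.
Proof.
move=> lf lg lk; rewrite (_ : (fun x => _) = (fun x => f x + (-1) * g x)).
  by rewrite innerDl ?innerZl ?mulN1r//; exact: L2Z.
by apply/funext => x; rewrite mulN1r.
Qed.

Lemma innerBr f g k : L2 f -> L2 g -> L2 k ->
  inner k (fun x => f x - g x) = inner k f - inner k g.
Proof.
move=> lf lg lk; rewrite innerJ//; last exact: L2B.
by rewrite innerBl// conjB -innerJ// -innerJ.
Qed.

Lemma inner_suml I (s : seq I) (P : pred I) (F : I -> R -> R[i]) k :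
  (forall i, P i -> L2 (F i)) -> L2 k ->
  inner (fun x => \sum_(i <- s | P i) F i x) k =
  \sum_(i <- s | P i) inner (F i) k.
Proof.
move=> lF lk; rewrite -cintegral_sum.
  by congr cintegral; apply/funext => x; rewrite mulr_suml.
by move=> i Pi; apply: L2_cintegrable => //; exact: lF.
Qed.

Lemma inner_nsq f : L2 f -> inner f f = (nsq f)%:C.
Proof.
move=> lf; rewrite innerE; apply: complex_eqP => /=; rewrite /nsq /Rintegral.
  by congr fine; apply: eq_integral => x _; rewrite mulcJ.
by rewrite integral0_eq// => x _; rewrite mulcJ.
Qed.

Lemma nsqZ f (c : R[i]) : L2 f -> nsq (fun x => c * f x) = normc c ^+ 2 * nsq f.
Proof.
move=> lf; apply: complexI; rewrite -inner_nsq; last exact: L2Z.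
by rewrite innerZl ?innerZr ?inner_nsq// ?mulrA ?mulcJ ?rmorphM//; exact: L2Z.
Qed.

Lemma nsqN f : L2 f -> nsq (fun x => - f x) = nsq f.
Proof.
move=> lf; rewrite (_ : (fun x => _) = (fun x => -1 * f x)).
  by rewrite nsqZ// normc2E !reimE !expr2 /=; ring.
by apply/funext => x; rewrite mulN1r.
Qed.

Lemma nsqD f g : L2 f -> L2 g ->
  nsq (fun x => f x + g x) = nsq f + nsq g + 2 * complex.Re (inner f g).
Proof.
move=> lf lg; apply: complexI; rewrite -inner_nsq; last exact: L2D.
have lfg := L2D lf lg.
rewrite innerDl// !innerDr// [inner g f]innerJ// !inner_nsq//.
by apply: complex_eqP; rewrite !reimE /=; ring.
Qed.

Lemma nsqB f g : L2 f -> L2 g ->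
  nsq (fun x => f x - g x) = nsq f + nsq g - 2 * complex.Re (inner f g).
Proof.
move=> lf lg; rewrite nsqD//; last exact: L2N.
rewrite nsqN//; congr (_ + _).
under [X in inner f X]eq_fun do rewrite -mulN1r.
by rewrite innerZr// !reimE /=; ring.
Qed.

Lemma nsq_subC f g : L2 f -> L2 g ->
  nsq (fun x => f x - g x) = nsq (fun x => g x - f x).
Proof.
by move=> lf lg; rewrite !nsqB// [inner g f]innerJ// cReJ [nsq f + _]addrC.
Qed.

Lemma nsqD_le f g : L2 f -> L2 g ->
  nsq (fun x => f x + g x) <= 2 * nsq f + 2 * nsq g.
Proof.
move=> lf lg; have := nsq_ge0 (fun x => f x - g x).
rewrite nsqB// nsqD//; lra.
Qed.

Lemma nsqB_tri f g k : L2 f -> L2 g -> L2 k ->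
  nsq (fun x => f x - g x) <=
  2 * nsq (fun x => f x - k x) + 2 * nsq (fun x => k x - g x).
Proof.
move=> lf lg lk.
have := nsqD_le (L2B lf lk) (L2B lk lg); congr (_ <= _).
by congr nsq; apply/funext => x; rewrite addrA subrK.
Qed.

Lemma inner_CS f g : L2 f -> L2 g ->
  normc (inner f g) ^+ 2 <= nsq f * nsq g.
Proof.
move=> lf lg; set t := inner f g.
have H (r : R) : 0 <= r ^+ 2 * nsq f + normc t ^+ 2 * nsq g - 2 * r * normc t ^+ 2.
  have := nsq_ge0 (fun x => r%:C * f x - t * g x).
  rewrite nsqB; try exact: L2Z.
  rewrite !nsqZ// innerZl//; last exact: L2Z.
  rewrite innerZr// -/t normcC real_normK ?num_real// [(conjc t) * t]mulrC mulcJ.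
  by rewrite !reimE; congr (_ <= _); ring.
have g0 := nsq_ge0 g; have f0 := nsq_ge0 f; have t0 := sqr_ge0 (normc t).
have [gp|gn] := ltP 0 (nsq g).
  (* The value of [r] that minimizes the squared norm of r f - t g, up to the factor |g|^2. *)
  have := H (nsq g).
  have -> : nsq g ^+ 2 * nsq f + normc t ^+ 2 * nsq g - 2 * nsq g * normc t ^+ 2 =
    nsq g * (nsq f * nsq g - normc t ^+ 2) by ring.
  by rewrite pmulr_rge0// subr_ge0.
have {gn}g00 : nsq g = 0 by apply/eqP; rewrite eq_le gn g0.
rewrite (_ : t = 0) ?normc0 ?expr0n/= ?mulr_ge0//.
rewrite /t innerE -[RHS]cintegral0; apply: cintegral_ae.
- by apply: cmeasurableM; [case: lf|apply: cmeasurableJ; case: lg].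
- exact: cmeasurable_cst.
- by apply: filterS (nsq_eq0 lg g00) => x ->; rewrite conjc0 mulr0.
Qed.

End L2Space.

(** * Mean-square convergence, truncations and translations *)

Section L2Convergence.
Context {R : realType}.
Local Notation mu := (@lebesgue_measure R).
Implicit Types (f g k : R -> R[i]) (u v : nat -> R -> R[i]).

Definition L2cvg u g := nsq (fun x => u n x - g x) @[n --> \oo] --> (0 : R).

Lemma L2cvgP u g : (forall n, L2 (u n)) -> L2 g ->
  (norm2sq (fun x => u n x - g x) @[n --> \oo] --> 0%E) <-> L2cvg u g.
Proof.
move=> lu lg.
have E n : norm2sq (fun x => u n x - g x) = (nsq (fun x => u n x - g x))%:E.
  by rewrite norm2sqE//; exact: L2B.
under eq_cvg do rewrite E.
split; first by move/fine_cvgP => [_].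
by move=> ug; apply: cvg_EFin => //; near=> n; [].
Unshelve. all: by end_near. Qed.

Lemma cvg0_squeeze (a b : nat -> R) : (forall n, 0 <= a n <= b n) ->
  b @ \oo --> (0 : R) -> a @ \oo --> (0 : R).
Proof.
move=> ab b0; apply: (@squeeze_cvgr _ _ _ _ (fun=> 0) b) => //.
  by apply: nearW => n; exact: ab.
exact: cvg_cst.
Qed.

Lemma L2cvg_unique u g k : (forall n, L2 (u n)) -> L2 g -> L2 k ->
  L2cvg u g -> L2cvg u k -> {ae mu, forall x, g x = k x}.
Proof.
move=> lu lg lk ug uk.
have lgk := L2B lg lk.
have : nsq (fun x => g x - k x) = 0.
  have H n : 0 <= nsq (fun x => g x - k x) <=
      2 * nsq (fun x => u n x - g x) + 2 * nsq (fun x => u n x - k x).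
    rewrite nsq_ge0/= [X in _ <= 2 * X + _]nsq_subC//.
    exact: nsqB_tri.
  have c : (fun=> nsq (fun x => g x - k x)) @ \oo --> (0 : R).
    apply: (cvg0_squeeze H).
    rewrite (_ : 0 = 2 * 0 + 2 * 0 :> R); last by rewrite mulr0 addr0.
    by apply: cvgD; apply: cvgMr.
  apply: (@cvg_unique _ (@Rhausdorff R) _ _ _ _ _ c).
  exact: cvg_cst.
move/(nsq_eq0 lgk).
by apply: filterS => x /eqP; rewrite subr_eq0 => /eqP.
Qed.

Lemma L2cvgD u v g k : (forall n, L2 (u n)) -> (forall n, L2 (v n)) ->
  L2 g -> L2 k -> L2cvg u g -> L2cvg v k ->
  L2cvg (fun n x => u n x + v n x) (fun x => g x + k x).
Proof.
move=> lu lv lg lk ug vk; apply: (@cvg0_squeeze _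
  (fun n => 2 * nsq (fun x => u n x - g x) + 2 * nsq (fun x => v n x - k x))).
  move=> n; rewrite nsq_ge0/=.
  have := nsqD_le (L2B (lu n) lg) (L2B (lv n) lk); congr (_ <= _).
  by congr nsq; apply/funext => x; rewrite opprD addrACA.
rewrite (_ : 0 = 2 * 0 + 2 * 0 :> R); last by rewrite mulr0 addr0.
by apply: cvgD; apply: cvgMr.
Qed.

Lemma nsq_bounded_mul (w : R -> R[i]) (M : R) f : cmeasurable w ->
  0 <= M -> {ae mu, forall x, normc (w x) ^+ 2 <= M} -> L2 f ->
  nsq (fun x => w x * f x) <= M * nsq f.
Proof.
move=> mw M0 wM lf.
have lwf : L2 (fun x => w x * f x) by exact: (L2_bounded_mul mw wM).
rewrite -lee_fin EFinM -!norm2sqE// /norm2sq -ge0_integralZl//; last first.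
- by move=> x _; rewrite lee_fin sqr_ge0.
- by apply/measurable_EFinP; apply: measurable_normc2; case: lf.
apply: ae_ge0_le_integral => //.
- by move=> x _; rewrite lee_fin sqr_ge0.
- by apply/measurable_EFinP; apply: measurable_normc2; case: lwf.
- by move=> x _; rewrite mule_ge0// lee_fin// sqr_ge0.
- apply: measurable_funeM; apply/measurable_EFinP; apply: measurable_normc2.
  by case: lf.
- by apply: filterS wM => x wM _; rewrite normcM exprMn EFinM lee_wpmul2r// lee_fin ?sqr_ge0.
Qed.

Lemma L2cvg_mul (w : R -> R[i]) (M : R) u g : cmeasurable w ->
  0 <= M -> {ae mu, forall x, normc (w x) ^+ 2 <= M} ->
  (forall n, L2 (u n)) -> L2 g -> L2cvg u g ->
  L2cvg (fun n x => w x * u n x) (fun x => w x * g x).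
Proof.
move=> mw M0 wM lu lg ug.
apply: (@cvg0_squeeze _ (fun n => M * nsq (fun x => u n x - g x))); last first.
  by rewrite -[X in _ --> X](mulr0 M); exact: cvgMr.
move=> n; apply/andP; split; first exact: nsq_ge0.
rewrite (_ : (fun x => _) = (fun x => w x * (u n x - g x))); last first.
  by apply/funext => x; rewrite mulrBr.
by apply: nsq_bounded_mul => //; exact: L2B.
Qed.

(** Continuity of the inner product, by Cauchy-Schwarz applied to <u, v> - <f, g> = <u - f, v> + <f,
    v - g>. It is stated for two pairs of sequences because its use is to carry identities such as
    Plancherel from approximations to limits. *)
Lemma inner_lim_eq u v U V f g F G :
  (forall n, L2 (u n)) -> (forall n, L2 (v n)) ->
  (forall n, L2 (U n)) -> (forall n, L2 (V n)) ->
  L2 f -> L2 g -> L2 F -> L2 G ->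
  L2cvg u f -> L2cvg v g -> L2cvg U F -> L2cvg V G ->
  (forall n, inner (u n) (v n) = inner (U n) (V n)) -> inner f g = inner F G.
Proof.
have H u' v' f' g' : (forall n, L2 (u' n)) -> (forall n, L2 (v' n)) ->
    L2 f' -> L2 g' -> L2cvg u' f' -> L2cvg v' g' ->
    (fun n => normc (inner (u' n) (v' n) - inner f' g') ^+ 2) @ \oo --> (0 : R).
  move=> lu lv lf lg uf vg.
  apply: (@cvg0_squeeze _ (fun n =>
    2 * (nsq (fun x => u' n x - f' x) * (2 * nsq (fun x => v' n x - g' x) + 2 * nsq g'))
    + 2 * (nsq f' * nsq (fun x => v' n x - g' x)))).
    move=> n; apply/andP; split; first exact: sqr_ge0.
    have -> : inner (u' n) (v' n) - inner f' g' =
        inner (fun x => u' n x - f' x) (v' n) + inner f' (fun x => v' n x - g' x).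
      by rewrite innerBl// innerBr//; ring.
    apply: (le_trans (normc2D_le _ _)); apply: lerD; rewrite ler_wpM2l//.
      apply: (le_trans (inner_CS (L2B (lu n) lf) (lv n))).
      rewrite ler_wpM2l ?nsq_ge0//.
      have := nsqD_le (L2B (lv n) lg) lg; congr (_ <= _).
      by congr nsq; apply/funext => x; rewrite subrK.
    by apply: inner_CS => //; exact: L2B.
  rewrite (_ : 0 = 2 * (0 * (2 * 0 + 2 * nsq g')) + 2 * (nsq f' * 0) :> R); last first.
    by rewrite mul0r !mulr0 addr0.
  apply: cvgD; apply: cvgMr; last exact: cvgMr.
  by apply: cvgM => //; apply: cvgD; [exact: cvgMr|exact: cvg_cst].
move=> lu lv lU lV lf lg lF lG uf vg UF VG E.
have H1 := H _ _ _ _ lu lv lf lg uf vg.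
have H2 := H _ _ _ _ lU lV lF lG UF VG.
apply/eqP; rewrite -subr_eq0; apply/eqP/normc2_eq0.
have c : (fun=> normc (inner f g - inner F G) ^+ 2) @ \oo --> (0 : R).
  apply: (@cvg0_squeeze _ (fun n =>
     2 * normc (inner (u n) (v n) - inner f g) ^+ 2 +
     2 * normc (inner (U n) (V n) - inner F G) ^+ 2)).
    move=> n; apply/andP; split; first exact: sqr_ge0.
    rewrite E.
    have -> : inner f g - inner F G = - (inner (U n) (V n) - inner f g) +
        (inner (U n) (V n) - inner F G) by ring.
    by rewrite (le_trans (normc2D_le _ _))// normcN.
  rewrite (_ : 0 = 2 * 0 + 2 * 0 :> R); last by rewrite mulr0 addr0.
  by apply: cvgD; apply: cvgMr.
by apply: (@cvg_unique _ (@Rhausdorff R) _ _ _ _ _ c); exact: cvg_cst.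
Qed.

Lemma truncateE n f : truncate n f =
  fun t => (\1_(`[- n%:R, n%:R]%classic : set R) t)%:C * f t.
Proof.
apply/funext => t; rewrite /truncate indicE mem_setE.
by case: ifP => _; rewrite ?mul1r ?mul0r.
Qed.

Lemma normc2_indic (A : set R) x : normc (\1_A x)%:C ^+ 2 <= 1 :> R.
Proof.
by rewrite normcC indicE; case: (_ \in _); rewrite ?normr1 ?normr0 ?expr0n ?expr1n ?ler01.
Qed.

Lemma L2_indic_mul (A : set R) f : measurable A -> L2 f ->
  L2 (fun t => (\1_A t)%:C * f t).
Proof.
move=> mA; apply: (@L2_bounded_mul _ _ _ 1); first exact: cmeasurable_indic.
by apply: aeW => x; exact: normc2_indic.
Qed.

Lemma L2_truncate n f : L2 f -> L2 (truncate n f).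
Proof. by move=> lf; rewrite truncateE; apply: L2_indic_mul. Qed.

(** At each point the truncations are eventually equal to [f], and their squared distance to [f] is
    dominated by |f|^2. *)
Lemma L2cvg_truncate f : L2 f -> L2cvg (fun n => truncate n f) f.
Proof.
move=> lf; apply/L2cvgP => //; first by move=> n; exact: L2_truncate.
rewrite -(integral0 mu setT).
have m n : measurable_fun setT (fun x => (normc (truncate n f x - f x) ^+ 2)%:E).
  apply/measurable_EFinP; apply: measurable_normc2.
  by apply: cmeasurableB; [case: (L2_truncate n lf)|case: lf].
have c : {ae mu, forall x, setT x ->
    (normc (truncate n f x - f x) ^+ 2)%:E @[n --> \oo] --> cst 0%E x}.
  apply: aeW => x _; apply: cvg_near_cst; near=> n.
  rewrite /truncate in_itv/= -ler_norml.
  have -> : `|x| <= n%:R by near: n; exact: nbhs_infty_ger.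
  by rewrite subrr normc0 expr0n.
have d : {ae mu, forall x n, setT x ->
    (`|(normc (truncate n f x - f x) ^+ 2)%:E| <= (normc (f x) ^+ 2)%:E)%E}.
  apply: aeW => x n _; rewrite lee_fin ger0_norm ?sqr_ge0// /truncate.
  by case: ifP => _; rewrite ?subrr ?normc0 ?sub0r ?normcN// expr0n sqr_ge0.
have c0 : measurable_fun [set: R] (cst 0%E : R -> \bar R) by exact: measurable_cst.
by have [_ _] := dominated_convergence (mu := mu) measurableT m c0 c (L2_integrable lf) d.
Unshelve. all: by end_near. Qed.

Lemma measurable_shift (a : R) :
  measurable_fun setT (fun x : R => x + a : measurableTypeR R).
Proof. by apply: measurable_funD => //; exact: measurable_cst. Qed.

(** Lebesgue measure is determined by its values on half-open intervals, whose lengths a translation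
    preserves. *)
Lemma pushforward_shift (a : R) (A : set R) : measurable A ->
  pushforward mu (fun x : R => (x + a)%R : measurableTypeR R) A = mu A.
Proof.
move=> mA; apply/esym/lebesgue_measure_unique => //=.
  exact: measurable_shift.
move=> _ _ [[b c]] _ <-.
rewrite /pushforward.
have -> : (fun x : R => x + a) @^-1` `]b, c]%classic = `]b - a, c - a]%classic.
  by apply/seteqP; split => x /=; rewrite !in_itv/= ltrBlDr lerBrDr.
by rewrite !lebesgue_measure_itv/= !lte_fin ltrD2r -!EFinD; case: ifP => // _; congr (_%:E); ring.
Qed.

Lemma ge0_integral_shift (a : R) (u : R -> \bar R) : measurable_fun setT u ->
  (forall x, 0 <= u x)%E -> (\int[mu]_x u (x + a)%R = \int[mu]_x u x)%E.
Proof.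
move=> mu' u0.
have E := @ge0_integral_pushforward _ _ (measurableTypeR R) (measurableTypeR R) R _
  (measurable_shift a) mu setT u
  measurableT mu' (fun x _ => u0 x).
rewrite preimage_setT in E; etransitivity; first exact: esym E.
apply: eq_measure_integral; first exact: measurable_shift.
by move=> ? A mA _; exact: pushforward_shift.
Qed.

Lemma integral_shift (a : R) (u : R -> \bar R) : measurable_fun setT u ->
  (\int[mu]_x u (x + a)%R = \int[mu]_x u x)%E.
Proof.
move=> mu'; rewrite integralE [RHS]integralE; congr (_ - _)%E.
  have mp := measurable_funepos mu'.
  transitivity (\int[mu]_x u^\+ (x + a)%R)%E; last first.
    exact: (ge0_integral_shift a mp (funepos_ge0 _)).
  by apply: eq_integral => x _; rewrite !funeposE.
have mn := measurable_funeneg mu'.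
transitivity (\int[mu]_x u^\- (x + a)%R)%E; last first.
  exact: (ge0_integral_shift a mn (funeneg_ge0 _)).
by apply: eq_integral => x _; rewrite !funenegE.
Qed.

Lemma cintegral_tau a f : cmeasurable f -> cintegral (tau a f) = cintegral f.
Proof.
move=> [f1 f2]; rewrite /cintegral /Rintegral /tau; congr Complex; congr fine.
  by rewrite -[RHS](integral_shift a)//; exact/measurable_EFinP.
by rewrite -[RHS](integral_shift a)//; exact/measurable_EFinP.
Qed.

Lemma norm2sq_tau a f : cmeasurable f -> norm2sq (tau a f) = norm2sq f.
Proof.
move=> mf; rewrite /norm2sq /tau -[RHS](integral_shift a)//.
by apply/measurable_EFinP; exact: measurable_normc2.
Qed.

Lemma L2_tau a f : L2 f -> L2 (tau a f).
Proof.
by move=> [mf lf]; split; [exact: cmeasurable_shift|rewrite norm2sq_tau].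
Qed.

Lemma nsq_tau a f : L2 f -> nsq (tau a f) = nsq f.
Proof. by move=> [mf _]; rewrite /nsq norm2sq_tau. Qed.

Lemma ae_shift (a : R) (P : R -> Prop) : {ae mu, forall x, P x} ->
  {ae mu, forall x, P (x + a)}.
Proof.
move=> [N [mN N0 PN]]; exists ((fun x : R => (x + a)%R) @^-1` N); split.
- by rewrite -[X in measurable X]setTI; exact: measurable_shift.
- by rewrite -[RHS]N0 -(pushforward_shift a mN).
- by move=> x /=; apply: PN.
Qed.

End L2Convergence.

(** * Completeness of the space of square-integrable functions *)

Section L2Complete.
Context {R : realType}.
Local Notation mu := (@lebesgue_measure R).
Implicit Types (f g : R -> R[i]) (u v : nat -> R -> R[i]).

Lemma measurable_normc2E f : cmeasurable f ->
  measurable_fun setT (fun x => (normc (f x) ^+ 2)%:E).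
Proof. by move=> mf; apply/measurable_EFinP; exact: measurable_normc2. Qed.

Lemma cvg0P (a : nat -> R) : (forall n, 0 <= a n) ->
  (a @ \oo --> (0 : R)) <->
  (forall e, 0 < e -> exists N, forall n, (N <= n)%N -> a n <= e).
Proof.
move=> a0; split => [/cvgrPdist_le H e e0|H].
  have [N _ HN] := H e e0; exists N => n Nn.
  by have := HN n Nn; rewrite /= sub0r normrN ger0_norm.
apply/cvgrPdist_le => e e0; have [N HN] := H e e0.
exists N => // n /= Nn; rewrite sub0r normrN ger0_norm//; exact: HN.
Qed.

Lemma sum_half_le n : \sum_(0 <= k < n) (2^-1 : R) ^+ k <= 2.
Proof.
suff -> : \sum_(0 <= k < n) (2^-1 : R) ^+ k = 2 - 2 * 2^-1 ^+ n.
  by rewrite lerBlDr lerDl mulr_ge0// exprn_ge0.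
elim: n => [|n IH]; first by rewrite big_geq// expr0 mulr1 subrr.
rewrite big_nat_recr//= IH exprS.
have h : (2^-1 : R) * 2 = 1 by rewrite mulVf.
by move: (2^-1 ^+ n) => z; field.
Qed.

(** If c t <= 1 the first term dominates t, otherwise the second one does. *)
Lemma normr_amgm (c t : R) : 0 < c -> 0 <= t -> t <= c^-1 + c * t ^+ 2.
Proof.
move=> c0 t0.
have ci : 0 < c^-1 by rewrite invr_gt0.
have ct2 : 0 <= c * t ^+ 2 by rewrite mulr_ge0 ?sqr_ge0// ltW.
have [ct1|ct1] := leP (c * t) 1.
  apply: (@le_trans _ _ c^-1); last by rewrite lerDl.
  by rewrite -(ler_pM2l c0) divff ?gt_eqF.
apply: (@le_trans _ _ (c * t ^+ 2)); last by rewrite lerDr ltW.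
by rewrite expr2 mulrA ler_peMl// ltW.
Qed.

(* The weights [2 ^+ k] make [sum_k |a k.+1 - a k|] finite, by AM-GM. *)
Lemma weighted_sum_cvg (a d : nat -> R) (M : R) :
  (forall k, 0 <= d k) ->
  (forall k, (a k.+1 - a k) ^+ 2 <= d k) ->
  (forall n, \sum_(0 <= k < n) 2 ^+ k * d k <= M) -> cvgn a.
Proof.
move=> d0 ad dM.
have H : cvgn (series (telescope a)).
  apply: normed_cvg; apply: nondecreasing_is_cvgn.
    by apply: nondecreasing_series => n _ _; exact: normr_ge0.
  exists (2 + M) => _ [n _ <-]; rewrite /series/=.
  apply: (@le_trans _ _ (\sum_(0 <= k < n) (2^-1 ^+ k + 2 ^+ k * d k))); last first.
    by rewrite big_split/= lerD// sum_half_le.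
  apply: ler_sum => k _.
  apply: (le_trans (@normr_amgm (2 ^+ k) _ _ (normr_ge0 _))).
    by rewrite exprn_gt0.
  rewrite exprVn lerD2l ler_wpM2l ?exprn_ge0//.
  by rewrite real_normK ?num_real//; exact: ad.
rewrite (_ : a = (fun n => a 0%N + series (telescope a) n)); last first.
  by apply/funext => n; exact: eq_sum_telescope.
by apply: is_cvgD => //; exact: is_cvg_cst.
Qed.

(** The series of the 2^n |u_(n+1) - u_n|^2 has integral at most the sum of the 2^n 4^-n, hence at
    most 2. It is thus finite almost everywhere, and [weighted_sum_cvg] applies at such points. *)
Lemma fast_cauchy_ae u : (forall n, L2 (u n)) ->
  (forall n, nsq (fun x => u n.+1 x - u n x) <= 4^-1 ^+ n) ->
  {ae mu, forall x, cvgn (fun n => complex.Re (u n x)) /\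
                    cvgn (fun n => complex.Im (u n x))}.
Proof.
move=> lu ufast.
pose d n x : R := normc (u n.+1 x - u n x) ^+ 2.
have d0 n x : 0 <= d n x by exact: sqr_ge0.
have ld n : L2 (fun x => u n.+1 x - u n x) by exact: L2B.
have md n : measurable_fun setT (EFin \o (fun x => 2 ^+ n * d n x)).
  apply/measurable_EFinP; apply: measurable_funM; first exact: measurable_cst.
  by apply: measurable_normc2; case: (ld n).
have wd0 n x : (0 <= (2 ^+ n * d n x)%:E)%E by rewrite lee_fin mulr_ge0// exprn_ge0.
pose S x := (\sum_(0 <= n <oo) (2 ^+ n * d n x)%:E)%E.
have iS : mu.-integrable setT S.
  apply/integrableP; split.
    by apply: ge0_emeasurable_sum => // n _; exact: md.
  under eq_integral.
    move=> x _; rewrite gee0_abs; last first.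
      by apply: nneseries_ge0 => n _ _; exact: wd0.
    over.
  rewrite integral_nneseries//.
  apply: (@le_lt_trans _ _ 2%:E); last by rewrite ltry.
  apply: lime_le; first by apply: is_cvg_nneseries => n _ _; apply: integral_ge0.
  apply: nearW => n; rewrite (le_trans _ (_ : (2%:E >= (\sum_(0 <= k < n) (2^-1 : R) ^+ k)%:E)%E))//.
    rewrite -sumEFin; apply: lee_sum => k _.
    under eq_integral do rewrite EFinM.
    have mdk : measurable_fun setT (fun x => (d k x)%:E).
      by apply: measurable_normc2E; case: (ld k).
    rewrite ge0_integralZl//; try by rewrite lee_fin exprn_ge0.
      2: by move=> x _; rewrite lee_fin.
    have -> : (\int[mu]_x (d k x)%:E = (nsq (fun x => u k.+1 x - u k x))%:E)%E.
      by rewrite -norm2sqE.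
    rewrite -EFinM lee_fin (le_trans (ler_wpM2l _ (ufast k))) ?exprn_ge0//.
    by rewrite -exprMn (_ : 2 * 4^-1 = 2^-1 :> R)//; field.
  by rewrite lee_fin sum_half_le.
have := integrable_ae measurableT iS.
apply: filterS => x /(_ I) Sx.
have M n : \sum_(0 <= k < n) 2 ^+ k * d k x <= fine (S x).
  rewrite -lee_fin fineK// -sumEFin.
  by apply: nneseries_lim_ge => k _ _; exact: wd0.
split.
  apply: (@weighted_sum_cvg _ (d ^~ x) _ _ _ M) => // k.
  by rewrite (le_trans _ (Re2_le_normc2 _))// cReD cReN.
apply: (@weighted_sum_cvg _ (d ^~ x) _ _ _ M) => // k.
by rewrite (le_trans _ (Im2_le_normc2 _))// cImD cImN.
Qed.

(** A limit superior exists for every sequence, so pointwise limits taken this way are measurable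
    even if the sequence diverges on a null set. *)
Definition elim_real (a : nat -> R) : R := fine (limn_esup (EFin \o a)).

Lemma elim_realP (a : nat -> R) : cvgn a -> a @ \oo --> elim_real a.
Proof.
move=> ca; have ea : EFin \o a @ \oo --> (limn a)%:E by apply: cvg_EFin => //; exact: nearW.
by rewrite /elim_real; have [_ ->] := cvg_limn_einf_sup ea.
Qed.

Lemma measurable_elim_real (a : nat -> R -> R) :
  (forall n, measurable_fun setT (a n)) ->
  measurable_fun setT (fun x => elim_real (a ^~ x)).
Proof.
move=> ma; rewrite /elim_real.
apply: (measurableT_comp (fine_measurable measurableT)).
apply: (@measurable_fun_limn_esup _ _ _ setT (fun n x => (a n x)%:E)) => n.
exact/measurable_EFinP.
Qed.

Lemma limn_einf_le_ub (v : nat -> \bar R) (e : \bar R) :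
  (forall n, v n <= e)%E -> (limn_einf v <= e)%E.
Proof.
move=> ve; rewrite limn_einf_lim; apply: lime_le; first exact: is_cvg_einfs.
apply: nearW => n; apply: le_trans (ve n).
by apply: ereal_inf_lbound; exists n => /=.
Qed.

(** Fatou's lemma: almost everywhere the limit inferior of the |u n|^2 is |g|^2. *)
Lemma norm2sq_fatou u g (e : R) :
  (forall n, L2 (u n)) -> cmeasurable g ->
  {ae mu, forall x, (complex.Re (u n x) @[n --> \oo] --> complex.Re (g x)) /\
                    (complex.Im (u n x) @[n --> \oo] --> complex.Im (g x))} ->
  (forall n, nsq (u n) <= e) -> L2 g /\ nsq g <= e.
Proof.
move=> lu mg ug ue.
suff H : (norm2sq g <= e%:E)%E.
  have lg : L2 g by split => //; apply: le_lt_trans H _; exact: ltry.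
  by split => //; rewrite -lee_fin -norm2sqE.
have mn n : measurable_fun setT (fun x => (normc (u n x) ^+ 2)%:E).
  by apply: measurable_normc2E; case: (lu n).
have n0 n x : setT x -> (0 <= (normc (u n x) ^+ 2)%:E)%E.
  by move=> _; rewrite lee_fin sqr_ge0.
have := @fatou _ _ _ mu setT measurableT _ mn n0.
have -> : (\int[mu]_x limn_einf (fun n => (normc (u n x) ^+ 2)%:E) = norm2sq g)%E.
  apply: ge0_ae_eq_integral => //.
  - rewrite (_ : (fun x => _) = (fun x =>
        - limn_esup (-%E \o (fun n => (normc (u n x) ^+ 2)%:E)))%E); last first.
      by apply/funext => x; rewrite limn_esupN oppeK.
    apply: measurableT_comp => //.
    apply: (@measurable_fun_limn_esup _ _ _ setT
      (fun n x => - (normc (u n x) ^+ 2)%:E)%E) => n.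
    by apply: measurableT_comp => //; exact: mn.
  - exact: measurable_normc2E.
  - move=> x _; rewrite limn_einf_lim; apply: lime_ge; first exact: is_cvg_einfs.
    by apply: nearW => n; apply: le_ereal_inf_tmp => _ [p /= _ <-]; exact: n0.
  - by move=> x _; rewrite lee_fin sqr_ge0.
  - apply: filterS ug => x [rx ix] _.
    suff c : (fun n => (normc (u n x) ^+ 2)%:E) @ \oo --> (normc (g x) ^+ 2)%:E.
      by have [] := cvg_limn_einf_sup c.
    apply: cvg_EFin; first exact: nearW.
    rewrite (_ : fine \o _ = (fun n => complex.Re (u n x) * complex.Re (u n x) +
        complex.Im (u n x) * complex.Im (u n x))); last first.
      by apply/funext => n; rewrite -!expr2 -normc2E.
    by rewrite normc2E !expr2; apply: cvgD; exact: cvgM.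
move/le_trans; apply; apply: limn_einf_le_ub => n.
by have := ue n; rewrite -lee_fin -norm2sqE.
Qed.

(** A subsequence with squared gaps at most 4^-k converges almost everywhere; Fatou's lemma then
    bounds the distance from its limit to the tail of the whole sequence. *)
Theorem L2_complete u : (forall n, L2 (u n)) ->
  (forall e, 0 < e -> exists N, forall m n, (N <= m)%N -> (N <= n)%N ->
     nsq (fun x => u m x - u n x) <= e) ->
  exists g, L2 g /\ L2cvg u g.
Proof.
move=> lu cu.
have /choice[N HN] : forall k : nat, exists N, forall m n, (N <= m)%N -> (N <= n)%N ->
    nsq (fun x => u m x - u n x) <= 4^-1 ^+ k.
  by move=> k; apply: cu; rewrite exprn_gt0// invr_gt0.
(* Summing the ranks makes the indices nondecreasing while keeping them above [N k]. *)
pose phi k := (\sum_(i < k.+1) N i)%N.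
have phiN k : (N k <= phi k)%N by rewrite /phi big_ord_recr/= leq_addl.
have phiS k : (phi k <= phi k.+1)%N by rewrite [leqRHS]/phi big_ord_recr leq_addr.
have phimono k j : (k <= j)%N -> (phi k <= phi j)%N.
  by move=> kj; apply: (homo_leq (r := leq)) => //; exact: leq_trans.
pose v k := u (phi k).
have lv k : L2 (v k) by exact: lu.
have cv : {ae mu, forall x, cvgn (fun n => complex.Re (v n x)) /\
                    cvgn (fun n => complex.Im (v n x))}.
  apply: fast_cauchy_ae => // k; apply: HN => //.
  exact: leq_trans (phiN _) (phiS _).
pose g x := elim_real (fun n => complex.Re (v n x)) +i*
            elim_real (fun n => complex.Im (v n x)).
have mg : cmeasurable g.
  by split; apply: measurable_elim_real => n; case: (lv n) => -[].
have key j n : (N j <= n)%N ->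
    L2 (fun x => g x - u n x) /\ nsq (fun x => g x - u n x) <= 4^-1 ^+ j.
  (* The shift by [j] keeps all the indices of the subsequence above [N j]. *)
  move=> jn; apply: (@norm2sq_fatou (fun k x => v (k + j)%N x - u n x)).
  - by move=> k; exact: L2B.
  - by apply: cmeasurableB => //; case: (lu n).
  - apply: filterS cv => x [/elim_realP rx /elim_realP ix].
    split.
      rewrite cReD cReN; under eq_cvg do rewrite cReD cReN.
      by apply: cvgD; [rewrite (cvg_shiftn j (fun k => complex.Re (v k x)))|exact: cvg_cst].
    rewrite cImD cImN; under eq_cvg do rewrite cImD cImN.
    by apply: cvgD; [rewrite (cvg_shiftn j (fun k => complex.Im (v k x)))|exact: cvg_cst].
  - move=> k; apply: HN => //; apply: leq_trans (phiN j) _.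
    by apply: phimono; exact: leq_addl.
have lg : L2 g.
  have [lgu _] := key 0%N _ (leqnn _).
  have := L2D lgu (lu (N 0%N)); congr L2.
  by apply/funext => x; rewrite subrK.
exists g; split => //; apply/cvg0P; first by move=> n; exact: nsq_ge0.
move=> e e0.
have [j je] : exists j : nat, 4^-1 ^+ j <= e.
  have : (fun j => (4^-1 : R) ^+ j) @ \oo --> (0 : R).
    by apply: cvg_expr; rewrite ger0_norm ?invr_ge0// invf_lt1// ltr1n.
  move/cvg0P => H; have [|j Hj] := H _ e e0; first by move=> j; rewrite exprn_ge0.
  by exists j; exact: Hj.
exists (N j) => n jn; rewrite nsq_subC//.
by have [_ /le_trans] := key j n jn; apply.
Qed.

Lemma L2cvg_cauchy u g : (forall n, L2 (u n)) -> L2 g -> L2cvg u g ->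
  (forall e, 0 < e -> exists N, forall m n, (N <= m)%N -> (N <= n)%N ->
     nsq (fun x => u m x - u n x) <= e).
Proof.
move=> lu lg /cvg0P H e e0.
(* [nsqB_tri] doubles each of the two squared distances. *)
have e40 : 0 < e / 4 by rewrite divr_gt0.
have [N HN] := H (fun n => nsq_ge0 _) _ e40.
exists N => m n Nm Nn.
apply: (le_trans (nsqB_tri (lu m) (lu n) lg)).
have := HN m Nm; have := HN n Nn; rewrite [X in X <= _ -> _]nsq_subC//.
by move: (nsq _) (nsq _) => a b; lra.
Qed.

End L2Complete.

(** * Completeness of the trigonometric system *)

Section TrigClosed.
Context {R : realType}.
Local Notation mu := (@lebesgue_measure R).
Variable w : R.
Implicit Types (m u : R -> R).

(* If all the trigonometric coefficients of [u] vanish, so do those of [u * m]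
   for [m] in this class, which is stable under bounded pointwise limits and hence
   contains the sign of a cosine, the indicators of arcs and, finally, those of
   Borel sets (up to periodicity). *)
Inductive tclosed : (R -> R) -> Prop :=
| tclosed_cst c : tclosed (fun=> c)
| tclosed_cos q : tclosed (fun x => cos (w * x + q))
| tclosedD m m' : tclosed m -> tclosed m' -> tclosed (fun x => m x + m' x)
| tclosedM m m' : tclosed m -> tclosed m' -> tclosed (fun x => m x * m' x)
| tclosed_lim (m_ : nat -> R -> R) m (M : R) : (forall n, tclosed (m_ n)) ->
    (forall n x, `|m_ n x| <= M) -> (forall x, m_ ^~ x @ \oo --> m x) -> tclosed m.

(** The free phase [p] covers sines and cosines at once, and is needed when the product with a
    shifted cosine is expanded. *)
Definition zero_coef u := mu.-integrable setT (EFin \o u) /\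
  forall (n : int) (p : R), \int[mu]_x (u x * cos (n%:~R * w * x + p)) = 0.

Lemma integrable_mul_bounded u m (M : R) : mu.-integrable setT (EFin \o u) ->
  measurable_fun setT m -> (forall x, `|m x| <= M) ->
  mu.-integrable setT (EFin \o (fun x => u x * m x)).
Proof.
move=> iu mm mM.
have mu' : measurable_fun setT u by have /integrableP[/measurable_EFinP] := iu.
have iM : mu.-integrable setT (EFin \o (fun x => M * `|u x|)).
  by apply: integrableZl'; exact: integrable_norm.
apply: (le_integrable measurableT _ _ iM).
  by apply/measurable_EFinP; exact: measurable_funM.
move=> x _ /=; rewrite lee_fin normrM mulrC [leRHS]ger0_norm.
  by rewrite ler_wpM2r.
by rewrite mulr_ge0// (le_trans _ (mM x)).
Qed.

Lemma measurable_cos_affine (a b : R) : measurable_fun setT (fun x => cos (a * x + b)).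
Proof.
apply: measurableT_comp; first exact: measurable_cos.
by apply: measurable_funD => //; exact: measurable_cst.
Qed.

Lemma tclosed_regular m : tclosed m ->
  measurable_fun setT m /\ exists M, forall x, `|m x| <= M.
Proof.
elim => {m}.
- by move=> c; split; [exact: measurable_cst|exists `|c|].
- by move=> q; split; [exact: measurable_cos_affine|exists 1 => x; exact: cos_max].
- move=> m m' _ [mm [M mM]] _ [mm' [M' mM']]; split; first exact: measurable_funD.
  by exists (M + M') => x; rewrite (le_trans (ler_normD _ _))// lerD.
- move=> m m' _ [mm [M mM]] _ [mm' [M' mM']]; split; first exact: measurable_funM.
  by exists (M * M') => x; rewrite normrM ler_pM.
- move=> m_ m M _ Hm mM mlim; split.
    apply: (measurable_fun_cvg (h := m_)) => [n|x _]; first by have [] := Hm n.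
    exact: mlim.
  exists M => x; have c : (fun n => `|m_ n x|) @ \oo --> `|m x| by exact: cvg_norm.
  rewrite -(cvg_lim (@Rhausdorff R) c).
  by apply: limr_le; [apply/cvg_ex; exists (`|m x|)|apply: nearW => n; exact: mM].
Qed.

(** By induction on [m]: multiplication by a cosine moves the frequency by 1 up and down, and a
    bounded limit is handled by dominated convergence with bound M |u|. *)
Lemma zero_coefM m : tclosed m -> forall u, zero_coef u -> zero_coef (fun x => u x * m x).
Proof.
elim => {m}.
- move=> c u [iu zu]; split.
    by apply: (@integrable_mul_bounded _ _ `|c|) => //; exact: measurable_cst.
  move=> n p; under eq_Rintegral do rewrite mulrAC mulrC.
  rewrite RintegralZl// ?zu ?mulr0//.
  apply: (@integrable_mul_bounded _ _ 1) => //; first exact: measurable_cos_affine.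
  by move=> x; exact: cos_max.
- move=> q u [iu zu]; split.
    apply: (@integrable_mul_bounded _ _ 1) => //; first exact: measurable_cos_affine.
    by move=> x; exact: cos_max.
  move=> n p.
  have ic k r : mu.-integrable setT (EFin \o (fun x => u x * cos (k * x + r))).
    apply: (@integrable_mul_bounded _ _ 1) => //; first exact: measurable_cos_affine.
    by move=> x; exact: cos_max.
  (* Product-to-sum formula for the two cosines. *)
  transitivity (\int[mu]_x (2^-1 * (u x * cos ((n + 1)%:~R * w * x + (q + p))) +
     2^-1 * (u x * cos ((n - 1)%:~R * w * x + (p - q))))).
    apply: eq_Rintegral => x _.
    have -> : (n + 1)%:~R * w * x + (q + p) = (n%:~R * w * x + p) + (w * x + q).
      by rewrite intrD; ring.
    have -> : (n - 1)%:~R * w * x + (p - q) = (n%:~R * w * x + p) - (w * x + q).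
      by rewrite intrB; ring.
    by move: (n%:~R * w * x + p) (w * x + q) => A B; rewrite cosD cosB; field.
  rewrite RintegralD//; [|exact: integrableZl'|exact: integrableZl'].
  by rewrite !RintegralZl// !zu !mulr0 addr0.
- move=> m m' tm IH tm' IH' u zu; have [im zm] := IH u zu; have [im' zm'] := IH' u zu.
  split.
    rewrite (_ : (fun x => _) = (fun x => u x * m x + u x * m' x)).
      exact: integrableD'.
    by apply/funext => x; rewrite mulrDr.
  move=> n p; under eq_Rintegral do rewrite mulrDr mulrDl.
  by rewrite RintegralD// ?zm ?zm' ?addr0//; apply: (@integrable_mul_bounded _ _ 1) => //;
    do ?[exact: measurable_cos_affine|move=> x; exact: cos_max].
- move=> m m' tm IH tm' IH' u zu; have := IH' _ (IH u zu).
  by rewrite (_ : (fun x => u x * (m x * m' x)) = (fun x => u x * m x * m' x))//;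
    apply/funext => x; rewrite mulrA.
- move=> m_ m M tm IH mM mlim u zu; have [iu _] := zu.
  have [mm [M' mM']] := tclosed_regular (tclosed_lim tm mM mlim).
  have [mM0] : measurable_fun setT u /\ True.
    by have /integrableP[/measurable_EFinP] := iu.
  split; first exact: (@integrable_mul_bounded _ _ M').
  move=> n p.
  have ig : mu.-integrable setT (EFin \o (fun x => M * `|u x|)).
    by apply: integrableZl'; exact: integrable_norm.
  have mc : measurable_fun setT (fun x => cos (n%:~R * w * x + p)) by exact: measurable_cos_affine.
  have m1 k : measurable_fun setT (fun x => (u x * m_ k x * cos (n%:~R * w * x + p))%:E).
    apply/measurable_EFinP; apply: measurable_funM => //; apply: measurable_funM => //.
    by have [] := tclosed_regular (tm k).
  have m2 : measurable_fun setT (fun x => (u x * m x * cos (n%:~R * w * x + p))%:E).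
    by apply/measurable_EFinP; apply: measurable_funM => //; exact: measurable_funM.
  have c1 : {ae mu, forall x, setT x ->
      (fun k => (u x * m_ k x * cos (n%:~R * w * x + p))%:E) @ \oo -->
      (u x * m x * cos (n%:~R * w * x + p))%:E}.
    apply: aeW => x _; apply: cvg_EFin; first exact: nearW.
    by apply: cvgMl; apply: cvgMr; exact: mlim.
  have d1 : {ae mu, forall x k, setT x ->
      (`|(u x * m_ k x * cos (n%:~R * w * x + p))%:E| <= (M * `|u x|)%:E)%E}.
    apply: aeW => x k _; rewrite lee_fin !normrM -[leRHS]mulr1 ler_pM ?mulr_ge0//.
      by rewrite mulrC ler_wpM2r.
    exact: cos_max.
  have [_ _] := dominated_convergence (mu := mu) measurableT m1 m2 c1 ig d1.
  rewrite /Rintegral (_ : [sequence _]_k = fun=> 0%E); last first.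
    apply/funext => k /=; have [ik zk] := IH k u zu.
    have := zk n p; rewrite /Rintegral => zk'.
    rewrite -[LHS]fineK ?zk'//; apply: integrable_fin_num => //.
    by apply: (@integrable_mul_bounded _ _ 1 ik mc) => x; exact: cos_max.
  move=> c0; rewrite -(cvg_lim _ c0)//.
  by rewrite lim_cst.
Qed.

(* The Newton-Schulz iteration, which converges to the sign on [-1, 1]. *)
Definition newton_sg (s : R) := s * (3 - s ^+ 2) / 2.

Lemma newton_sgN s : newton_sg (- s) = - newton_sg s.
Proof. by rewrite /newton_sg sqrrN !mulNr. Qed.

Lemma iter_newton_sgN k s : iter k newton_sg (- s) = - iter k newton_sg s.
Proof. by elim: k => //= k ->; exact: newton_sgN. Qed.

(** One iteration multiplies the distance to 1 by 1 - (t + t^2) / 2, which is at most 1 - s / 2 as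
    long as t >= s; this lower bound is preserved since the iterates increase on (0, 1]. *)
Lemma iter_newton_sg_bound (s : R) k : 0 < s <= 1 ->
  s <= iter k newton_sg s <= 1 /\ 1 - iter k newton_sg s <= (1 - s / 2) ^+ k.
Proof.
move=> /andP[s0 s1]; elim: k => [|k [/andP[st t1] IH]] /=.
  by rewrite lexx s1 expr0 gerBl ltW.
move: (iter k newton_sg s) st t1 IH => t st t1 IH.
have E : 1 - newton_sg t = (1 - t) * (1 - (t + t ^+ 2) / 2) by rewrite /newton_sg; field.
have t0 : 0 < t by exact: lt_le_trans st.
split; last first.
  rewrite E [leRHS]exprS [leRHS]mulrC; apply: ler_pM => //.
  - by rewrite subr_ge0.
  - by rewrite subr_ge0 ler_pdivrMr// mul1r -[2]/(1 + 1) lerD// expr_le1// ltW.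
  - by rewrite lerD2l lerN2 ler_wpM2r// (le_trans st)// lerDl sqr_ge0.
apply/andP; split.
  apply: (le_trans st); rewrite -subr_ge0.
  have -> : newton_sg t - t = t * ((1 - t) * (1 + t)) / 2 by rewrite /newton_sg; field.
  apply: divr_ge0 => //; apply: mulr_ge0; first exact: ltW.
  by apply: mulr_ge0; lra.
rewrite -subr_ge0 E mulr_ge0// subr_ge0// ler_pdivrMr// mul1r.
by rewrite -[2]/(1 + 1) lerD// expr_le1// ltW.
Qed.

Lemma cvg_newton_sg (s : R) : `|s| <= 1 -> (fun k => iter k newton_sg s) @ \oo --> Num.sg s.
Proof.
have pos t : 0 < t <= 1 -> (fun k => iter k newton_sg t) @ \oo --> (1 : R).
  move=> t01; have /andP[t0 t1] := t01.
  apply: (@squeeze_cvgr _ _ _ _ (fun k => 1 - (1 - t / 2) ^+ k) (fun=> 1)).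
  - apply: nearW => k; have [/andP[_ ->]] := iter_newton_sg_bound k t01.
    by rewrite andbT lerBlDr -lerBlDl.
  - rewrite -[X in _ --> X]subr0; apply: cvgB; first exact: cvg_cst.
    by apply: cvg_expr; rewrite ger0_norm; lra.
  - exact: cvg_cst.
move=> s1; have [s0|s0|->] := ltgtP s 0.
- rewrite ltr0_sg// -[s]opprK.
  under eq_cvg do rewrite iter_newton_sgN.
  apply: cvgN; apply: pos; rewrite oppr_gt0 s0/=.
  by rewrite (le_trans _ s1)// ler0_norm// ltW.
- by rewrite gtr0_sg//; apply: pos; rewrite s0 (le_trans (ler_norm _)).
- rewrite sgr0 (_ : (fun k => _) = fun=> 0); first exact: cvg_cst.
  by apply/funext; elim => //= k ->; rewrite /newton_sg !mul0r.
Qed.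

Lemma iter_newton_sg_norm k (s : R) : `|s| <= 1 -> `|iter k newton_sg s| <= 1.
Proof.
move=> s1; have [s0|s0|->] := ltgtP s 0.
- rewrite -[s]opprK iter_newton_sgN normrN.
  have s01 : 0 < - s <= 1 by rewrite oppr_gt0 s0 -[leLHS]ltr0_norm.
  have [/andP[a b] _] := iter_newton_sg_bound k s01.
  by rewrite ger0_norm// (le_trans _ a)// oppr_ge0 ltW.
- have s01 : 0 < s <= 1 by rewrite s0 -[leLHS]gtr0_norm.
  have [/andP[a b] _] := iter_newton_sg_bound k s01.
  by rewrite ger0_norm// (le_trans _ a)// ltW.
- by elim: k => [|k /= IH]; rewrite ?normr0//; move: IH; suff -> : iter k newton_sg 0 = 0;
    rewrite /newton_sg ?mul0r ?normr0//; elim: k => //= k ->; rewrite /newton_sg !mul0r.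
Qed.

Lemma tclosed_sg q : tclosed (fun x => Num.sg (cos (w * x + q))).
Proof.
apply: (@tclosed_lim (fun k x => iter k newton_sg (cos (w * x + q))) _ 1).
- elim => [|k IH] /=; first exact: tclosed_cos.
  rewrite /newton_sg; set t := fun x => iter k newton_sg _ in IH.
  rewrite (_ : (fun x => _) = (fun x => t x * ((fun=> 3 / 2) x +
     (fun=> - 2^-1) x * (t x * t x)))); last by apply/funext => x; rewrite /t; field.
  by do ?[apply: tclosedM|apply: tclosedD|apply: tclosed_cst|exact: IH].
- by move=> k x; apply: iter_newton_sg_norm; exact: cos_max.
- by move=> x; apply: cvg_newton_sg; exact: cos_max.
Qed.

End TrigClosed.

(** * Borel sets of a period whose indicators belong to the closed class *)

Section TrigSets.
Context {R : realType}.
Local Notation mu := (@lebesgue_measure R).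
Variables (a L : R).
Hypothesis L0 : 0 < L.
Let w := 2 * pi / L.

Definition tind (C : set R) := tclosed w (\1_C : R -> R).

Lemma tind_setT : tind setT.
Proof.
rewrite /tind (_ : \1_setT = fun=> 1); first exact: tclosed_cst.
by apply/funext => x; rewrite indicE in_setT.
Qed.

Lemma tindC C : tind C -> tind (~` C).
Proof.
move=> tC; rewrite /tind (_ : \1_(~` C) = (fun x => (fun=> 1) x + (fun=> -1) x * \1_C x :> R)).
  by apply: tclosedD; [|apply: tclosedM => //]; exact: tclosed_cst.
by apply/funext => x; rewrite !indicE in_setC; case: (x \in C) => /=; ring.
Qed.

Lemma tindI C D : tind C -> tind D -> tind (C `&` D).
Proof.
move=> tC tD; rewrite /tind (_ : \1_(C `&` D) = (fun x => \1_C x * \1_D x :> R)).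
  exact: tclosedM.
by apply/funext => x; rewrite !indicE in_setI; case: (x \in C); case: (x \in D) => /=; ring.
Qed.

Lemma tindU C D : tind C -> tind D -> tind (C `|` D).
Proof.
move=> tC tD; rewrite -[C `|` D]setCK setCU.
by apply: tindC; apply: tindI; exact: tindC.
Qed.

Lemma tind_bigcup (A : (set R)^nat) : (forall n, tind (A n)) -> tind (\bigcup_k A k).
Proof.
move=> tA.
apply: (@tclosed_lim _ _ (fun n => \1_(\big[setU/set0]_(k < n) A k)) _ 1).
- elim => [|n IH]; last by rewrite big_ord_recr/=; exact: tindU.
  by rewrite big_ord0 -setCT; apply: tindC; exact: tind_setT.
- by move=> n x; rewrite indicE; case: (_ \in _); rewrite ?normr1 ?normr0.
- move=> x; have [[k _ Akx]|nA] := pselect ((\bigcup_k A k) x).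
    apply: cvg_near_cst; near=> n; rewrite !indicE mem_set; last first.
      rewrite -bigcup_mkord; exists k => //=; near: n.
      exact: nbhs_infty_gt.
    by rewrite mem_set//; exists k.
  apply: cvg_near_cst; apply: nearW => n; rewrite !indicE memNset; last first.
    by rewrite -bigcup_mkord => -[k _ Akx]; apply: nA; exists k.
  by rewrite memNset.
Unshelve. all: by end_near. Qed.

(** The open half-period (c, c + L / 2), repeated with period [L]. *)
Definition arc (c : R) : set R := [set x | 0 < sin (w * (x - c))].

(** The indicator of s > 0 is (sg s + sg s ^ 2) / 2, and the sine is a shifted cosine. *)
Lemma tind_arc c : tind (arc c).
Proof.
pose q := - (w * c) - pi / 2.
have E x : sin (w * (x - c)) = cos (w * x + q).
  by rewrite -cosBpihalf; congr cos; rewrite /q; ring.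
rewrite /tind (_ : \1_(arc c) = (fun x => (fun=> 2^-1) x * (Num.sg (cos (w * x + q)) +
   Num.sg (cos (w * x + q)) * Num.sg (cos (w * x + q))) :> R)).
  by apply: tclosedM; [exact: tclosed_cst|apply: tclosedD; [|apply: tclosedM]; exact: tclosed_sg].
apply/funext => x; rewrite indicE -E /arc.
have [s0|s0|s0] := ltgtP (sin (w * (x - c))) 0.
- rewrite memNset ?ltr0_sg//=; first by ring.
  by rewrite ltNge (ltW s0).
- rewrite mem_set ?gtr0_sg//=.
  by rewrite mulr1 -[1 + 1]/2 mulVf.
- by rewrite s0 sgr0 memNset /= ?s0 ?ltxx// mul0r addr0 mulr0.
Qed.

Lemma arc_in c x : 0 < x - c < L / 2 -> arc c x.
Proof.
move=> /andP[d0 dL]; apply: sin_gt0_pi; rewrite /w; apply/andP; split.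
  by rewrite mulr_gt0// divr_gt0// mulr_gt0// pi_gt0.
rewrite [ltRHS](_ : pi = 2 * pi / L * (L / 2)); last by field; rewrite gt_eqF.
by rewrite ltr_pM2l// divr_gt0// mulr_gt0// pi_gt0.
Qed.

Lemma arc_notin c x : - (L / 2) <= x - c <= 0 -> ~ arc c x.
Proof.
move=> /andP[dL d0]; rewrite /arc /=; apply/negP; rewrite -leNgt.
rewrite -[x - c]opprK mulrN sinN oppr_le0; apply: sin_ge0_pi.
have w0 : 0 < w by rewrite /w divr_gt0// mulr_gt0// pi_gt0.
rewrite mulr_ge0 ?oppr_ge0 ?(ltW w0)//=.
rewrite [leRHS](_ : pi = w * (L / 2)); last by rewrite /w; field; rewrite gt_eqF.
by rewrite ler_pM2l// lerNl.
Qed.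

(** The functions of the class are [L]-periodic, so that only the trace of [B] on one period can be
    described. *)
Definition arcset (B : set R) := exists C, tind C /\
  forall x, a <= x < a + L -> (C x <-> B x).

(** On the period, the ray is a union of two half-period arcs if [c] lies in the first half and an
    intersection of two if it lies in the second half. *)
Lemma arcset_ray c : arcset `]c, +oo[%classic.
Proof.
have [ca|ac|ca] := ltgtP c a.
- exists setT; split; first exact: tind_setT.
  by move=> x /andP[ax _]; split => // _; rewrite /= in_itv/= andbT (lt_le_trans ca).
- have [cL|Lc] := ltP c (a + L); last first.
    exists set0; split; first by rewrite -setCT; apply: tindC; exact: tind_setT.
    move=> x /andP[_ xL]; split => //; rewrite /= in_itv/= andbT => cx.
    by have := lt_trans (le_lt_trans Lc cx) xL; rewrite ltxx.
  have [cL2|L2c] := ltP c (a + L / 2).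
    exists (arc c `|` arc (a + L / 2)); split.
      by apply: tindU; exact: tind_arc.
    move=> x /andP[ax xL]; rewrite /= in_itv/= andbT; split.
      move=> H; rewrite ltNge; apply/negP => xc; case: H; apply: arc_notin; lra.
    move=> cx; have [h|h] := ltP x (c + L / 2).
      by left; apply: arc_in; lra.
    by right; apply: arc_in; lra.
  exists (arc (a + L / 2) `&` arc c); split.
    by apply: tindI; exact: tind_arc.
  move=> x /andP[ax xL]; rewrite /= in_itv/= andbT; split.
    move=> [H1 H2]; rewrite ltNge; apply/negP => xc.
    have [h|h] := leP x (a + L / 2); first by apply: arc_notin H1; lra.
    by apply: arc_notin H2; lra.
  by move=> cx; split; apply: arc_in; lra.
(* The first two arcs miss the midpoint a + L / 2, which the third one covers. *)
- exists (arc a `|` arc (a + L / 2) `|` arc (a + L / 4)); split.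
    by apply: tindU; [apply: tindU|]; exact: tind_arc.
  move=> x /andP[ax xL]; rewrite /= in_itv/= andbT ca; split.
    move=> H; rewrite ltNge; apply/negP => xa.
    by case: H => [[|]|]; apply: arc_notin; lra.
  move=> xa; have [h|h|h] := ltgtP x (a + L / 2).
  + by left; left; apply: arc_in; lra.
  + by left; right; apply: arc_in; lra.
  + by right; apply: arc_in; lra.
Qed.

(** The sets with this property form a sigma-algebra containing the open rays, which generate the
    Borel sets. *)
Lemma arcset_measurable (B : set R) : measurable B -> arcset B.
Proof.
move=> mB; have {mB} : (@RGenOInfty.G R).-sigma.-measurable B.
  by rewrite -RGenOInfty.measurableE.
move: B; apply: smallest_sub; last first.
  by move=> _ [c ->]; exact: arcset_ray.
split.
- exists set0; split => //; rewrite -setCT; apply: tindC; exact: tind_setT.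
- move=> B [C [tC CB]]; exists (~` C); split; first exact: tindC.
  by move=> x /CB CBx; rewrite setTD /setC/= CBx.
- move=> A /choice[C HC]; exists (\bigcup_k C k); split.
    by apply: tind_bigcup => n; have [] := HC n.
  move=> x xI; split => -[k _ kx]; exists k => //.
    by have [_ /(_ x xI) <-] := HC k.
  by have [_ /(_ x xI) ->] := HC k.
Qed.

(** The coefficient of frequency 0 and phase 0 of [u] times the indicator of a set is the integral
    of [u] on that set. All these integrals vanish, hence so does [u]. *)
Lemma zero_coef_ae (u : R -> R) : zero_coef w u ->
  (forall x, ~ (a <= x < a + L) -> u x = 0) -> {ae mu, forall x, u x = 0}.
Proof.
move=> zu uI; have [iu _] := zu.
have mc : measurable_fun setT (cst 0%E : R -> \bar R) by exact: measurable_cst.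
have H : forall E, E `<=` setT -> measurable E ->
    (\int[mu]_(x in E) (EFin \o u) x = \int[mu]_(x in E) (cst 0) x)%E.
  move=> E _ mE; rewrite integral0.
  have [C [tC CE]] := arcset_measurable mE.
  have [iuC zuC] := zero_coefM tC zu.
  have := zuC 0 0; rewrite /Rintegral.
  under eq_integral do rewrite mulr0z !mul0r addr0 cos0 mulr1.
  move=> z; rewrite integral_mkcond -[LHS]fineK; last first.
    rewrite -integral_mkcond; apply: integrable_fin_num => //.
    exact: integrableS iu.
  transitivity (fine (\int[mu]_x (u x * \1_C x)%:E))%:E; last by rewrite z.
  congr (_%:E); congr fine; apply: eq_integral => x _.
  rewrite patchE indicE; have [xI|xI] := pselect (a <= x < a + L).
    have [Ex|Ex] := pselect (E x).
      by rewrite !mem_set ?mulr1//; apply/CE.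
    by rewrite !memNset ?mulr0//; apply/CE.
  by rewrite [in RHS]uI// mul0r; case: ifP => // _ /=; rewrite uI.
have := integral_ae_eq measurableT iu mc H.
by apply: filterS => x /(_ I) [].
Qed.

End TrigSets.

Lemma realC_inv (R : realType) (r : R) : (r%:C)^-1 = (r^-1)%:C :> R[i].
Proof.
have [->|r0] := eqVneq r 0; first by rewrite rmorph0 !invr0 rmorph0.
have rC : r%:C != 0 :> R[i] by apply/eqP => -[] /eqP; apply/negP.
by apply: (mulfI rC); rewrite divff// -rmorphM/= divff.
Qed.

(** * Fourier series *)

Section TrigIntegrals.
Context {R : realType}.
Local Notation mu := (@lebesgue_measure R).

Lemma expi_nat2pi (n : nat) : expi (n%:R * (2 * pi)) = 1 :> R[i].
Proof.
elim: n => [|n IH]; first by rewrite mul0r expi0.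
rewrite -natr1 mulrDl mul1r expiD IH mul1r /expi mulr_natl cos2pi sin2pi.
by [].
Qed.

Lemma expi_int2pi (n : int) : expi (n%:~R * (2 * pi)) = 1 :> R[i].
Proof.
case: n => n; first exact: expi_nat2pi.
by rewrite NegzE mulrNz mulNr expiN expi_nat2pi; apply: complex_eqP; rewrite /= ?oppr0.
Qed.

Lemma expi_periodic (n : int) (x : R) : expi (x + n%:~R * (2 * pi)) = expi x.
Proof. by rewrite expiD expi_int2pi mulr1. Qed.

Lemma integral_deriv_itv (F f : R -> R) (a b : R) : a < b -> continuous f ->
  (forall x : R, is_derive x (1 : R) F (f x)) ->
  (\int[mu]_(x in `[a, b[) (f x)%:E = (F b - F a)%:E)%E.
Proof.
move=> ab cf dF.
have cF : continuous F.
  move=> x; apply: differentiable_continuous; apply/derivable1_diffP.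
  by have [] := dF x.
rewrite integral_itv_bndo_bndc; last first.
  apply/measurable_EFinP; apply: measurable_funTS; exact: continuous_measurable_fun.
rewrite (@continuous_FTC2 _ _ F)//.
- by apply: continuous_subspaceT.
- split.
  + by move=> x _; have [] := dF x.
  + by apply: cvg_at_right_filter; exact: cF.
  + by apply: cvg_at_left_filter; exact: cF.
- by move=> x _; rewrite derive1E; have [_ ->] := dF x.
Qed.

Lemma is_derive_sin_affine (c x : R) : c != 0 ->
  is_derive x (1 : R) (fun y => c^-1 * sin (c * y)) (cos (c * x)).
Proof.
move=> c0.
have h : is_derive x (1 : R) (c \*: (@id R)) c.
  by apply: is_derive_eq; rewrite /GRing.scale/= mulr1.
have h2 := @is_derive1_comp R sin (c \*: (@id R)) x _ _ (is_derive_sin _) h.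
apply: (@is_derive_eq _ _ _ _ _ _ _ _ (is_deriveZ c^-1 h2)).
by rewrite /GRing.scale/= mulrCA mulVf// mulr1.
Qed.

Lemma is_derive_cos_affine (c x : R) : c != 0 ->
  is_derive x (1 : R) (fun y => - c^-1 * cos (c * y)) (sin (c * x)).
Proof.
move=> c0.
have h : is_derive x (1 : R) (c \*: (@id R)) c.
  by apply: is_derive_eq; rewrite /GRing.scale/= mulr1.
have h2 := @is_derive1_comp R cos (c \*: (@id R)) x _ _ (is_derive_cos _) h.
apply: (@is_derive_eq _ _ _ _ _ _ _ _ (is_deriveZ (- c^-1) h2)).
by rewrite /GRing.scale/= !mulNr mulrN opprK mulrCA mulVf// mulr1.
Qed.

Lemma continuous_trig_affine (c : R) :
  continuous (fun x : R => cos (c * x)) /\ continuous (fun x : R => sin (c * x)).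
Proof.
by split=> x; apply: continuous_comp; do ?[exact: mulrl_continuous |
  exact: continuous_cos|exact: continuous_sin].
Qed.

Lemma Rintegral_indic_mul (A : set R) (u : R -> R) :
  \int[mu]_x (\1_A x * u x) = fine (\int[mu]_(x in A) (u x)%:E)%E.
Proof.
rewrite /Rintegral [in RHS]integral_mkcond; congr fine; apply: eq_integral => x _.
by rewrite patchE indicE; case: ifP; rewrite ?mul1r ?mul0r.
Qed.

End TrigIntegrals.

(** * Orthogonality, convergence of Fourier series and Parseval on an interval *)

Section FourierSeries.
Context {R : realType}.
Local Notation mu := (@lebesgue_measure R).
Variables (a L : R).
Hypothesis L0 : 0 < L.
Let w := 2 * pi / L.
Let I : set R := `[a, a + L[%classic.
Implicit Types (f g : R -> R[i]) (n m : int) (s t : seq int).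

Definition fexp n (x : R) : R[i] := expi (n%:~R * w * x).
(** Orthogonal but not normalized: the squared norm is [L], whence the divisions by [L] in the sums
    and energies. *)
Definition fbasis n (x : R) : R[i] := (\1_I x)%:C * fexp n x.

Lemma fexp_period n x (k : int) : fexp n (x + k%:~R * L) = fexp n x.
Proof.
rewrite /fexp -[RHS](expi_periodic (n * k)); congr expi.
by rewrite /w intrM; field; rewrite gt_eqF.
Qed.

Lemma fexpM n m x : fexp n x * conjc (fexp m x) = fexp (n - m) x.
Proof.
by rewrite /fexp -expiN -expiD; congr expi; rewrite intrB; ring.
Qed.

Lemma measurable_I : measurable I. Proof. exact: measurable_itv. Qed.

Lemma cmeasurable_fexp n : cmeasurable (fexp n).
Proof. by apply: cmeasurable_expi; apply: measurable_funM => //; exact: measurable_cst. Qed.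

Lemma cmeasurable_fbasis n : cmeasurable (fbasis n).
Proof.
by apply: cmeasurableM; [exact: cmeasurable_indic measurable_I|exact: cmeasurable_fexp].
Qed.

Lemma integrable_indicI : mu.-integrable setT (EFin \o (\1_I : R -> R)).
Proof. exact: integrable_indic_itv. Qed.

Lemma L2_fbasis n : L2 (fbasis n).
Proof.
apply: (L2_dom (cmeasurable_fbasis n) integrable_indicI).
apply: aeW => x; rewrite /fbasis normcM exprMn normc2_expi mulr1 normcC indicE.
by case: (_ \in _); rewrite ?normr1 ?expr1n ?normr0 ?expr0n.
Qed.

(** For a nonzero frequency the primitives of the cosine and sine are [L]-periodic and thus agree at
    both ends of the interval. *)
Lemma cintegral_fbasis n : cintegral (fbasis n) = if n == 0 then L%:C else 0.
Proof.
have aL : a < a + L by rewrite ltrDl.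
have [cc cs] := continuous_trig_affine (n%:~R * w).
rewrite /cintegral /fbasis /fexp; apply: complex_eqP => /=.
  under eq_Rintegral do rewrite mul0r subr0.
  rewrite Rintegral_indic_mul /=; have [->|n0] := eqVneq n 0.
    under eq_integral do rewrite mulr0z !mul0r cos0.
    rewrite integral_cst/=; last exact: measurable_I.
    rewrite mul1e /I lebesgue_measure_itv/= lte_fin aL -EFinD.
    by rewrite /= addrAC subrr add0r.
  have w0 : n%:~R * w != 0.
    by rewrite mulf_neq0 ?intr_eq0// gt_eqF// divr_gt0// mulr_gt0// pi_gt0.
  rewrite (integral_deriv_itv aL cc (fun x => is_derive_sin_affine x w0))/=.
  suff -> : sin (n%:~R * w * (a + L)) = sin (n%:~R * w * a) by rewrite subrr.
  by have := fexp_period n a 1; rewrite mul1r => -[].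
under eq_Rintegral do rewrite mul0r addr0.
rewrite Rintegral_indic_mul /=; have [->|n0] := eqVneq n 0.
  under eq_integral do rewrite mulr0z !mul0r sin0.
  by rewrite integral0.
have w0 : n%:~R * w != 0.
  by rewrite mulf_neq0 ?intr_eq0// gt_eqF// divr_gt0// mulr_gt0// pi_gt0.
rewrite (integral_deriv_itv aL cs (fun x => is_derive_cos_affine x w0))/=.
suff -> : cos (n%:~R * w * (a + L)) = cos (n%:~R * w * a) by rewrite subrr.
by have := fexp_period n a 1; rewrite mul1r => -[].
Qed.

Lemma inner_fbasis n m : inner (fbasis n) (fbasis m) = if n == m then L%:C else 0.
Proof.
rewrite -subr_eq0 -cintegral_fbasis innerE; congr cintegral; apply/funext => x.
rewrite /fbasis conjM conjc_real mulrACA fexpM -rmorphM/=; congr (_%:C * _).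
by rewrite indicE; case: (_ \in _); rewrite ?mulr1 ?mulr0.
Qed.

Definition fcoef f n := inner f (fbasis n).
Definition fsum f s x := \sum_(n <- s) fcoef f n / L%:C * fbasis n x.
Definition fenergy f s : R := \sum_(n <- s) normc (fcoef f n) ^+ 2.

Lemma L2_fsum f s : L2 (fsum f s).
Proof. by apply: L2_sum => n _; apply: L2Z; exact: L2_fbasis. Qed.

Lemma LC0 : L%:C != 0 :> R[i].
Proof. by apply/eqP => -[] /eqP; rewrite gt_eqF. Qed.

Lemma inner_fsum f s m : L2 f -> uniq s ->
  inner (fsum f s) (fbasis m) = if m \in s then fcoef f m else 0.
Proof.
move=> lf us; rewrite inner_suml; last 2 first.
- by move=> n _; apply: L2Z; exact: L2_fbasis.
- exact: L2_fbasis.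
under eq_bigr => n _.
  rewrite innerZl; [|exact: L2_fbasis|exact: L2_fbasis].
  rewrite inner_fbasis (_ : _ * _ = if n == m then fcoef f n else 0); last first.
    by case: ifP => _; rewrite ?mulr0// divfK// LC0.
  over.
rewrite -big_mkcond/= -big_filter; case: ifPn => ms.
  by rewrite filter_pred1_uniq// big_seq1.
rewrite big_filter big1_seq// => n /andP[/eqP -> ns].
by rewrite ns in ms.
Qed.

Lemma inner_fsumr f g s : L2 f -> L2 g ->
  inner g (fsum f s) = \sum_(n <- s) conjc (fcoef f n / L%:C) * fcoef g n.
Proof.
move=> lf lg; rewrite innerJ//; last exact: L2_fsum.
rewrite inner_suml//; last by move=> n _; apply: L2Z; exact: L2_fbasis.
rewrite conj_sum; apply: eq_bigr => n _; rewrite innerZl//; last exact: L2_fbasis.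
rewrite (conjM (_ / _)); congr (_ * _); rewrite /fcoef.
by apply/esym/innerJ => //; exact: L2_fbasis.
Qed.

Lemma fsum_energy f s : \sum_(n <- s) conjc (fcoef f n / L%:C) * fcoef f n =
  (fenergy f s / L)%:C.
Proof.
rewrite /fenergy mulr_suml rmorph_sum; apply: eq_bigr => n _.
rewrite realC_inv; move: (fcoef f n) => z; apply: complex_eqP.
  by rewrite !reimE normc2E; ring.
by rewrite !reimE; ring.
Qed.

Lemma nsq_fsum f s : L2 f -> uniq s -> nsq (fsum f s) = fenergy f s / L.
Proof.
move=> lf us; apply: complexI; rewrite -inner_nsq; last exact: L2_fsum.
rewrite inner_fsumr//; last exact: L2_fsum.
rewrite -fsum_energy; apply: eq_big_seq => n ns; congr (_ * _).
by rewrite /fcoef inner_fsum// ns.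
Qed.

Lemma nsq_sub_fsum f s : L2 f -> uniq s ->
  nsq (fun x => f x - fsum f s x) = nsq f - fenergy f s / L.
Proof.
move=> lf us; have ls := L2_fsum f s.
rewrite nsqB// nsq_fsum// inner_fsumr// fsum_energy cReC; ring.
Qed.

Lemma bessel f s : L2 f -> uniq s -> fenergy f s <= L * nsq f.
Proof.
move=> lf us; have := nsq_ge0 (fun x => f x - fsum f s x).
by rewrite nsq_sub_fsum// subr_ge0 ler_pdivrMr// mulrC.
Qed.

Lemma fenergy_sub f s t : uniq s -> uniq t -> {subset s <= t} ->
  fenergy f s <= fenergy f t.
Proof.
move=> us ut st.
have p : perm_eq t (s ++ [seq n <- t | n \notin s]).
  apply: uniq_perm => //.
    rewrite cat_uniq us filter_uniq// andbT/=; apply/hasPn => n.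
    by rewrite mem_filter => /andP[].
  move=> n; rewrite mem_cat mem_filter; case: (boolP (n \in s)) => //= /st ->//.
rewrite /fenergy (perm_big _ p) big_cat/= lerDl; apply: sumr_ge0 => n _.
exact: sqr_ge0.
Qed.

Lemma nsq_fsum_sub f s t : L2 f -> uniq s -> uniq t -> {subset s <= t} ->
  nsq (fun x => fsum f t x - fsum f s x) = (fenergy f t - fenergy f s) / L.
Proof.
move=> lf us ut st.
set r := [seq n <- t | n \notin s].
have p : perm_eq t (s ++ r).
  apply: uniq_perm => //.
    rewrite cat_uniq us filter_uniq// andbT/=; apply/hasPn => n.
    by rewrite mem_filter => /andP[].
  move=> n; rewrite mem_cat mem_filter; case: (boolP (n \in s)) => //= /st ->//.
rewrite (_ : (fun x => _) = fsum f r); last first.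
  apply/funext => x; rewrite /fsum (perm_big _ p) big_cat/= addrAC subrr add0r//.
by rewrite nsq_fsum ?filter_uniq// /fenergy (perm_big _ p) big_cat/= addrAC subrr add0r.
Qed.

(** The integers from -N to N - 1, as [Negz i] is -(i + 1). This asymmetric range matches half-open
    tilings, and [int_range 2] gives the four shifts of the pre-Gramian. *)
Definition int_range (N : nat) : seq int :=
  [seq Posz i | i <- iota 0 N] ++ [seq Negz i | i <- iota 0 N].

Lemma mem_int_range N n : (n \in int_range N) =
  match n with Posz k => (k < N)%N | Negz k => (k < N)%N end.
Proof.
rewrite mem_cat; case: n => k.
  rewrite mem_map; last by move=> ? ? [].
  rewrite mem_iota add0n/= orbC; case: (boolP (_ \in _)) => // /mapP[j _ //].
rewrite [X in _ || X]mem_map; last by move=> ? ? [].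
by rewrite mem_iota add0n/=; case: (boolP (_ \in _)) => // /mapP[j _ //].
Qed.

Lemma uniq_int_range N : uniq (int_range N).
Proof.
rewrite cat_uniq !map_inj_uniq ?iota_uniq/= ?andbT; try by move=> ? ? [].
by apply/hasPn => _ /mapP[j _ ->]; apply/mapP => -[].
Qed.

Lemma sub_int_range N M : (N <= M)%N -> {subset int_range N <= int_range M}.
Proof.
by move=> NM n; rewrite !mem_int_range; case: n => k kN; exact: leq_trans NM.
Qed.

(** The squared distance of two nested partial sums is the difference of their energies over [L],
    and the energies increase and are bounded by Bessel's inequality. *)
Lemma fsum_cauchy f : L2 f ->
  (forall e, 0 < e -> exists N, forall m n : nat, (N <= m)%N -> (N <= n)%N ->
     nsq (fun x => fsum f (int_range m) x - fsum f (int_range n) x) <= e).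
Proof.
move=> lf.
pose B N := fenergy f (int_range N).
have Bnd : nondecreasing_seq B.
  move=> N M NM; apply: fenergy_sub; [exact: uniq_int_range..|exact: sub_int_range].
have cB : cvgn B.
  apply: nondecreasing_is_cvgn => //; exists (L * nsq f) => _ [N _ <-].
  by apply: bessel => //; exact: uniq_int_range.
have sB : forall N, B N <= limn B by exact: nondecreasing_cvgn_le.
move=> e e0; move/cvgrPdist_le : cB => /(_ (e * L)).
have eL : 0 < e * L by rewrite mulr_gt0.
move=> /(_ eL)[N _ HN]; exists N.
have main i j : (N <= i)%N -> (i <= j)%N ->
    nsq (fun x => fsum f (int_range j) x - fsum f (int_range i) x) <= e.
  move=> Ni ij; rewrite nsq_fsum_sub ?uniq_int_range//; last exact: sub_int_range.
  rewrite ler_pdivrMr// -/(B i) -/(B j).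
  have := HN i Ni; rewrite /= ger0_norm ?subr_ge0//; apply: le_trans.
  by rewrite lerD2r.
move=> i j Ni Nj; have [ij|/ltnW ji] := leqP i j; last exact: main.
by rewrite nsq_subC; [exact: main|exact: L2_fsum|exact: L2_fsum].
Qed.

Lemma L2_supp_cintegrable f : L2 f -> (forall x, ~ I x -> f x = 0) ->
  cintegrable f.
Proof.
move=> lf fI; have [mf _] := lf.
apply: (@cintegrable_dom _ _ (fun x => \1_I x + normc (f x) ^+ 2)) => //.
  by apply: integrableD'; [exact: integrable_indicI|exact: L2_integrable].
move=> x; have [Ix|Ix] := pselect (I x).
  by rewrite indicE mem_set//; have := normr_amgm ltr01 (normc_ge0 (f x)); rewrite invr1 mul1r.
by rewrite fI// normc0 indicE memNset// expr0n addr0.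
Qed.

(** The coefficients mix the real and imaginary parts of [f]. Comparing the frequencies [n] and
    [- n], where the cosine integrals [A] and [C] are even and the sine integrals [B] and [D] are
    odd, separates them, and both parts fall under [zero_coef_ae]. *)
Lemma fcoef0_ae f : L2 f -> (forall x, ~ I x -> f x = 0) ->
  (forall n, fcoef f n = 0) -> {ae mu, forall x, f x = 0}.
Proof.
move=> lf fI f0; have [mf _] := lf; have [mf1 mf2] := mf.
have cf := L2_supp_cintegrable lf fI.
pose A n := \int[mu]_x (complex.Re (f x) * cos (n%:~R * w * x)).
pose B n := \int[mu]_x (complex.Re (f x) * sin (n%:~R * w * x)).
pose C n := \int[mu]_x (complex.Im (f x) * cos (n%:~R * w * x)).
pose D n := \int[mu]_x (complex.Im (f x) * sin (n%:~R * w * x)).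
have mcos n : measurable_fun setT (fun x : R => cos (n%:~R * w * x)).
  by have [c _] := continuous_trig_affine (n%:~R * w); exact: continuous_measurable_fun.
have msin n : measurable_fun setT (fun x : R => sin (n%:~R * w * x)).
  by have [_ c] := continuous_trig_affine (n%:~R * w); exact: continuous_measurable_fun.
have [c1 c2] := cf.
have iA n := integrable_mul_bounded c1 (mcos n) (fun x => cos_max _).
have iB n := integrable_mul_bounded c1 (msin n) (fun x => sin_max _).
have iC n := integrable_mul_bounded c2 (mcos n) (fun x => cos_max _).
have iD n := integrable_mul_bounded c2 (msin n) (fun x => sin_max _).
have eq1 n : A n + D n = 0 /\ C n - B n = 0.
  have := f0 n; rewrite /fcoef innerE (_ : (fun x => _) = (fun x => f x * conjc (fexp n x))).
    case=> H1 H2; split.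
      rewrite -H1 /A /D -RintegralD//; apply: eq_Rintegral => x _.
      by rewrite /fexp /expi; case: (f x) => u v /=; ring.
    rewrite -H2 /C /B -RintegralB//; apply: eq_Rintegral => x _.
    by rewrite /fexp /expi; case: (f x) => u v /=; ring.
  apply/funext => x; rewrite /fbasis conjM conjc_real.
  have [Ix|Ix] := pselect (I x); first by rewrite indicE mem_set// mul1r.
  by rewrite fI// !mul0r.
have symc n : A (- n) = A n /\ C (- n) = C n.
  by split; apply: eq_Rintegral => x _; rewrite mulrNz !mulNr cosN.
have syms n : B (- n) = - B n /\ D (- n) = - D n.
  split; rewrite -[RHS]mulN1r -RintegralZl//; apply: eq_Rintegral => x _;
    by rewrite mulrNz !mulNr sinN; ring.
have allz n : [/\ A n = 0, B n = 0, C n = 0 & D n = 0].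
  have [e1 e2] := eq1 n; have := eq1 (- n).
  have [-> ->] := symc n; have [-> ->] := syms n => -[e3 e4].
  by split; lra.
have phase (u : R -> R) (P Q : int -> R) :
    mu.-integrable setT (EFin \o u) ->
    (forall n, \int[mu]_x (u x * cos (n%:~R * w * x)) = 0) ->
    (forall n, \int[mu]_x (u x * sin (n%:~R * w * x)) = 0) -> zero_coef w u.
  move=> iu uc us; split => // n p.
  have i1 := integrable_mul_bounded iu (mcos n) (fun x => cos_max _).
  have i2 := integrable_mul_bounded iu (msin n) (fun x => sin_max _).
  transitivity (\int[mu]_x (cos p * (u x * cos (n%:~R * w * x)) -
                           sin p * (u x * sin (n%:~R * w * x)))).
    by apply: eq_Rintegral => x _; rewrite cosD; ring.
  rewrite RintegralB//; [|exact: integrableZl'|exact: integrableZl'].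
  by rewrite !RintegralZl// uc us !mulr0 subrr.
have zr : {ae mu, forall x, complex.Re (f x) = 0}.
  apply: (@zero_coef_ae _ a L L0).
    by apply: (phase _ A B) => // n; have [] := allz n.
  by move=> x xI; rewrite fI// => Ix; apply: xI; move: Ix; rewrite /I/= in_itv.
have zi : {ae mu, forall x, complex.Im (f x) = 0}.
  apply: (@zero_coef_ae _ a L L0).
    by apply: (phase _ C D) => // n; have [] := allz n.
  by move=> x xI; rewrite fI// => Ix; apply: xI; move: Ix; rewrite /I/= in_itv.
by apply: filterS2 zr zi => x r i; exact: complex_eqP.
Qed.

Lemma L2cvg_shift (u : nat -> R -> R[i]) g (N : nat) :
  L2cvg u g -> L2cvg (fun n : nat => u (n + N)%N) g.
Proof.
by move=> ug; rewrite /L2cvg (cvg_shiftn N (fun n : nat => nsq (fun x => u n x - g x))).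
Qed.

Lemma L2cvg_cst g : L2cvg (fun=> g) g.
Proof.
rewrite /L2cvg (_ : (fun=> _) = fun=> 0); first exact: cvg_cst.
apply/funext => _; rewrite -[RHS](@nsq0 R); congr nsq.
by apply/funext => x; rewrite subrr.
Qed.

(** The partial sums converge by completeness. Each coefficient of the partial sums is eventually
    that of [f], so the limit has the coefficients of [f] and equals it almost everywhere. *)
Lemma fsum_cvg f : L2 f -> (forall x, ~ I x -> f x = 0) ->
  L2cvg (fun N => fsum f (int_range N)) f.
Proof.
move=> lf fI.
have lS N : L2 (fsum f (int_range N)) by exact: L2_fsum.
have [g0 [lg0 Sg0]] := L2_complete lS (fsum_cauchy lf).
(* The limit is only known up to null sets, while [fcoef0_ae] asks for exact vanishing outside of
   the interval. *)
pose g x := (\1_I x)%:C * g0 x.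
have lg : L2 g by apply: L2_indic_mul => //; exact: measurable_I.
have Sg : L2cvg (fun N => fsum f (int_range N)) g.
  have h1 : {ae mu, forall x, normc (\1_I x)%:C ^+ 2 <= 1 :> R}.
    by apply: aeW => x; exact: normc2_indic.
  have E : (fun N x => (\1_I x)%:C * fsum f (int_range N) x) =
      (fun N => fsum f (int_range N)).
    apply/funext => N; apply/funext => x.
    rewrite /fsum mulr_sumr; apply: eq_bigr => n _; rewrite mulrCA; congr (_ * _).
    rewrite /fbasis mulrA -rmorphM/=; congr (_%:C * _).
    by rewrite indicE; case: (_ \in _); rewrite ?mulr1 ?mulr0.
  rewrite -E; exact: L2cvg_mul (cmeasurable_indic measurable_I) ler01 h1 lS lg0 Sg0.
have H : {ae mu, forall x, g x - f x = 0}.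
  apply: fcoef0_ae; first exact: L2B.
    by move=> x Ix; rewrite fI// /g indicE memNset// mul0r subr0.
  move=> n; rewrite /fcoef innerBl//; last exact: L2_fbasis.
  apply/eqP; rewrite subr_eq0; apply/eqP.
  have [N0 HN0] : exists N0, forall N, (N0 <= N)%N -> n \in int_range N.
    by exists (absz n).+1 => N; rewrite mem_int_range; case: n => k /=; rewrite ?absz_nat// => /ltnW.
  have E N : inner (fsum f (int_range (N + N0))) (fbasis n) = inner f (fbasis n).
    by rewrite inner_fsum ?uniq_int_range// HN0// leq_addl.
  have lb := L2_fbasis n.
  exact: (inner_lim_eq (fun N => lS (N + N0)%N) (fun=> lb) (fun=> lf) (fun=> lb)
    lg lb lf lb (L2cvg_shift N0 Sg) (L2cvg_cst _) (L2cvg_cst _) (L2cvg_cst _) E).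
rewrite /L2cvg (_ : (fun N => _) = (fun N => nsq (fun x => fsum f (int_range N) x - g x)))//.
apply/funext => N; apply: nsq_ae.
- by apply: cmeasurableB; [case: (lS N)|case: lf].
- by apply: cmeasurableB; [case: (lS N)|case: lg].
- by apply: filterS H => x /eqP; rewrite subr_eq0 => /eqP ->.
Qed.

(** The squared error is |f|^2 minus an energy over [L], and the energy grows with the set of
    indices: any larger set does at least as well as [int_range N]. *)
Lemma fsum_uncond f : L2 f -> (forall x, ~ I x -> f x = 0) ->
  forall e, 0 < e -> exists N, forall s, uniq s -> {subset int_range N <= s} ->
    nsq (fun x => f x - fsum f s x) <= e.
Proof.
move=> lf fI e e0.
have /cvg0P H := fsum_cvg lf fI.
have [N HN] := H (fun n : nat => nsq_ge0 _) e e0.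
exists N => s us Ns; have := HN N (leqnn _); apply: le_trans.
rewrite nsq_subC//; last exact: L2_fsum.
rewrite !nsq_sub_fsum// ?uniq_int_range// lerD2l lerN2 ler_pM2r ?invr_gt0//.
by apply: fenergy_sub => //; exact: uniq_int_range.
Qed.

Lemma parseval f : L2 f -> (forall x, ~ I x -> f x = 0) ->
  (\esum_(n in [set: int]) (normc (fcoef f n) ^+ 2)%:E = (L * nsq f)%:E)%E.
Proof.
move=> lf fI; apply/eqP; rewrite eq_le; apply/andP; split.
  apply: ub_ereal_sup => _ [A [fA _] <-].
  rewrite fsbig_finite//= sumEFin lee_fin; apply: bessel => //; exact: fset_uniq.
apply/lee_addgt0Pr => e e0.
have eL : 0 < e / L by rewrite divr_gt0.
have [N HN] := fsum_uncond lf fI eL.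
have := HN _ (uniq_int_range N) (fun _ h => h).
rewrite nsq_sub_fsum ?uniq_int_range// lerBlDr => H.
apply: (@le_trans _ _ (fenergy f (int_range N) + e)%:E).
  rewrite lee_fin; have : L * nsq f <= L * (e / L + fenergy f (int_range N) / L).
    by rewrite ler_pM2l.
  by rewrite mulrDr ![L * (_ / L)]mulrC !divfK ?gt_eqF// addrC.
rewrite EFinD leeD2r//; apply: esum_ge.
exists [set` int_range N]; first by split => //; exact: finite_seq.
rewrite -fsbig_seq ?uniq_int_range//= sumEFin.
by [].
Qed.

End FourierSeries.

(** * The Fourier transform on the line *)

Section FourierIntegral.
Context {R : realType}.
Local Notation mu := (@lebesgue_measure R).
Implicit Types (f g : R -> R[i]).

Lemma normc_le_ReIm (z : R[i]) : normc z <= `|complex.Re z| + `|complex.Im z|.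
Proof.
rewrite -(@ler_pXn2r _ 2) ?nnegrE ?normc_ge0 ?addr_ge0//.
rewrite normc2E -[complex.Re z ^+ 2]real_normK ?num_real//.
rewrite -[complex.Im z ^+ 2]real_normK ?num_real//.
have := normr_ge0 (complex.Re z); have := normr_ge0 (complex.Im z).
by move: `|_| `|_| => p q; nra.
Qed.

Lemma cintegrable_cmeasurable f : cintegrable f -> cmeasurable f.
Proof.
by move=> [/integrableP[/measurable_EFinP ? _] /integrableP[/measurable_EFinP ? _]].
Qed.

Lemma integrable_ReIm f : cintegrable f ->
  mu.-integrable setT (EFin \o (fun x => `|complex.Re (f x)| + `|complex.Im (f x)|)).
Proof. by move=> [f1 f2]; apply: integrableD'; exact: integrable_norm. Qed.

Lemma cintegrable_unimod f g : cintegrable f -> cmeasurable g ->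
  (forall x, normc (g x) ^+ 2 = 1) -> cintegrable (fun x => f x * g x).
Proof.
move=> cf mg g1.
apply: (cintegrable_dom _ (integrable_ReIm cf)).
  by apply: cmeasurableM => //; exact: cintegrable_cmeasurable.
move=> x; rewrite normcM (_ : normc (g x) = 1) ?mulr1 ?normc_le_ReIm//.
apply: (@pexpIrn _ 2) => //; rewrite ?nnegrE ?normc_ge0//.
by rewrite g1 expr1n.
Qed.

Lemma measurable_kernel (xi : R) : cmeasurable (fun t : R => expi (- (t * xi))).
Proof.
apply: cmeasurable_expi; apply: measurableT_comp => //.
by apply: measurable_funM => //; exact: measurable_cst.
Qed.

Lemma cintegrable_kernel f xi : cintegrable f ->
  cintegrable (fun t => f t * expi (- (t * xi))).
Proof.
move=> cf; apply: cintegrable_unimod => //; first exact: measurable_kernel.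
by move=> x; exact: normc2_expi.
Qed.

(** The integral depends continuously on the frequency, by domination with a bound on |f|. *)
Lemma cmeasurable_fourier_integral f : cintegrable f -> cmeasurable (fourier_integral f).
Proof.
move=> cf.
suff : cmeasurable (fun xi => cintegral (fun t => f t * expi (- (t * xi)))).
  by apply: cmeasurableM; exact: cmeasurable_cst.
have ck := fun xi => cintegrable_kernel xi cf.
have ub xi t : normc (f t * expi (- (t * xi))) <= `|complex.Re (f t)| + `|complex.Im (f t)|.
  rewrite normcM (_ : normc (expi _) = 1) ?mulr1 ?normc_le_ReIm//.
  apply: (@pexpIrn _ 2) => //; rewrite ?nnegrE ?normc_ge0//.
  by rewrite normc2_expi expr1n.
have cc t : continuous (fun xi : R => cos (- (t * xi))).
  move=> x; apply: continuous_comp; last exact: continuous_cos.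
  by apply: continuousN; exact: mulrl_continuous.
have cs t : continuous (fun xi : R => sin (- (t * xi))).
  move=> x; apply: continuous_comp; last exact: continuous_sin.
  by apply: continuousN; exact: mulrl_continuous.
have cRe t : continuous (fun xi : R => complex.Re (f t * expi (- (t * xi)))).
  rewrite (_ : (fun xi => _) = (fun xi => complex.Re (f t) * cos (- (t * xi)) -
    complex.Im (f t) * sin (- (t * xi)))); last by apply/funext => xi; rewrite cReM.
  by move=> y; apply: cvgB; apply: cvgMr; [exact: cc|exact: cs].
have cIm t : continuous (fun xi : R => complex.Im (f t * expi (- (t * xi)))).
  rewrite (_ : (fun xi => _) = (fun xi => complex.Re (f t) * sin (- (t * xi)) +
    complex.Im (f t) * cos (- (t * xi)))); last by apply/funext => xi; rewrite cImM.
  by move=> y; apply: cvgD; apply: cvgMr; [exact: cs|exact: cc].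
have inI (x : R) : x \in (`]x - 1, x + 1[%classic : set R).
  by rewrite inE /= in_itv/=; lra.
split; apply: continuous_measurable_fun => x.
- apply: (@continuity_under_integral R _ _ mu
    (fun xi t => complex.Re (f t * expi (- (t * xi)))) setT measurableT (x - 1) (x + 1)
    _ _ _ (integrable_ReIm cf) _ x (inI x)).
  + by move=> xi _; case: (ck xi).
  + by apply: aeW => t _ xi _; exact: cRe.
  + by move=> xi _; apply: aeW => t _; rewrite (le_trans (normr_Re_le _))// ub.
- apply: (@continuity_under_integral R _ _ mu
    (fun xi t => complex.Im (f t * expi (- (t * xi)))) setT measurableT (x - 1) (x + 1)
    _ _ _ (integrable_ReIm cf) _ x (inI x)).
  + by move=> xi _; case: (ck xi).
  + by apply: aeW => t _ xi _; exact: cIm.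
  + by move=> xi _; apply: aeW => t _; rewrite (le_trans (normr_Im_le _))// ub.
Qed.

Lemma fourier_integralD f g xi : cintegrable f -> cintegrable g ->
  fourier_integral (fun t => f t + g t) xi = fourier_integral f xi + fourier_integral g xi.
Proof.
move=> cf cg; rewrite /fourier_integral -mulrDr -cintegralD; try exact: cintegrable_kernel.
by congr (_ * cintegral _); apply/funext => t; rewrite mulrDl.
Qed.

Lemma fourier_integralZ f c xi : cintegrable f ->
  fourier_integral (fun t => c * f t) xi = c * fourier_integral f xi.
Proof.
move=> cf; rewrite /fourier_integral [RHS]mulrCA; congr (_ * _).
rewrite -cintegralZ; last exact: cintegrable_kernel.
by congr cintegral; apply/funext => t; rewrite mulrA.
Qed.

End FourierIntegral.

(** * Folding integrals over the line onto one interval *)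

Section Tiling.
Context {R : realType}.
Local Notation mu := (@lebesgue_measure R).
Variable w : R.
Hypothesis w0 : 0 < w.

Definition tile (k : int) : set R := `[k%:~R * w, (k + 1)%:~R * w[%classic.

Lemma int_rangeS K : perm_eq (int_range K.+1) [:: Posz K, Negz K & int_range K].
Proof.
apply: uniq_perm; first exact: uniq_int_range.
  by rewrite !cons_uniq uniq_int_range andbT inE !mem_int_range !ltnn.
move=> n; rewrite mem_int_range 2!in_cons mem_int_range; case: n => k.
  by rewrite ltnS leq_eqVlt.
by rewrite ltnS leq_eqVlt.
Qed.

Lemma sum_indic_tile (K : nat) (x : R) :
  \sum_(k <- int_range K) (\1_(tile k) x : R) =
  \1_(`[- (K%:R * w), K%:R * w[%classic) x.
Proof.
have inE' (a b : R) : (\1_(`[a, b[%classic) x : R) = ((a <= x) && (x < b))%:R.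
  by rewrite indicE mem_setE in_itv.
elim: K => [|K IH].
  rewrite big_nil inE' mul0r oppr0; case: leP => //= h; by rewrite ltNge h.
rewrite (perm_big _ (int_rangeS K))/= !big_cons IH /tile !inE'.
rewrite NegzE !intrD !mulrNz -!pmulrn -natr1 mulrDl mul1r.
have -> : (- (K%:R + 1) + 1%:~R) * w = - (K%:R * w) by ring.
have -> : - (K%:R + 1) * w = - (K%:R * w + w) by ring.
have [p pE] : exists p : R, p = K%:R * w by exists (K%:R * w).
have p0 : 0 <= p by rewrite pE mulr_ge0// ltW.
rewrite -pE; clear pE IH; have w00 := w0.
have [h1|h1] := leP p x.
  have e1 : - (p + w) <= x by lra.
  have e2 : - p <= x by lra.
  have -> : (x < - p) = false by apply/negbTE; rewrite -leNgt.
  by rewrite e1 !andbF !addr0.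
have e1 : x < p + w by lra.
rewrite e1 !andbT add0r; have [h2|h2] := leP (- p) x.
  have e2 : - (p + w) <= x by lra.
  by rewrite e2 andbF add0r.
by rewrite andbT addr0.
Qed.

Lemma indic_tile_shift k x : \1_(tile k) (x + k%:~R * w) = \1_(tile 0) x :> R.
Proof.
rewrite /tile !indicE !mem_setE !in_itv/= !mulr0z add0r mul0r mul1r.
by rewrite lerDr intrD mulrDl mul1r addrC ltrD2l.
Qed.

Lemma measurable_tile k : measurable (tile k). Proof. exact: measurable_itv. Qed.

Lemma tile0E : tile 0 = `[0, w[%classic.
Proof. by rewrite /tile !mulr0z mul0r add0r mul1r. Qed.

Lemma integral_indic_mkcond (A : set R) (u : R -> \bar R) :
  (\int[mu]_(x in A) u x = \int[mu]_x ((\1_A x)%:E * u x))%E.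
Proof.
rewrite integral_mkcond; apply: eq_integral => x _.
by rewrite patchE indicE; case: ifP; rewrite ?mul1e ?mul0e.
Qed.

Lemma ge0_integral_tile (K : nat) (u : R -> R) : measurable_fun setT u ->
  (forall x, 0 <= u x) ->
  (\int[mu]_(x in `[(- (K%:R * w))%R, (K%:R * w)%R[) (u x)%:E =
   \int[mu]_(x in `[0%R, w[) (\sum_(k <- int_range K) u (x + k%:~R * w))%:E)%E.
Proof.
move=> mu' u0.
have i0 (A : set R) x : 0 <= \1_A x :> R by rewrite indicE; case: (_ \in _).
have mi k : measurable_fun setT (fun x => \1_(tile k) x * u x).
  by apply: measurable_funM => //; apply: measurable_indic; exact: measurable_tile.
transitivity (\int[mu]_x \sum_(k <- int_range K) (\1_(tile k) x * u x)%:E)%E.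
  rewrite integral_indic_mkcond; apply: eq_integral => x _.
  by rewrite sumEFin -mulr_suml sum_indic_tile.
rewrite ge0_integral_sum//; last 2 first.
- by move=> k; apply/measurable_EFinP; exact: mi.
- by move=> k x _; rewrite lee_fin mulr_ge0.
rewrite -tile0E integral_indic_mkcond.
transitivity (\int[mu]_x \sum_(k <- int_range K) (\1_(tile 0) x * u (x + k%:~R * w))%:E)%E; last first.
  by apply: eq_integral => x _; rewrite sumEFin -EFinM mulr_sumr.
have ms k : measurable_fun setT (fun x : R => u (x + k%:~R * w)).
  by have := measurableT_comp mu' (measurable_shift (k%:~R * w)).
rewrite ge0_integral_sum//; last 2 first.
- move=> k; apply/measurable_EFinP; apply: measurable_funM; last exact: ms.
  by apply: measurable_indic; exact: measurable_tile.
- by move=> k x _; rewrite lee_fin mulr_ge0.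
apply: eq_bigr => k _.
rewrite -[LHS](integral_shift (k%:~R * w)); last exact/measurable_EFinP.
by apply: eq_integral => x _; rewrite indic_tile_shift.
Qed.

Lemma cintegral_tile (K : nat) (f : R -> R[i]) : cintegrable f ->
  (forall x, ~ (- (K%:R * w) <= x < K%:R * w) -> f x = 0) ->
  cintegral f = cintegral (fun x => (\1_(tile 0) x)%:C *
    \sum_(k <- int_range K) f (x + k%:~R * w)).
Proof.
move=> cf f0.
have mf := cintegrable_cmeasurable cf.
have cif k : cintegrable (fun x => (\1_(tile k) x)%:C * f x).
  apply: (cintegrable_dom _ (integrable_ReIm cf)).
    by apply: cmeasurableM => //; apply: cmeasurable_indic; exact: measurable_tile.
  move=> x; rewrite (le_trans _ (normc_le_ReIm _))// normcM normcC indicE.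
  by case: (_ \in _); rewrite ?normr1 ?mul1r// normr0 mul0r normc_ge0.
transitivity (cintegral (fun x => \sum_(k <- int_range K) (\1_(tile k) x)%:C * f x)).
  congr cintegral; apply/funext => x; rewrite -mulr_suml -rmorph_sum/=.
  rewrite sum_indic_tile indicE mem_setE in_itv/=.
  have [h|/negP h] := boolP (- (K%:R * w) <= x < K%:R * w); first by rewrite mul1r.
  by rewrite f0// mulr0.
have E k : tau (k%:~R * w) (fun x => (\1_(tile k) x)%:C * f x) =
    (fun x => (\1_(tile 0) x)%:C * f (x + k%:~R * w)).
  by apply/funext => x; rewrite /tau indic_tile_shift.
have citau k : cintegrable (tau (k%:~R * w) (fun x => (\1_(tile k) x)%:C * f x)).
  have [/integrableP[/measurable_EFinP m1 i1] /integrableP[/measurable_EFinP m2 i2]] := cif k.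
  have [n1 n2] := cmeasurable_shift (k%:~R * w) (cintegrable_cmeasurable (cif k)).
  split; apply/integrableP; split; do ?exact/measurable_EFinP.
    have := integral_shift (k%:~R * w) (measurableT_comp (@abse_measurable R setT)
       (measurableT_comp (@EFin_measurable R setT) m1)).
    by move=> /= ->.
  have := integral_shift (k%:~R * w) (measurableT_comp (@abse_measurable R setT)
       (measurableT_comp (@EFin_measurable R setT) m2)).
  by move=> /= ->.
rewrite cintegral_sum//.
transitivity (cintegral (fun x => \sum_(k <- int_range K)
    (\1_(tile 0) x)%:C * f (x + k%:~R * w))); last first.
  by congr cintegral; apply/funext => x; rewrite mulr_sumr.
rewrite cintegral_sum; last by move=> k _; rewrite -E.
apply: eq_bigr => k _; rewrite -E cintegral_tau//.
exact: cintegrable_cmeasurable.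
Qed.

End Tiling.

(** * Plancherel's theorem and the transform of square-integrable functions *)

Section Plancherel.
Context {R : realType}.
Local Notation mu := (@lebesgue_measure R).
Implicit Types (f g : R -> R[i]).

Section Support.
Variables (a L : R).
Hypothesis L0 : 0 < L.
Let w := 2 * pi / L.
Let I : set R := `[a, a + L[%classic.

Lemma fcoef_fourier_integral f xi (n : int) : (forall x, ~ I x -> f x = 0) ->
  fcoef a L (fun t => f t * expi (- (t * xi))) n =
  (Num.sqrt (2 * pi))%:C * fourier_integral f (xi + n%:~R * w).
Proof.
move=> fI; rewrite /fcoef /fourier_integral innerE mulrA.
have e : (Num.sqrt (2 * pi))%:C * (Num.sqrt (2 * pi))^-1%:C = 1 :> R[i].
  by rewrite -rmorphM/= mulfV// gt_eqF// sqrtr_gt0 mulr_gt0// pi_gt0.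
rewrite e mul1r; congr cintegral; apply/funext => t.
have [It|It] := pselect (I t); last by rewrite fI// !mul0r.
rewrite /fbasis indicE mem_set// mul1r /fexp -expiN -mulrA -expiD.
by congr (_ * expi _); rewrite -/w; ring.
Qed.

(* Parseval for the modulated function; integrating it over a period of [xi]
   gives Plancherel for compactly supported functions. *)
Lemma fourier_integral_energy f xi : L2 f -> (forall x, ~ I x -> f x = 0) ->
  (forall K, \sum_(k <- int_range K) normc (fourier_integral f (xi + k%:~R * w)) ^+ 2
    <= nsq f / w) /\
  (fun K => \sum_(k <- int_range K) normc (fourier_integral f (xi + k%:~R * w)) ^+ 2)
    @ \oo --> nsq f / w.
Proof.
move=> lf fI.
pose fx t := f t * expi (- (t * xi)).
have E t : fx t = expi (- (t * xi)) * f t by rewrite mulrC.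
have mk := measurable_kernel xi.
have lfx : L2 fx.
  rewrite (_ : fx = fun t => expi (- (t * xi)) * f t); last exact/funext.
  apply: (@L2_bounded_mul _ _ _ 1) => //; apply: aeW => x; by rewrite normc2_expi.
have nfx : nsq fx = nsq f.
  rewrite /nsq /norm2sq; congr fine; apply: eq_integral => t _.
  by rewrite /fx normcM exprMn normc2_expi mulr1.
have fxI x : ~ I x -> fx x = 0 by move=> Ix; rewrite /fx fI// mul0r.
have tp : 0 < 2 * pi :> R by rewrite mulr_gt0// pi_gt0.
have SE K : \sum_(k <- int_range K) normc (fourier_integral f (xi + k%:~R * w)) ^+ 2 =
    fenergy a L fx (int_range K) / (2 * pi).
  rewrite /fenergy mulr_suml; apply: eq_bigr => n _.
  rewrite fcoef_fourier_integral// normcM exprMn normcC real_normK ?num_real//.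
  rewrite (@sqr_sqrtr _ (2 * pi)); last exact: ltW.
  by rewrite [2 * pi * _]mulrC mulfK// gt_eqF.
have CE : nsq f / w = (L * nsq f) / (2 * pi).
  by rewrite /w invf_div mulrA [nsq f * L]mulrC.
split.
  move=> K; rewrite SE CE -nfx ler_pM2r ?invr_gt0//; apply: bessel => //.
  exact: uniq_int_range.
under eq_cvg do rewrite SE.
rewrite CE; apply: cvgMl.
have := fsum_cvg L0 lfx fxI; rewrite /L2cvg.
rewrite (_ : (fun N => nsq _) = (fun N => nsq fx - fenergy a L fx (int_range N) / L)); last first.
  apply/funext => N; rewrite nsq_subC//; last exact: L2_fsum.
  by rewrite nsq_sub_fsum// uniq_int_range.
move=> H.
rewrite (_ : (fun K => fenergy a L fx (int_range K)) =
  (fun K => L * (nsq fx - (nsq fx - fenergy a L fx (int_range K) / L)))); last first.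
  by apply/funext => K; field; rewrite gt_eqF.
rewrite -nfx -[X in _ --> X](subr0 (L * nsq fx)) -(mulr0 L) -mulrBr.
by apply: cvgMr; apply: cvgB => //; exact: cvg_cst.
Qed.

Lemma plancherel_supp f : L2 f -> (forall x, ~ I x -> f x = 0) ->
  L2 (fourier_integral f) /\ nsq (fourier_integral f) = nsq f.
Proof.
move=> lf fI.
have cf := L2_supp_cintegrable lf fI.
have mF := cmeasurable_fourier_integral cf.
have w0 : 0 < w by rewrite /w divr_gt0// mulr_gt0// pi_gt0.
set F := fourier_integral f in mF *.
pose u x := normc (F x) ^+ 2.
have mu' : measurable_fun setT u by exact: measurable_normc2.
have u0 x : 0 <= u x by exact: sqr_ge0.
suff H : norm2sq F = (nsq f)%:E.
  by split; [split => //; rewrite H ltry|rewrite /nsq H].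
pose A (K : nat) : set R := `[- (K%:R * w), K%:R * w[%classic.
have mA K : measurable (A K) by exact: measurable_itv.
have ndA : nondecreasing_seq A.
  move=> N M NM; apply/subsetPset => x; rewrite /A /= !in_itv/= => /andP[x1 x2].
  have : N%:R * w <= M%:R * w by rewrite ler_wpM2r ?ler_nat// ltW.
  by move: (N%:R * w) (M%:R * w) x1 x2 => p q; lra.
have UA : \bigcup_K A K = setT.
  apply/seteqP; split => // x _.
  have [N HN] : exists N : nat, `|x| / w < N%:R.
    by exists (Num.trunc (`|x| / w)).+1; rewrite truncnS_gt.
  exists N => //; rewrite /A/= in_itv/=.
  move: HN; rewrite ltr_pdivrMr// ltr_norml => /andP[h1 h2].
  by rewrite (ltW h1) h2.
have c1 : (\int[mu]_(x in A K) (u x)%:E)%E @[K --> \oo] --> norm2sq F.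
  rewrite /norm2sq -UA; apply: ge0_nondecreasing_set_cvg_integral => //.
  - by move=> K; apply/measurable_EFinP; exact: measurable_funTS.
  - by move=> K x _; rewrite lee_fin.
(* Folding the window onto [0, w) turns the integrand into the partial energies, which are dominated
   by their limit, the constant |f|^2 / w. *)
have c2 : (\int[mu]_(x in A K) (u x)%:E)%E @[K --> \oo] --> (nsq f)%:E.
  rewrite (_ : (fun K => _) = (fun K => \int[mu]_(x in `[0%R, w[)
     (\sum_(k <- int_range K) u (x + k%:~R * w))%:E)%E); last first.
    by apply/funext => K; exact: ge0_integral_tile.
  have m0w : measurable (`[0, w[%classic : set R) by exact: measurable_itv.
  have meas0w : mu `[0, w[%classic = w%:E.
    by rewrite lebesgue_measure_itv/= lte_fin w0 -EFinD subr0.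
  have -> : (nsq f)%:E = (\int[mu]_(x in `[0%R, w[) (nsq f / w)%:E)%E.
    transitivity ((nsq f / w)%:E * w%:E)%E; first by rewrite -EFinM divfK// gt_eqF.
    by rewrite integral_cst//; congr (_ * _)%E; exact: esym meas0w.
  have m1 K : measurable_fun `[0, w[%classic
      (fun x => (\sum_(k <- int_range K) u (x + k%:~R * w))%:E).
    apply/measurable_EFinP; apply: measurable_funTS; apply: measurable_sum => k.
    exact: measurableT_comp mu' (measurable_shift (k%:~R * w)).
  have m2 : measurable_fun `[0, w[%classic (fun x : R => (nsq f / w)%:E).
    exact: measurable_cst.
  have cv : {ae mu, forall x, `[0, w[%classic x ->
      (fun K => (\sum_(k <- int_range K) u (x + k%:~R * w))%:E) @ \oo --> (nsq f / w)%:E}.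
    apply: aeW => x _; apply: cvg_EFin; first exact: nearW.
    by have [_] := fourier_integral_energy x lf fI.
  have ic : mu.-integrable `[0, w[%classic (fun x : R => (nsq f / w)%:E).
    apply/integrableP; split; first exact: measurable_cst.
    have -> : (\int[mu]_(x in `[0%R, w[) `|(nsq f / w)%:E| = `|(nsq f / w)%:E| * w%:E)%E.
      by rewrite integral_cst//; congr (_ * _)%E; exact: meas0w.
    by rewrite /= -EFinM ltry.
  have dm : {ae mu, forall x K, `[0, w[%classic x ->
      (`|(\sum_(k <- int_range K) u (x + k%:~R * w))%:E| <= (nsq f / w)%:E)%E}.
    apply: aeW => x K _; rewrite /= ger0_norm ?lee_fin; last exact: sumr_ge0.
    by have [h _] := fourier_integral_energy x lf fI; exact: h.
  by have [_ _] := dominated_convergence (mu := mu) m0w m1 m2 cv ic dm.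
exact: (cvg_unique _ c1 c2).
Qed.

End Support.

(** The closed interval [-n, n] is not contained in [-n, n), whence n + 1. *)
Lemma truncate_supp n f x : ~ (`[- (n.+1)%:R, - (n.+1)%:R + 2 * (n.+1)%:R[%classic x : Prop) ->
  truncate n f x = 0.
Proof.
move=> H; rewrite /truncate; case: ifP => // xI; exfalso; apply: H.
move: xI; rewrite /= !in_itv/= -natr1 => /andP[h1 h2].
by move: (n%:R : R) h1 h2 => p; lra.
Qed.

Lemma supp_len0 n : 0 < 2 * (n.+1)%:R :> R. Proof. by rewrite mulr_gt0. Qed.

Lemma cintegrable_truncate n f : L2 f -> cintegrable (truncate n f).
Proof.
move=> lf; apply: (L2_supp_cintegrable (L2_truncate n lf)) => x.
exact: truncate_supp.
Qed.

Lemma L2_fourier_truncate n f : L2 f -> L2 (fourier_integral (truncate n f)).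
Proof.
by move=> lf; have [] := plancherel_supp (supp_len0 n) (L2_truncate n lf) (@truncate_supp n f).
Qed.

Lemma truncate_le m n f x : (n <= m)%N -> truncate n f x = truncate n (truncate m f) x.
Proof.
move=> nm; rewrite /truncate; case: ifP => // xn; case: ifP => // /negP[].
move: xn; rewrite !in_itv/=; have : (n%:R : R) <= m%:R by rewrite ler_nat.
by move: (n%:R : R) (m%:R : R) => p q; lra.
Qed.

Lemma is_fourierP f g : L2 f -> L2 g ->
  is_fourier f g <-> L2cvg (fun n => fourier_integral (truncate n f)) g.
Proof.
move=> lf lg; have lF n : L2 (fourier_integral (truncate n f)) by exact: L2_fourier_truncate.
by split => [[_ /(L2cvgP lF lg)]|/(L2cvgP lF lg) H] //; split.
Qed.

Lemma nsq_fourier_truncateB m n f : L2 f ->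
  nsq (fun xi => fourier_integral (truncate m f) xi - fourier_integral (truncate n f) xi) =
  nsq (fun x => truncate m f x - truncate n f x).
Proof.
move=> lf.
have ct k : cintegrable (fun x => -1 * truncate k f x).
  by apply: cintegrableZ; exact: cintegrable_truncate.
pose N := maxn m n.
have lmn : L2 (fun x => truncate m f x + -1 * truncate n f x).
  by apply: L2D; [|apply: L2Z]; exact: L2_truncate.
have supp x : ~ (`[- (N.+1)%:R, - (N.+1)%:R + 2 * (N.+1)%:R[%classic x : Prop) ->
    truncate m f x + -1 * truncate n f x = 0.
  move=> Ix.
  have Z k : (k <= N)%N -> truncate k f x = 0.
    move=> kN; rewrite (truncate_le _ _ kN) {1}/truncate (truncate_supp f Ix).
    by case: ifP.
  by rewrite !Z ?mulr0 ?addr0// ?leq_maxl ?leq_maxr.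
have [_ E] := plancherel_supp (supp_len0 N) lmn supp.
rewrite (_ : (fun x => truncate m f x - truncate n f x) =
  (fun x => truncate m f x + -1 * truncate n f x)); last first.
  by apply/funext => x; rewrite mulN1r.
rewrite -E; congr nsq; apply/funext => xi.
by rewrite fourier_integralD// ?fourier_integralZ ?mulN1r//; exact: cintegrable_truncate.
Qed.

(** By Plancherel for compact supports, the transforms of the truncations are a Cauchy sequence
    because the truncations are. *)
Lemma fourier_exists f : L2 f -> exists g, is_fourier f g.
Proof.
move=> lf.
have lF n : L2 (fourier_integral (truncate n f)) by exact: L2_fourier_truncate.
have [|g [lg Fg]] := L2_complete lF; last by exists g; apply/is_fourierP.
move=> e e0; have lt n : L2 (truncate n f) by exact: L2_truncate.
have [N HN] := L2cvg_cauchy lt lf (L2cvg_truncate lf) e0.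
by exists N => m n Nm Nn; rewrite nsq_fourier_truncateB//; exact: HN.
Qed.

Lemma fourierP f : L2 f -> is_fourier f (fourier f).
Proof.
move=> lf; have [g fg] := fourier_exists lf.
exact: (@xgetPex _ (fun=> 0) [set g | is_fourier f g] (ex_intro _ g fg)).
Qed.

Lemma L2_fourier f : L2 f -> L2 (fourier f).
Proof. by move=> /fourierP[]. Qed.

Lemma fourier_cvg f : L2 f -> L2cvg (fun n => fourier_integral (truncate n f)) (fourier f).
Proof. by move=> lf; apply/is_fourierP => //; [exact: L2_fourier|exact: fourierP]. Qed.

Lemma fourier_unique f g : L2 f -> L2 g ->
  L2cvg (fun n => fourier_integral (truncate n f)) g ->
  {ae mu, forall xi, fourier f xi = g xi}.
Proof.
move=> lf lg fg; apply: (L2cvg_unique (fun n => L2_fourier_truncate n lf) _ _ (fourier_cvg lf) fg) => //.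
exact: L2_fourier.
Qed.

Lemma truncateD n f g : truncate n (fun x => f x + g x) =
  (fun x => truncate n f x + truncate n g x).
Proof. by apply/funext => x; rewrite /truncate; case: ifP => // _; rewrite addr0. Qed.

Lemma truncateZ n c f : truncate n (fun x => c * f x) = (fun x => c * truncate n f x).
Proof. by apply/funext => x; rewrite /truncate; case: ifP => // _; rewrite mulr0. Qed.

Lemma fourierD f g : L2 f -> L2 g ->
  {ae mu, forall xi, fourier (fun x => f x + g x) xi = fourier f xi + fourier g xi}.
Proof.
move=> lf lg; apply: fourier_unique; [exact: L2D|by apply: L2D; exact: L2_fourier|].
rewrite (_ : (fun n => _) = (fun n xi => fourier_integral (truncate n f) xi +
  fourier_integral (truncate n g) xi)); last first.
  apply/funext => n; apply/funext => xi; rewrite truncateD fourier_integralD//;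
    exact: cintegrable_truncate.
apply: L2cvgD; do ?[by move=> n; exact: L2_fourier_truncate|exact: L2_fourier|exact: fourier_cvg].
Qed.

Lemma fourierZ c f : L2 f ->
  {ae mu, forall xi, fourier (fun x => c * f x) xi = c * fourier f xi}.
Proof.
move=> lf; apply: fourier_unique; [exact: L2Z|by apply: L2Z; exact: L2_fourier|].
rewrite (_ : (fun n => _) = (fun n xi => c * fourier_integral (truncate n f) xi)); last first.
  apply/funext => n; apply/funext => xi; rewrite truncateZ fourier_integralZ//.
  exact: cintegrable_truncate.
apply: (@L2cvg_mul _ (fun=> c) (normc c ^+ 2)); do ?[exact: cmeasurable_cst|exact: sqr_ge0|
  by move=> n; exact: L2_fourier_truncate|exact: L2_fourier|exact: fourier_cvg].
exact: aeW.
Qed.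

(** Polarization: the norm of f + g gives the real part of the inner product, that of f + i g its
    imaginary part. *)
Lemma inner_polar f g F G : L2 f -> L2 g -> L2 F -> L2 G ->
  nsq f = nsq F -> nsq g = nsq G ->
  nsq (fun x => f x + g x) = nsq (fun x => F x + G x) ->
  nsq (fun x => f x + 'i * g x) = nsq (fun x => F x + 'i * G x) ->
  inner f g = inner F G.
Proof.
move=> lf lg lF lG nf ng; rewrite !nsqD//; try exact: L2Z.
rewrite !nsqZ// !innerZr// nf ng => e1 e2.
have r : complex.Re (inner f g) = complex.Re (inner F G) by lra.
have : complex.Re (conjc 'i * inner f g) = complex.Re (conjc 'i * inner F G) by lra.
rewrite !reimE /= !mul0r !sub0r !mulN1r !opprK => i.
exact: complex_eqP.
Qed.

Lemma nsq_fourier f : L2 f -> nsq (fourier f) = nsq f.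
Proof.
move=> lf; have lt n : L2 (truncate n f) by exact: L2_truncate.
have lF n := L2_fourier_truncate n lf.
apply: complexI; rewrite -!inner_nsq//; last exact: L2_fourier.
apply: (inner_lim_eq lF lF lt lt _ _ lf lf (fourier_cvg lf) (fourier_cvg lf)
  (L2cvg_truncate lf) (L2cvg_truncate lf)); do ?exact: L2_fourier.
move=> n; rewrite !inner_nsq//; congr (_%:C).
by have [] := plancherel_supp (supp_len0 n) (lt n) (@truncate_supp n f).
Qed.

Lemma inner_fourier f g : L2 f -> L2 g -> inner (fourier f) (fourier g) = inner f g.
Proof.
move=> lf lg; apply: inner_polar => //; do ?[exact: L2_fourier|exact: nsq_fourier].
- rewrite -(nsq_fourier (L2D lf lg)); apply: nsq_ae.
  + by apply: cmeasurableD; [case: (L2_fourier lf)|case: (L2_fourier lg)].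
  + by case: (L2_fourier (L2D lf lg)).
  + by apply: filterS (fourierD lf lg) => x ->.
- have lig := L2Z 'i lg.
  rewrite -(nsq_fourier (L2D lf lig)); apply: nsq_ae.
  + apply: cmeasurableD; [by case: (L2_fourier lf)|].
    by case: (L2Z 'i (L2_fourier lg)).
  + by case: (L2_fourier (L2D lf lig)).
  + by apply: filterS2 (fourierD lf lig) (fourierZ 'i lg) => x -> ->.
Qed.

End Plancherel.

(** * Stability of the transform under limits and its behaviour under translation *)

Section FourierTranslation.
Context {R : realType}.
Local Notation mu := (@lebesgue_measure R).
Implicit Types (f g : R -> R[i]).

Lemma L2cvg_ae (u v : nat -> R -> R[i]) g : (forall n, L2 (u n)) -> (forall n, L2 (v n)) ->
  L2 g -> (forall n, {ae mu, forall x, u n x = v n x}) -> L2cvg u g -> L2cvg v g.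
Proof.
move=> lu lv lg uv; rewrite /L2cvg.
rewrite (_ : (fun n => nsq (fun x => u n x - g x)) = (fun n => nsq (fun x => v n x - g x)))//.
apply/funext => n; apply: nsq_ae.
- by apply: cmeasurableB; [case: (lu n)|case: lg].
- by apply: cmeasurableB; [case: (lv n)|case: lg].
- by apply: filterS (uv n) => x ->.
Qed.

Lemma fourierB f g : L2 f -> L2 g ->
  {ae mu, forall xi, fourier (fun x => f x - g x) xi = fourier f xi - fourier g xi}.
Proof.
move=> lf lg; have lNg := L2Z (-1) lg.
rewrite (_ : (fun x => f x - g x) = (fun x => f x + -1 * g x)).
  by apply: filterS2 (fourierD lf lNg) (fourierZ (-1) lg) => x -> ->; rewrite mulN1r.
by apply/funext => x; rewrite mulN1r.
Qed.

Lemma nsq_fourierB f g : L2 f -> L2 g ->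
  nsq (fun xi => fourier f xi - fourier g xi) = nsq (fun x => f x - g x).
Proof.
move=> lf lg; rewrite -(nsq_fourier (L2B lf lg)); apply: nsq_ae.
- by apply: cmeasurableB; [case: (L2_fourier lf)|case: (L2_fourier lg)].
- by case: (L2_fourier (L2B lf lg)).
- by apply: filterS (fourierB lf lg) => x ->.
Qed.

Lemma L2cvg_fourier (u : nat -> R -> R[i]) g : (forall n, L2 (u n)) -> L2 g ->
  L2cvg u g -> L2cvg (fun n => fourier (u n)) (fourier g).
Proof.
move=> lu lg; rewrite /L2cvg.
rewrite (_ : (fun n => nsq (fun x => fourier (u n) x - fourier g x)) =
  (fun n => nsq (fun x => u n x - g x)))//.
by apply/funext => n; exact: nsq_fourierB.
Qed.

Lemma fourier_ae f g : L2 f -> L2 g -> {ae mu, forall x, f x = g x} ->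
  {ae mu, forall xi, fourier f xi = fourier g xi}.
Proof.
move=> lf lg fg.
have lFG := L2B (L2_fourier lf) (L2_fourier lg).
have : nsq (fun xi => fourier f xi - fourier g xi) = 0.
  rewrite nsq_fourierB// -[RHS](@nsq0 R); apply: nsq_ae.
  - by case: (L2B lf lg).
  - exact: cmeasurable_cst.
  - by apply: filterS fg => x ->; rewrite subrr.
by move/(nsq_eq0 lFG); apply: filterS => x /eqP; rewrite subr_eq0 => /eqP.
Qed.

(** The truncations of a compactly supported function are eventually equal to it. *)
Lemma fourier_supp (a L : R) f : 0 < L -> L2 f ->
  (forall x, ~ (`[a, a + L[%classic x : Prop) -> f x = 0) ->
  {ae mu, forall xi, fourier f xi = fourier_integral f xi}.
Proof.
move=> L0 lf fI; have [lF _] := plancherel_supp L0 lf fI.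
apply: fourier_unique => //.
have [N HN] : exists N : nat, `|a| + L < N%:R.
  by exists (Num.trunc (`|a| + L)).+1; rewrite truncnS_gt.
rewrite /L2cvg; apply: cvg_near_cst; near=> n.
have Nn : (N <= n)%N by near: n; exact: nbhs_infty_ge.
have E : truncate n f = f.
  apply/funext => x; rewrite /truncate; case: ifPn => // xn.
  rewrite fI// => -[]; rewrite /= in_itv/= => /andP[h1 h2]; move/negP: xn; apply.
  have nN : (N%:R : R) <= n%:R by rewrite ler_nat.
  have := ler_norm a; have := ler_norm (- a); rewrite normrN in_itv/=.
  by move: (n%:R : R) (N%:R : R) HN nN => p q; move: `|a| => b; lra.
rewrite E (_ : (fun xi => _ - _) = fun=> 0) ?nsq0//.
by apply/funext => xi; rewrite subrr.
Unshelve. all: by end_near. Qed.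

Lemma fourier_integral_tau a f xi : cintegrable f ->
  fourier_integral (tau a f) xi = expi (a * xi) * fourier_integral f xi.
Proof.
move=> cf; rewrite /fourier_integral [RHS]mulrCA; congr (_ * _).
rewrite -cintegralZ; last exact: cintegrable_kernel.
have mk : cmeasurable (fun x => expi (a * xi) * (f x * expi (- (x * xi)))).
  apply: cmeasurableM; first exact: cmeasurable_cst.
  by apply: cintegrable_cmeasurable; exact: cintegrable_kernel.
rewrite -(cintegral_tau a mk); congr cintegral; apply/funext => t.
by rewrite /tau mulrCA -expiD; congr (_ * expi _); ring.
Qed.

(** Translated truncations are used instead of truncated translates: they also converge to the
    translate, and their transforms are modulations of those of the truncations. *)
Lemma fourier_tau a f : L2 f ->
  {ae mu, forall xi, fourier (tau a f) xi = expi (a * xi) * fourier f xi}.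
Proof.
move=> lf.
pose v n := tau a (truncate n f).
have lt n : L2 (truncate n f) by exact: L2_truncate.
have lv n : L2 (v n) by exact: L2_tau.
have lta := L2_tau a lf.
have vt : L2cvg v (tau a f).
  have := L2cvg_truncate lf; rewrite /L2cvg.
  rewrite (_ : (fun n => nsq (fun x => v n x - tau a f x)) =
    (fun n => nsq (fun x => truncate n f x - f x)))//.
  by apply/funext => n; rewrite -[RHS](nsq_tau a (L2B (lt n) lf)).
have Fv := L2cvg_fourier lv lta vt.
have me : cmeasurable (fun xi : R => expi (a * xi)).
  by apply: cmeasurable_expi; apply: measurable_funM => //; exact: measurable_cst.
have e1 : {ae mu, forall xi : R, normc (expi (a * xi)) ^+ 2 <= 1}.
  by apply: aeW => x; rewrite normc2_expi.
have leF (k : R -> R[i]) : L2 k -> L2 (fun xi => expi (a * xi) * k xi).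
  by move=> lk; exact: L2_bounded_mul me e1 lk.
have lFt n := L2_fourier_truncate n lf.
have ev n : {ae mu, forall xi, expi (a * xi) * fourier_integral (truncate n f) xi = fourier (v n) xi}.
  pose a0 : R := - (n.+1)%:R - a.
  have sv x : ~ (`[a0, a0 + 2 * (n.+1)%:R[%classic x : Prop) -> v n x = 0.
    move=> H; apply: truncate_supp => -[]; rewrite /= in_itv/= => /andP[h1 h2]; apply: H.
    rewrite /= in_itv/= /a0; move: ((n.+1)%:R : R) h1 h2 => p h1 h2.
    by apply/andP; split; lra.
  apply: filterS (fourier_supp (supp_len0 n) (lv n) sv) => xi ->.
  by rewrite fourier_integral_tau//; exact: cintegrable_truncate.
have c2 : L2cvg (fun n => fourier (v n)) (fun xi => expi (a * xi) * fourier f xi).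
  apply: (L2cvg_ae (fun n => leF _ (lFt n)) (fun n => L2_fourier (lv n)) _ ev).
    by apply: leF; exact: L2_fourier.
  exact: (L2cvg_mul me ler01 e1 lFt (L2_fourier lf) (fourier_cvg lf)).
apply: (L2cvg_unique (fun n => L2_fourier (lv n)) (L2_fourier lta) _ Fv c2).
by apply: leF; exact: L2_fourier.
Qed.

End FourierTranslation.

(** * Inversion for compactly supported transforms *)

Section FourierInversion.
Context {R : realType}.
Local Notation mu := (@lebesgue_measure R).
Implicit Types (f g H : R -> R[i]).

Lemma Rintegral_swap (u : R -> R -> R) :
  (mu \x mu)%E.-integrable setT (fun z : R * R => (u z.1 z.2)%:E) ->
  (forall x, mu.-integrable setT (EFin \o u x)) ->
  (forall y, mu.-integrable setT (EFin \o (u ^~ y))) ->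
  \int[mu]_x \int[mu]_y u x y = \int[mu]_y \int[mu]_x u x y.
Proof.
move=> iu i1 i2; have := Fubini iu => /= E.
rewrite /Rintegral; congr fine.
transitivity (\int[mu]_x \int[mu]_y (u x y)%:E)%E.
  by apply: eq_integral => x _; rewrite fineK//; exact: integrable_fin_num (i1 x).
by rewrite E; apply: eq_integral => y _; rewrite fineK//; exact: integrable_fin_num (i2 y).
Qed.

Lemma integrable_prod_dom (u : R -> R -> R) (A B : R -> R) :
  measurable_fun setT (fun z : R * R => u z.1 z.2) ->
  mu.-integrable setT (EFin \o A) -> mu.-integrable setT (EFin \o B) ->
  (forall x y, `|u x y| <= A x * B y) ->
  (mu \x mu)%E.-integrable setT (fun z : R * R => (u z.1 z.2)%:E).
Proof.
move=> mu' iA iB uAB.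
have [mA _] := integrableP _ _ _ iA; have [mB _] := integrableP _ _ _ iB.
have mA' : measurable_fun setT A by exact/measurable_EFinP.
have mB' : measurable_fun setT B by exact/measurable_EFinP.
have iAB : (mu \x mu)%E.-integrable setT (fun z : R * R => (A z.1 * B z.2)%:E).
  apply/integrable12ltyP.
    apply/measurable_EFinP; apply: measurable_funM.
      exact: (measurableT_comp mA' measurable_fst).
    exact: (measurableT_comp mB' measurable_snd).
  have iA' := integrable_lty measurableT (integrable_norm iA).
  have iB' := integrable_lty measurableT (integrable_norm iB).
  have nB0 : (0 <= \int[mu]_x (EFin \o (Num.Def.normr \o B)) x)%E.
    by apply: integral_ge0 => x _; rewrite /= lee_fin normr_ge0.
  have mnA : measurable_fun setT (EFin \o (Num.Def.normr \o A)).
    by apply/measurable_EFinP; exact: measurableT_comp.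
  have mnB : measurable_fun setT (EFin \o (Num.Def.normr \o B)).
    by apply/measurable_EFinP; exact: measurableT_comp.
  have E1 x : (\int[mu]_y `|(A x * B y)%:E|)%E =
      ((EFin \o (Num.Def.normr \o A)) x * \int[mu]_y (EFin \o (Num.Def.normr \o B)) y)%E.
    rewrite -ge0_integralZl//; try by move=> *; rewrite /= lee_fin normr_ge0.
    by apply: eq_integral => y _; rewrite /= normrM EFinM.
  have E2 : (\int[mu]_x \int[mu]_y `|(A x * B y)%:E| < +oo)%E.
    rewrite [ltLHS](_ : _ = \int[mu]_x ((EFin \o (Num.Def.normr \o A)) x *
      \int[mu]_y (EFin \o (Num.Def.normr \o B)) y)%E)%E; last first.
      by apply: eq_integral => x _; exact: E1.
    rewrite ge0_integralZr//; try by move=> *; rewrite /= lee_fin normr_ge0.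
    rewrite lte_mul_pinfty//; first by apply: integral_ge0 => x _; rewrite /= lee_fin normr_ge0.
    by rewrite ge0_fin_numE//; apply: integral_ge0 => x _; rewrite /= lee_fin normr_ge0.
  exact: E2.
apply: (le_integrable measurableT _ _ iAB); first exact/measurable_EFinP.
by move=> z _; rewrite /= lee_fin (le_trans (uAB _ _))// ler_norm.
Qed.

Lemma cintegral_kernel_swap f H : cintegrable f -> cintegrable H ->
  cintegral (fun t => cintegral (fun xi => f t * H xi * expi (- (t * xi)))) =
  cintegral (fun xi => cintegral (fun t => f t * H xi * expi (- (t * xi)))).
Proof.
move=> cf cH.
have [mf1 mf2] := cintegrable_cmeasurable cf; have [mH1 mH2] := cintegrable_cmeasurable cH.
pose Phi (t xi : R) := f t * H xi * expi (- (t * xi)).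
have ct xi : cintegrable (Phi ^~ xi).
  have := cintegrableZ (H xi) (cintegrable_kernel xi cf).
  by rewrite (_ : (fun t => _) = Phi ^~ xi)//; apply/funext => t; rewrite /Phi; ring.
have cx t : cintegrable (Phi t).
  have := cintegrableZ (f t) (cintegrable_kernel t cH).
  by rewrite (_ : (fun xi => _) = Phi t)//; apply/funext => xi; rewrite /Phi [t * xi]mulrC; ring.
pose A (g : R -> R[i]) x := `|complex.Re (g x)| + `|complex.Im (g x)|.
have ub t xi : normc (Phi t xi) <= A f t * A H xi.
  rewrite /Phi !normcM (_ : normc (expi _) = 1); last first.
    apply: (@pexpIrn _ 2) => //; rewrite ?nnegrE ?normc_ge0//.
    by rewrite normc2_expi expr1n.
  by rewrite mulr1 ler_pM ?normc_ge0// normc_le_ReIm.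
have m1 (u : R -> R) : measurable_fun setT u -> measurable_fun setT (fun z : R * R => u z.1).
  by move=> mu'; exact: (measurableT_comp mu' measurable_fst).
have m2 (u : R -> R) : measurable_fun setT u -> measurable_fun setT (fun z : R * R => u z.2).
  by move=> mu'; exact: (measurableT_comp mu' measurable_snd).
have mk : measurable_fun setT (fun z : R * R => - (z.1 * z.2)).
  apply: measurableT_comp => //; apply: measurable_funM.
    exact: (m1 id (@measurable_id _ _ _)).
  exact: (m2 id (@measurable_id _ _ _)).
have mc : measurable_fun setT (fun z : R * R => cos (- (z.1 * z.2))).
  exact: measurableT_comp measurable_cos mk.
have ms : measurable_fun setT (fun z : R * R => sin (- (z.1 * z.2))).
  exact: measurableT_comp measurable_sin mk.
have mRe : measurable_fun setT (fun z : R * R => complex.Re (Phi z.1 z.2)).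
  rewrite (_ : (fun z => _) = (fun z : R * R =>
    (complex.Re (f z.1) * complex.Re (H z.2) - complex.Im (f z.1) * complex.Im (H z.2)) *
      cos (- (z.1 * z.2)) -
    (complex.Re (f z.1) * complex.Im (H z.2) + complex.Im (f z.1) * complex.Re (H z.2)) *
      sin (- (z.1 * z.2)))); last by apply/funext => z; rewrite /Phi !(cReM, cImM).
  apply: measurable_funB; apply: measurable_funM => //;
    [apply: measurable_funB|apply: measurable_funD]; apply: measurable_funM;
    do ?[exact: (m1 _ mf1)|exact: (m1 _ mf2)|exact: (m2 _ mH1)|exact: (m2 _ mH2)].
have mIm : measurable_fun setT (fun z : R * R => complex.Im (Phi z.1 z.2)).
  rewrite (_ : (fun z => _) = (fun z : R * R =>
    (complex.Re (f z.1) * complex.Re (H z.2) - complex.Im (f z.1) * complex.Im (H z.2)) *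
      sin (- (z.1 * z.2)) +
    (complex.Re (f z.1) * complex.Im (H z.2) + complex.Im (f z.1) * complex.Re (H z.2)) *
      cos (- (z.1 * z.2)))); last by apply/funext => z; rewrite /Phi !(cReM, cImM).
  apply: measurable_funD; apply: measurable_funM => //;
    [apply: measurable_funB|apply: measurable_funD]; apply: measurable_funM;
    do ?[exact: (m1 _ mf1)|exact: (m1 _ mf2)|exact: (m2 _ mH1)|exact: (m2 _ mH2)].
have iA g : cintegrable g -> mu.-integrable setT (EFin \o A g) by exact: integrable_ReIm.
have iRe := integrable_prod_dom mRe (iA _ cf) (iA _ cH)
  (fun t xi => le_trans (normr_Re_le _) (ub t xi)).
have iIm := integrable_prod_dom mIm (iA _ cf) (iA _ cH)
  (fun t xi => le_trans (normr_Im_le _) (ub t xi)).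
have x1 t : mu.-integrable setT (EFin \o (fun xi => complex.Re (Phi t xi))) by case: (cx t).
have x2 t : mu.-integrable setT (EFin \o (fun xi => complex.Im (Phi t xi))) by case: (cx t).
have t1 xi : mu.-integrable setT (EFin \o (fun t => complex.Re (Phi t xi))) by case: (ct xi).
have t2 xi : mu.-integrable setT (EFin \o (fun t => complex.Im (Phi t xi))) by case: (ct xi).
apply: complex_eqP.
  exact: (@Rintegral_swap (fun t xi => complex.Re (Phi t xi)) iRe x1 t1).
exact: (@Rintegral_swap (fun t xi => complex.Im (Phi t xi)) iIm x2 t2).
Qed.

(** The multiplication formula for the Fourier transform, by Fubini: the kernel is symmetric in its
    two variables. *)
Lemma cintegral_fourier_swap f H : cintegrable f -> cintegrable H ->
  cintegral (fun xi => fourier_integral f xi * H xi) =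
  cintegral (fun t => f t * fourier_integral H t).
Proof.
move=> cf cH; rewrite /fourier_integral; set c := (_^-1)%:C.
have := cintegral_kernel_swap (cintegrableZ c cf) cH => E.
transitivity (cintegral (fun xi => cintegral (fun t => c * f t * H xi * expi (- (t * xi))))).
  congr cintegral; apply/funext => xi.
  rewrite mulrC mulrA -cintegralZ; last exact: cintegrable_kernel.
  by congr cintegral; apply/funext => t; ring.
rewrite -E; congr cintegral; apply/funext => t.
rewrite mulrA -cintegralZ; last exact: cintegrable_kernel.
by congr cintegral; apply/funext => xi; rewrite [xi * t]mulrC; ring.
Qed.

(* [g] is the inverse Fourier transform of [G]; that it is a preimage follows from
   |hatg - G|^2 = |g|^2 + |G|^2 - 2 Re <hatg, G> = 2 |G|^2 - 2 |g|^2 = 0. *)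
Lemma inner_fourier_adjoint (a L : R) f G : 0 < L -> L2 f -> L2 G ->
  (forall x, ~ (`[a, a + L[%classic x : Prop) -> G x = 0) ->
  let g := fun t => conjc (fourier_integral (fun xi => conjc (G xi)) t) in
  [/\ L2 g, nsq g = nsq G & inner (fourier f) G = inner f g].
Proof.
move=> L0 lf lG GI g.
have lcG := L2J lG.
have cGI x : ~ (`[a, a + L[%classic x : Prop) -> conjc (G x) = 0.
  by move=> /GI ->; rewrite conjc0.
have ccG := L2_supp_cintegrable lcG cGI.
have [lFG nFG] := plancherel_supp L0 lcG cGI.
have nJ (k : R -> R[i]) : nsq (fun x => conjc (k x)) = nsq k.
  by rewrite /nsq /norm2sq; congr fine; apply: eq_integral => x _; rewrite normcJ2.
have lg : L2 g by exact: L2J.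
split => //; first by rewrite /g nJ nFG nJ.
have lt n : L2 (truncate n f) by exact: L2_truncate.
apply: (inner_lim_eq (fun n => L2_fourier_truncate n lf) (fun=> lG) lt (fun=> lg)
  (L2_fourier lf) lG lf lg (fourier_cvg lf) (L2cvg_cst G) (L2cvg_truncate lf) (L2cvg_cst g)).
move=> n; rewrite !innerE cintegral_fourier_swap//; last exact: cintegrable_truncate.
by congr cintegral; apply/funext => t; rewrite /g conjcK.
Qed.

Lemma fourier_surj (a L : R) G : 0 < L -> L2 G ->
  (forall x, ~ (`[a, a + L[%classic x : Prop) -> G x = 0) ->
  exists g, L2 g /\ {ae mu, forall xi, fourier g xi = G xi}.
Proof.
move=> L0 lG GI.
pose g := fun t => conjc (fourier_integral (fun xi => conjc (G xi)) t).
have [lg ng _] := inner_fourier_adjoint L0 lG lG GI.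
exists g; split => //.
have [_ _ E] := inner_fourier_adjoint L0 lg lG GI.
have lFg := L2_fourier lg.
have : nsq (fun xi => fourier g xi - G xi) = 0.
  by rewrite nsqB// nsq_fourier// E inner_nsq// -/g ng cReC; ring.
move/(nsq_eq0 (L2B lFg lG)).
by apply: filterS => x /eqP; rewrite subr_eq0 => /eqP.
Qed.

End FourierInversion.

(** * Cross products and Gram matrices *)

Section Cross.
Context {K : comNzRingType}.
Implicit Types (u v a b c d : 'rV[K]_4).

Definition dotp u v : K := \sum_(j < 4) u 0 j * v 0 j.

Lemma det_matrixS n (e : nat -> nat -> K) :
  \det (\matrix_(i < n.+1, j < n.+1) e i j) =
  \sum_(j < n.+1) e 0 j * ((-1) ^+ j * \det (\matrix_(i < n, k < n) e i.+1 (bump j k))).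
Proof.
rewrite (expand_det_row _ ord0); apply: eq_bigr => j _; rewrite mxE; congr (_ * _).
rewrite /cofactor add0n; congr (_ * \det _).
by apply/matrixP => i k; rewrite !mxE.
Qed.

(** Indexing by [nat] and recursing on the size lets the expansion compute, so that identities
    between small determinants are left to [ring]. [bump j] skips the column j. *)
Fixpoint laplace n (e : nat -> nat -> K) : K :=
  if n is m.+1 then
    \sum_(j < m.+1) e 0 j * ((-1) ^+ j * laplace m (fun i k => e i.+1 (bump j k)))
  else 1.

Lemma det_laplace n (e : nat -> nat -> K) :
  \det (\matrix_(i < n, j < n) e i j) = laplace n e.
Proof.
elim: n e => [|n IH] e; first by rewrite det_mx00.
rewrite det_matrixS; apply: eq_bigr => j _; congr (_ * (_ * _)).
exact: (IH (fun i k => e i.+1 (bump j k))).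
Qed.

Lemma laplace3 (e : nat -> nat -> K) :
  laplace 3 e =
  e 0 0 * (e 1 1 * e 2 2 - e 1 2 * e 2 1)
  - e 0 1 * (e 1 0 * e 2 2 - e 1 2 * e 2 0)
  + e 0 2 * (e 1 0 * e 2 1 - e 1 1 * e 2 0).
Proof. by rewrite /laplace !(big_ord_recl, big_ord0) /=; ring. Qed.

Lemma laplace4 (e : nat -> nat -> K) :
  laplace 4 e =
    e 0 0 * laplace 3 (fun i j => e i.+1 (nth 0 [:: 1; 2; 3] j))
  - e 0 1 * laplace 3 (fun i j => e i.+1 (nth 0 [:: 0; 2; 3] j))
  + e 0 2 * laplace 3 (fun i j => e i.+1 (nth 0 [:: 0; 1; 3] j))
  - e 0 3 * laplace 3 (fun i j => e i.+1 (nth 0 [:: 0; 1; 2] j)).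
Proof. by rewrite /laplace !(big_ord_recl, big_ord0) /=; ring. Qed.


Arguments laplace : simpl never.

Definition det4 a b c d : K :=
  laplace 4 (fun i j => nth 0 [:: a; b; c; d] i 0 (inord j)).

Lemma det4E a b c d : det4 a b c d =
  let e i j := nth 0 [:: a; b; c; d] i 0 (inord j) in
    e 0 0 * laplace 3 (fun i j => e i.+1 (nth 0 [:: 1; 2; 3] j))
  - e 0 1 * laplace 3 (fun i j => e i.+1 (nth 0 [:: 0; 2; 3] j))
  + e 0 2 * laplace 3 (fun i j => e i.+1 (nth 0 [:: 0; 1; 3] j))
  - e 0 3 * laplace 3 (fun i j => e i.+1 (nth 0 [:: 0; 1; 2] j)).
Proof. by rewrite /det4 laplace4. Qed.

Lemma det_rows4 a b c d :
  \det (col_mx a (col_mx b (col_mx c d)) : 'M[K]_4) = det4 a b c d.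
Proof.
rewrite /det4 -det_laplace; congr (\det _); apply/matrixP => i j; rewrite !mxE inord_val.
by case: (@splitP 1 3 i) => [i1 ->|i1 ->]; rewrite ?(ord1 i1)// !mxE;
  case: (@splitP 1 2 i1) => [i2 ->|i2 ->]; rewrite ?(ord1 i2)// !mxE;
  case: (@splitP 1 1 i2) => [i3 ->|i3 ->]; rewrite ?(ord1 i3).
Qed.

Lemma big_inord4 (F : 'I_4 -> K) :
  \sum_(j < 4) F j = F (inord 0) + F (inord 1) + F (inord 2) + F (inord 3).
Proof.
rewrite !big_ord_recl big_ord0 addr0 !addrA.
by congr (F _ + F _ + F _ + F _); apply/val_inj; rewrite /= inordK.
Qed.

(** Expansion along the first row. Orthogonality to a factor of a cross product thus becomes the
    vanishing of a determinant with a repeated row. *)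
Lemma dotp_cross d a b c : dotp d (cross a b c) = det4 d a b c.
Proof.
have dE i (k : nat) : (k < 4)%N -> (delta_mx 0 i : 'rV[K]_4) 0 (inord k) = (k == i :> nat)%:R.
  by move=> k4; rewrite mxE eqxx /=; congr (_%:R); rewrite -val_eqE /= inordK// .
rewrite /dotp big_inord4 /cross !mxE !det_rows4 !det4E /= !dE// !inordK//=; ring.
Qed.

Lemma det4_swap23 a b c d : det4 a c b d = - det4 a b c d.
Proof. rewrite !det4E /= !laplace3 /=; ring. Qed.
Lemma det4_swap34 a b c d : det4 a b d c = - det4 a b c d.
Proof. rewrite !det4E /= !laplace3 /=; ring. Qed.
Lemma det4_alt12 a c d : det4 a a c d = 0.
Proof. rewrite !det4E /= !laplace3 /=; ring. Qed.

Lemma dotpC u v : dotp u v = dotp v u.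
Proof. by apply: eq_bigr => j _; rewrite mulrC. Qed.

Lemma dotpZr k u v : dotp u (k *: v) = k * dotp u v.
Proof. by rewrite /dotp mulr_sumr; apply: eq_bigr => j _; rewrite mxE mulrCA. Qed.

Lemma dotpBl u v w : dotp (u - v) w = dotp u w - dotp v w.
Proof. by rewrite /dotp -sumrB; apply: eq_bigr => j _; rewrite !mxE mulrBl. Qed.

(** Reversing three rows is an odd permutation. *)
Lemma cross_rev a b c : cross c b a = - cross a b c.
Proof.
apply/rowP => j; rewrite !mxE !det_rows4.
by rewrite det4_swap23 det4_swap34 det4_swap23 opprK.
Qed.

Lemma crossN2 a b c : cross a (- b) c = - cross a b c.
Proof.
apply/rowP => j; rewrite !mxE !det_rows4 !det4E /= !laplace3 /= !mxE; ring.
Qed.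

Lemma crossN3 a b c : cross a b (- c) = - cross a b c.
Proof.
apply/rowP => j; rewrite !mxE !det_rows4 !det4E /= !laplace3 /= !mxE; ring.
Qed.

Lemma rows3 (A : 'M[K]_(3, 4)) :
  col_mx (row (inord 0) A) (col_mx (row (inord 1) A) (row (inord 2) A) : 'M[K]_(2, 4)) = A.
Proof.
apply/matrixP => i j; rewrite mxE.
case: (@splitP 1 2 i) => [i1 e|i1 e]; rewrite ?(ord1 i1)// !mxE.
  by congr (A _ _); apply/val_inj; rewrite /= inordK// e (ord1 i1).
case: (@splitP 1 1 i1) => [i2 e2|i2 e2]; rewrite ?(ord1 i2)// !mxE;
  by congr (A _ _); apply/val_inj; rewrite /= inordK// e e2 (ord1 i2).
Qed.

Lemma cross_minor a b c (j : 'I_4) :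
  cross a b c 0 j = (-1) ^+ j * \det (col' j (col_mx a (col_mx b c : 'M[K]_(2, 4)) : 'M[K]_(3, 4))).
Proof.
rewrite mxE (expand_det_row _ ord0) (bigD1 j)//= big1 ?addr0; last first.
  move=> i ij; rewrite mxE; case: (@splitP 1 3 ord0) => // i1 _.
  by rewrite mxE (negPf ij) andbF mul0r.
rewrite mxE; case: (@splitP 1 3 ord0) => // i1 _; rewrite (ord1 i1) mxE !eqxx mul1r.
rewrite /cofactor add0n; congr (_ * \det _); apply/matrixP => k l; rewrite !mxE.
case: (@splitP 1 3 (lift ord0 k)) => [i2 e|i2 e].
  by move: e; rewrite (ord1 i2) /= /bump.
by rewrite (_ : i2 = k) ?mxE//; apply/val_inj; move: e; rewrite /= /bump /= !add1n => -[].
Qed.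

Definition cross_rows (A : 'M[K]_(3, 4)) : 'rV[K]_4 :=
  cross (row (inord 0) A) (row (inord 1) A) (row (inord 2) A).

Lemma cross_rows_minor (A : 'M[K]_(3, 4)) j : cross_rows A 0 j = (-1) ^+ j * \det (col' j A).
Proof. by rewrite /cross_rows cross_minor rows3. Qed.

(** The Cauchy-Binet formula for 3 x 4 matrices: the coordinates of the cross product of the rows
    are the signed minors of order 3. It is checked as a polynomial identity. *)
Lemma det_mul_trmx34 (A B : 'M[K]_(3, 4)) :
  \det (A *m B^T) = dotp (cross_rows A) (cross_rows B).
Proof.
have dE (C : 'M[K]_3) : \det C = laplace 3 (fun i j => C (inord i) (inord j)).
  rewrite -det_laplace; congr (\det _); apply/matrixP => i j.
  by rewrite mxE !inord_val.
have cE (C : 'M[K]_(3, 4)) (k : nat) : (k < 4)%N -> cross_rows C 0 (inord k) =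
    (-1) ^+ k * laplace 3 (fun i j => C (inord i) (inord (bump k j))).
  move=> k4; rewrite cross_rows_minor inordK// (dE (col' (inord k) C)); congr (_ * _).
  rewrite -!det_laplace; congr (\det _); apply/matrixP => i j; rewrite !mxE !inord_val.
  congr (C _ _); apply/val_inj; rewrite /= !inordK//.
  by move: (ltn_ord j); rewrite /bump; case: (k <= j)%N => // j3; rewrite ltnS ltnW.
rewrite dE /dotp big_inord4 !cE// !laplace3 /= /bump /=.
rewrite !mxE !big_inord4 !mxE /=; ring.
Qed.

Lemma dotp_mulmx (m n : nat) (A : 'M[K]_(m, 4)) (B : 'M[K]_(n, 4)) i j :
  (A *m B^T) i j = dotp (row i A) (row j B).
Proof. by rewrite mxE; apply: eq_bigr => k _; rewrite !mxE. Qed.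

End Cross.

Arguments laplace {K} n e : simpl never.

Section CrossField.
Context {K : fieldType}.
Implicit Types (u v a b c d : 'rV[K]_4).

(** The four vectors are the rows of an invertible matrix. The formulas for the dual vectors are all
    checked through this criterion. *)
Lemma dotp_unique a b c d u v : det4 a b c d != 0 ->
  dotp u a = dotp v a -> dotp u b = dotp v b -> dotp u c = dotp v c -> dotp u d = dotp v d ->
  u = v.
Proof.
rewrite -det_rows4; set W := col_mx _ _ => dW ea eb ec ed.
have uW : W^T \in unitmx by rewrite unitmx_tr unitmxE unitfE.
apply/eqP; rewrite -subr_eq0; apply/eqP; apply: (can_inj (mulmxK uW)); rewrite mul0mx.
have E w : dotp u w = dotp v w -> (u - v) *m w^T = 0.
  move=> e; apply/rowP => j; rewrite dotp_mulmx mxE.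
  by rewrite (ord1 j) !row_id dotpBl e subrr.
rewrite /W (@tr_col_mx _ 1 3) (@mul_mx_row _ 1 4 1 3) E// (@tr_col_mx _ 1 2).
by rewrite (@mul_mx_row _ 1 4 1 2) E// (@tr_col_mx _ 1 1) (@mul_mx_row _ 1 4 1 1) !E// !row_mx0.
Qed.

Lemma dotp_scale_cross k a b c d : dotp (k *: cross a b c) d = k * det4 d a b c.
Proof. by rewrite dotpC dotpZr dotp_cross. Qed.

Ltac sort_det4 := rewrite !det4E /= !laplace3 /=.

Section Square.
Variables (c0 c1 c2 c3 u : 'rV[K]_4) (q : K).
Hypothesis d0 : det4 c0 c1 c2 c3 != 0.

Let det4_reorder :
  [/\ det4 c2 c0 c1 c3 = det4 c0 c1 c2 c3, det4 c3 c0 c1 c2 = - det4 c0 c1 c2 c3,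
      det4 c1 c3 c2 c0 = det4 c0 c1 c2 c3 & det4 c0 c3 c2 c1 = - det4 c0 c1 c2 c3].
Proof. by split; sort_det4; ring. Qed.

Let det4_alt13 a b c : det4 a b a c = 0 :> K.
Proof. by rewrite det4_swap23 det4_alt12 oppr0. Qed.
Let det4_alt14 a b c : det4 a b c a = 0 :> K.
Proof. by rewrite det4_swap34 det4_alt13 oppr0. Qed.

(** Cramer's rule for the basis dual to [c0], ..., [c3]. Here and in the next three lemmas the
    factors are listed in the order of the final formulas, which fixes the sign; for the rows 0 and
    1, which correspond to negative frequencies, the order is reversed. *)
Lemma dual_vector2 : dotp u c0 = 0 -> dotp u c1 = 0 -> dotp u c2 = q -> dotp u c3 = 0 ->
  u = (q / det4 c0 c1 c2 c3) *: cross c0 c1 c3.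
Proof.
move=> e0 e1 e2 e3; have [r2 _ _ _] := det4_reorder.
apply: (dotp_unique d0); rewrite dotp_scale_cross ?(det4_alt12, det4_alt13, det4_alt14) ?mulr0//.
by rewrite r2 divfK.
Qed.

Lemma dual_vector3 : dotp u c0 = 0 -> dotp u c1 = 0 -> dotp u c2 = 0 -> dotp u c3 = q ->
  u = - (q / det4 c0 c1 c2 c3) *: cross c0 c1 c2.
Proof.
move=> e0 e1 e2 e3; have [_ r3 _ _] := det4_reorder.
apply: (dotp_unique d0); rewrite dotp_scale_cross ?(det4_alt12, det4_alt13, det4_alt14) ?mulr0//.
by rewrite r3 mulrNN divfK.
Qed.

Lemma dual_vector1 : dotp u c0 = 0 -> dotp u c1 = q -> dotp u c2 = 0 -> dotp u c3 = 0 ->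
  u = (q / det4 c0 c1 c2 c3) *: cross c3 c2 c0.
Proof.
move=> e0 e1 e2 e3; have [_ _ r1 _] := det4_reorder.
apply: (dotp_unique d0); rewrite dotp_scale_cross ?(det4_alt12, det4_alt13, det4_alt14) ?mulr0//.
by rewrite r1 divfK.
Qed.

Lemma dual_vector0 : dotp u c0 = q -> dotp u c1 = 0 -> dotp u c2 = 0 -> dotp u c3 = 0 ->
  u = - (q / det4 c0 c1 c2 c3) *: cross c3 c2 c1.
Proof.
move=> e0 e1 e2 e3; have [_ _ _ r0] := det4_reorder.
apply: (dotp_unique d0); rewrite dotp_scale_cross ?(det4_alt12, det4_alt13, det4_alt14) ?mulr0//.
by rewrite r0 mulrNN divfK.
Qed.

End Square.

Section Rectangular.
Variables (a b c ca cb cc u : 'rV[K]_4) (q : K).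
Let n := cross a b c.
Let N := dotp n (cross ca cb cc).
Hypothesis N0 : N != 0.
Hypothesis un : dotp u n = 0.

Let d0 : det4 n ca cb cc != 0. Proof. by rewrite -dotp_cross. Qed.
Let det4_alt13 x y z : det4 x y x z = 0 :> K.
Proof. by rewrite det4_swap23 det4_alt12 oppr0. Qed.
Let det4_alt14 x y z : det4 x y z x = 0 :> K.
Proof. by rewrite det4_swap34 det4_alt13 oppr0. Qed.

(** The inner and the outer reversal each change the sign: the formula next to the origin has the
    same shape on both sides of it. *)
Lemma cross_cross_rev : cross cc (cross c b a) ca = cross ca (cross a b c) cc.
Proof. by rewrite [cross c b a]cross_rev crossN2 cross_rev opprK. Qed.

(** The basis is now [n], [ca], [cb], [cc], with determinant [N], and [u] is known to be orthogonal
    to [n]. A cross product with [n] as a factor has this property too, so only its product with the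
    missing vector, which is [N] up to sign, remains to be computed. *)
Lemma dual_vector_mid : dotp u ca = 0 -> dotp u cb = q -> dotp u cc = 0 ->
  u = - (q / N) *: cross ca n cc.
Proof.
move=> ea eb ec.
apply: (dotp_unique d0); rewrite dotp_scale_cross ?(det4_alt12, det4_alt13, det4_alt14) ?mulr0//.
by rewrite (_ : det4 cb ca n cc = - N) ?mulrNN ?divfK// /N dotp_cross; sort_det4; ring.
Qed.

Lemma dual_vector_last : dotp u ca = 0 -> dotp u cb = 0 -> dotp u cc = q ->
  u = - (q / N) *: cross ca cb n.
Proof.
move=> ea eb ec.
apply: (dotp_unique d0); rewrite dotp_scale_cross ?(det4_alt12, det4_alt13, det4_alt14) ?mulr0//.
by rewrite (_ : det4 cc ca cb n = - N) ?mulrNN ?divfK// /N dotp_cross; sort_det4; ring.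
Qed.

Lemma dual_vector_first : dotp u ca = q -> dotp u cb = 0 -> dotp u cc = 0 ->
  u = - (q / N) *: cross cc cb (cross c b a).
Proof.
move=> ea eb ec; rewrite [cross c b a]cross_rev crossN3 -/n scalerN -scaleNr opprK.
apply: (dotp_unique d0); rewrite dotp_scale_cross ?(det4_alt12, det4_alt13, det4_alt14) ?mulr0//.
by rewrite (_ : det4 ca cc cb n = N) ?divfK// /N dotp_cross; sort_det4; ring.
Qed.

End Rectangular.

End CrossField.

(** * Conjugation, Gram determinants and bounds on determinants *)

Section Hermitian.
Context {R : realType}.
Implicit Types (a b c : 'rV[R[i]]_4).

Lemma conj_sign k : conjc ((-1) ^+ k) = (-1) ^+ k :> R[i].
Proof. by rewrite -signr_odd; case: odd; rewrite ?expr0 ?expr1 ?conjN conjc1. Qed.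

Lemma conj_det n (A : 'M[R[i]]_n) : conjc (\det A) = \det (conj_entries A).
Proof. by rewrite (det_map_mx (conjc : {rmorphism R[i] -> R[i]})). Qed.

Lemma conj_cross a b c : conj_entries (cross a b c) =
  cross (conj_entries a) (conj_entries b) (conj_entries c).
Proof.
apply/rowP => j; rewrite mxE [in LHS]cross_minor cross_minor /conj_entries.
rewrite -[in RHS]map_col_mx -map_col_mx -map_col'.
by rewrite conjM conj_sign conj_det.
Qed.

Lemma dotp_conj a : dotp a (conj_entries a) = (\sum_j normc (a 0 j) ^+ 2)%:C.
Proof. by rewrite rmorph_sum; apply: eq_bigr => j _; rewrite mxE mulcJ. Qed.

Lemma conj_trmxE m n (A : 'M[R[i]]_(m, n)) : conj_trmx A = (conj_entries A)^T.
Proof. by []. Qed.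

Lemma cross_rows_conj (A : 'M[R[i]]_(3, 4)) :
  cross_rows (conj_entries A) = conj_entries (cross_rows A).
Proof. by rewrite conj_cross /conj_entries !map_row. Qed.

(** Cauchy-Binet with a conjugate factor: each squared minor of order 3 is seen to be bounded by the
    Gram determinant. *)
Lemma det_gram34 (A : 'M[R[i]]_(3, 4)) :
  \det (A *m conj_trmx A) = (\sum_j normc (\det (col' j A)) ^+ 2)%:C.
Proof.
rewrite conj_trmxE det_mul_trmx34 cross_rows_conj dotp_conj; congr (_%:C).
apply: eq_bigr => j _; rewrite cross_rows_minor normcM exprMn [X in X * _](_ : _ = 1) ?mul1r//.
by rewrite -signr_odd; case: odd; rewrite ?expr1 ?expr0 ?normcN normc1 expr1n.
Qed.

Lemma normc_sum_le (I : Type) (r : seq I) (F : I -> R[i]) :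
  normc (\sum_(i <- r) F i) <= \sum_(i <- r) normc (F i).
Proof.
elim: r => [|i r IH]; first by rewrite !big_nil normc0.
by rewrite !big_cons (le_trans (le_normcD _ _))// lerD2l.
Qed.

Lemma normc_prod (I : Type) (r : seq I) (F : I -> R[i]) :
  normc (\prod_(i <- r) F i) = \prod_(i <- r) normc (F i).
Proof.
elim: r => [|i r IH]; first by rewrite !big_nil normc1.
by rewrite !big_cons normcM IH.
Qed.

Lemma normc_sign k : normc ((-1) ^+ k : R[i]) = 1.
Proof. by rewrite -signr_odd; case: odd; rewrite ?expr1 ?expr0 ?normcN normc1. Qed.

Lemma normc_conjc (x : R[i]) : normc (conjc x) = normc x.
Proof. by case: x => a b /=; rewrite sqrrN. Qed.

Lemma normc_det_le n (A : 'M[R[i]]_n) (g : R) : (forall i j, normc (A i j) <= g) ->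
  normc (\det A) <= n`!%:R * g ^+ n.
Proof.
move=> Ag; rewrite /determinant (le_trans (normc_sum_le _ _))//.
rewrite mulr_natl -card_Sn -sumr_const.
apply: ler_sum => s _; rewrite normcM normc_sign mul1r normc_prod.
rewrite [leRHS](_ : _ = \prod_(i < n) g); last by rewrite prodr_const card_ord.
by apply: ler_prod => i _; rewrite normc_ge0/=.
Qed.

Lemma normc_mulmx_le m n p (A : 'M[R[i]]_(m, n)) (B : 'M[R[i]]_(n, p)) (a b : R) :
  0 <= a -> (forall i j, normc (A i j) <= a) -> (forall i j, normc (B i j) <= b) ->
  forall i j, normc ((A *m B) i j) <= n%:R * (a * b).
Proof.
move=> a0 Aa Bb i j; rewrite mxE (le_trans (normc_sum_le _ _))//.
rewrite (_ : n%:R * (a * b) = \sum_(k < n) (a * b)); last first.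
  by rewrite sumr_const mulr_natl card_ord.
by apply: ler_sum => k _; rewrite normcM ler_pM ?normc_ge0.
Qed.

Lemma normc_adj_le n (A : 'M[R[i]]_n) (g : R) : (forall i j, normc (A i j) <= g) ->
  forall i j, normc ((\adj A) i j) <= (n.-1)`!%:R * g ^+ n.-1.
Proof.
move=> Ag i j; rewrite mxE /cofactor normcM normc_sign mul1r.
by apply: normc_det_le => k l; rewrite !mxE.
Qed.

(** * The completed Gram matrix and the linear system of a fiber *)

Section Gram.
Implicit Types (M X : 'M[R[i]]_4) (z : pred 'I_4).

(* Adding 1 on the diagonal where a row of [M] vanishes keeps the Gram matrix
   4 x 4 and invertible, so that [M] and its 3 x 4 reductions are treated alike. *)
Definition gramz M z : 'M[R[i]]_4 :=
  M *m conj_trmx M + \matrix_(i, j) ((i == j) && z i)%:R.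

(** The added diagonal acts only on rows where [F] vanishes. *)
Lemma gramz_mul M z m (F : 'M[R[i]]_(4, m)) : (forall k, z k -> row k F = 0) ->
  gramz M z *m F = M *m (conj_trmx M *m F).
Proof.
move=> Fz; rewrite /gramz mulmxDl mulmxA [X in _ + X](_ : _ = 0) ?addr0//.
apply/matrixP => i j; rewrite !mxE big1// => k _; rewrite mxE.
case: (eqVneq i k) => [->|_]; last by rewrite mul0r.
case zk : (z k); last by rewrite mul0r.
by have /rowP/(_ j) := Fz _ zk; rewrite !mxE => ->; rewrite mulr0.
Qed.

Lemma gramz_row M z k : z k -> row k M = 0 -> forall j, gramz M z k j = (k == j)%:R.
Proof.
move=> zk Mk j; rewrite !mxE zk andbT big1 ?add0r// => l _.
by have /rowP/(_ l) := Mk; rewrite !mxE => ->; rewrite mul0r.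
Qed.

Lemma row_gramz M z k n (B : 'M[R[i]]_(4, n)) : z k -> row k M = 0 -> row k (gramz M z *m B) = row k B.
Proof.
move=> zk Mk; apply/rowP => j; rewrite !mxE (bigD1 k)//= gramz_row// eqxx mul1r big1 ?addr0// => l.
by rewrite gramz_row// eq_sym => /negPf ->; rewrite mul0r.
Qed.

Lemma normc_gramz_le M z (g : R) : 0 <= g -> (forall i j, normc (M i j) <= g) ->
  forall i j, normc (gramz M z i j) <= 4 * g ^+ 2 + 1.
Proof.
move=> g0 Mg i j; rewrite mxE (le_trans (le_normcD _ _))// lerD//.
  by apply: normc_mulmx_le => // k l; rewrite !mxE normc_conjc.
by rewrite mxE; case: (_ && _); rewrite ?normc1 ?normc0.
Qed.

(** Cramer's rule: a cofactor of order 3 has 3! = 6 terms, each bounded by the cube of the bound 4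
    g^2 + 1 on the entries, and is divided by a determinant of modulus at least [c]. The outer
    factor 4 comes from the matrix product. *)
Lemma normc_gramz_solution_le M z (g c : R) : 0 <= g -> 0 < c ->
  (forall i j, normc (M i j) <= g) -> c <= normc (\det (gramz M z)) ->
  forall i j, normc ((invmx (gramz M z) *m M) i j) <=
    4 * (c^-1 * (6 * (4 * g ^+ 2 + 1) ^+ 3) * g).
Proof.
move=> g0 c0 Mg cd.
have d0 : \det (gramz M z) != 0.
  by apply: contraTneq cd => ->; rewrite normc0 -ltNge.
have p0 : 0 <= 4 * g ^+ 2 + 1 by rewrite addr_ge0// mulr_ge0// sqr_ge0.
apply: normc_mulmx_le => //; first by rewrite !mulr_ge0// ?invr_ge0 ?exprn_ge0// ltW.
move=> i j; rewrite /invmx unitmxE unitfE d0 mxE normcM.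
apply: ler_pM; rewrite ?normc_ge0//.
  by rewrite normcV lef_pV2// ?posrE// (lt_le_trans c0).
by have := normc_adj_le (normc_gramz_le z g0 Mg) i j.
Qed.

Lemma gramz_unit M z (c : R) : 0 < c -> c <= normc (\det (gramz M z)) -> gramz M z \in unitmx.
Proof.
move=> c0 cd; rewrite unitmxE unitfE; apply: contraTneq cd => ->.
by rewrite normc0 -ltNge.
Qed.

Section Solution.
Variables (M : 'M[R[i]]_4) (z : pred 'I_4) (q : R[i]).
Hypothesis Mz : forall k, z k -> row k M = 0.
Hypothesis uG : gramz M z \in unitmx.

(** The fibers of the dual generators, [q] being the step [h]. *)
Definition gramz_solution : 'M[R[i]]_4 := q^-1 *: (invmx (gramz M z) *m M).

Lemma row_gramz_solution k : z k -> row k gramz_solution = 0.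
Proof.
move=> zk; have := row_gramz (invmx (gramz M z) *m M) zk (Mz zk).
rewrite mulmxA mulmxV// mul1mx (Mz zk) => e; apply/rowP => j.
by move/rowP/(_ j): e; rewrite !mxE => <-; rewrite mulr0.
Qed.

Lemma gramz_solutionP : q != 0 ->
  q *: (M *m (conj_trmx M *m gramz_solution)) = M.
Proof.
move=> q0; rewrite -(gramz_mul _ row_gramz_solution) /gramz_solution -scalemxAr scalerA mulfV//.
by rewrite scale1r mulmxA mulmxV// mul1mx.
Qed.

Lemma gramz_solution_unique X : q != 0 -> (forall k, z k -> row k X = 0) ->
  q *: (M *m (conj_trmx M *m X)) = M -> X = gramz_solution.
Proof.
move=> q0 Xz; rewrite -(gramz_mul _ Xz) => e; rewrite /gramz_solution.
have <- : invmx (gramz M z) *m (q *: (gramz M z *m X)) = invmx (gramz M z) *m M by rewrite e.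
by rewrite -scalemxAr mulmxA mulVmx// mul1mx scalerA mulVf// scale1r.
Qed.

(** With G the completed matrix and Z the added diagonal, G Z = Z because the corresponding rows of
    M vanish. Hence G^-1 M M^* = G^-1 (G - Z) = 1 - Z. *)
Lemma gramz_solution_dual k l :
  dotp (row k gramz_solution) (conj_entries (row l M)) = q^-1 * ((k == l) && ~~ z k)%:R.
Proof.
pose Z : 'M[R[i]]_4 := \matrix_(i, j) ((i == j) && z i)%:R.
have GZ : gramz M z *m Z = Z.
  apply/matrixP => i j; rewrite mxE (bigD1 j)//= big1 ?addr0; last first.
    by move=> m /negPf mj; rewrite [Z _ _]mxE mj mulr0.
  rewrite !mxE eqxx /=; case zj : (z j); last first.
    by rewrite mulr0; case: (eqVneq i j) => // ->; rewrite zj.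
  rewrite mulr1 big1 ?add0r; first by case: (eqVneq i j) => // ->; rewrite zj.
  move=> m _; rewrite !mxE; have /rowP/(_ m) := Mz zj; rewrite !mxE => ->.
  by rewrite conjc0 mulr0.
have E : invmx (gramz M z) *m (M *m conj_trmx M) = 1%:M - Z.
  rewrite (_ : M *m _ = gramz M z - Z); last by rewrite /gramz addrK.
  by rewrite mulmxBr mulVmx// -[X in _ - _ *m X]GZ mulmxA mulVmx// mul1mx.
rewrite /conj_entries map_row -dotp_mulmx -/(conj_entries M) -conj_trmxE.
rewrite /gramz_solution -scalemxAl -mulmxA E !mxE; congr (_ * _).
by case: eqP => //= _; case: (z k); rewrite ?subrr ?subr0.
Qed.

(** The rows of the solution are linear combinations of the rows of [M]. *)
Lemma gramz_solution_orth w k : M *m w^T = 0 -> dotp (row k gramz_solution) w = 0.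
Proof.
move=> Mw; rewrite -[w](row_id 0) -dotp_mulmx /gramz_solution -scalemxAl -mulmxA Mw.
by rewrite mulmx0 scaler0 mxE.
Qed.

End Solution.

Lemma det_gramz0 M : \det (gramz M pred0) = (normc (\det M) ^+ 2)%:C.
Proof.
rewrite /gramz [X in _ + X](_ : _ = 0) ?addr0; last first.
  by apply/matrixP => i j; rewrite !mxE andbF.
by rewrite det_mulmx conj_trmxE det_tr -conj_det mulcJ.
Qed.

(** The row [i] of the completed matrix is the i-th basis vector, and expanding along it leaves the
    Gram matrix of the other rows. *)
Lemma det_gramz1 M i : row i M = 0 -> \det (gramz M (pred1 i)) =
  \det (row' i M *m conj_trmx (row' i M)).
Proof.
move=> Mi.
have gi j : gramz M (pred1 i) i j = (i == j)%:R by rewrite gramz_row//= eqxx.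
rewrite (expand_det_row _ i) (bigD1 i)//= gi eqxx mul1r.
rewrite big1 ?addr0 => [|j]; last by rewrite gi eq_sym => /negPf ->; rewrite mul0r.
rewrite /cofactor -signr_odd oddD addbb expr0 mul1r; congr (\det _).
apply/matrixP => k l; rewrite !mxE /= [lift i k == i]eq_sym (negPf (neq_lift i k)) andbF addr0.
by apply: eq_bigr => m _; rewrite !mxE.
Qed.

(** An increasing map from three to four indices omits exactly one value, so that the minors of
    order 3 are those obtained by deleting a row and a column. *)
Lemma increasing_lift (f : {ffun 'I_3 -> 'I_4}) : increasing_ffun f ->
  exists i : 'I_4, forall k : 'I_3, f k = lift i k.
Proof.
move=> /forallP fP; have fl (a b : 'I_3) : (a < b)%N -> (f a < f b)%N.
  by move=> ab; have /forallP/(_ b)/implyP := fP a; exact.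
have f01 := fl (inord 0) (inord 1); have f12 := fl (inord 1) (inord 2).
rewrite !inordK// in f01 f12.
have [i i4 [f0 f1 f2]] : exists2 i : nat, (i < 4)%N &
    [/\ f (inord 0) = bump i 0 :> nat, f (inord 1) = bump i 1 :> nat
      & f (inord 2) = bump i 2 :> nat].
  move: (f01 isT) (f12 isT) (ltn_ord (f (inord 2))).
  move: (f (inord 0) : nat) (f (inord 1) : nat) (f (inord 2) : nat).
  case=> [|[|p]] [|[|[|q]]] [|[|[|[|r]]]] //; rewrite ?ltnS ?ltn0 //; do ?[by lia];
    by [exists 3%N|exists 2%N|exists 1%N|exists 0%N].
exists (Ordinal i4) => k; apply/val_inj => /=; rewrite -[k]inord_val.
by case: k => [[|[|[|//]]] k3] /=; rewrite ?f0 ?f1 ?f2 inordK.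
Qed.

(** A minor that uses the zero row vanishes, and the square of any other is a term of the Gram
    determinant. The constant 4^6 counts all pairs of maps from three to four indices, which is a
    crude bound on the number of minors. *)
Lemma minors_sq_le M i : row i M = 0 ->
  minors_sq 3 M <= 4 ^+ 6 * normc (\det (gramz M (pred1 i))).
Proof.
move=> Mi; rewrite det_gramz1// det_gram34 normcC ger0_norm; last first.
  by apply: sumr_ge0 => j _; exact: sqr_ge0.
set S := \sum_j _.
have S0 : 0 <= S by apply: sumr_ge0 => j _; exact: sqr_ge0.
have le1 (r c : {ffun 'I_3 -> 'I_4}) : increasing_ffun r -> increasing_ffun c ->
    normc (\det (mxsub r c M)) ^+ 2 <= S.
  move=> /increasing_lift[a ra] /increasing_lift[j cj].
  case: (eqVneq a i) => [ai|ai].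
    rewrite /S (bigD1 j)//= (_ : mxsub r c M = col' j (row' i M)) ?lerDl ?sumr_ge0//.
      by move=> k _; exact: sqr_ge0.
    by apply/matrixP => k l; rewrite !mxE ra cj ai.
  have [k ik] : exists k, i = lift a k by case: (unliftP a i) ai => [k ->|-> /eqP//]; exists k.
  rewrite (expand_det_row _ k) big1 ?normc0 ?expr0n// => l _; rewrite mxE ra -ik.
  by have /rowP/(_ (c l)) := Mi; rewrite !mxE => ->; rewrite mul0r.
rewrite /minors_sq.
apply: (@le_trans _ _ (\sum_(r : {ffun 'I_3 -> 'I_4}) \sum_(c : {ffun 'I_3 -> 'I_4}) S)).
  rewrite [leLHS]big_mkcond; apply: ler_sum => r _; case: ifP => ri; last first.
    by apply: sumr_ge0.
  by rewrite [leLHS]big_mkcond; apply: ler_sum => c _; case: ifP => ci //; exact: le1.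
by rewrite !sumr_const card_ffun !card_ord -mulrnA -[leLHS]mulr_natl natrM !natrX -exprD.
Qed.

End Gram.

End Hermitian.

(** * Fibers of the Fourier transform *)

Section Fibers.
Context {R : realType}.
Local Notation mu := (@lebesgue_measure R).
Variable h : R.
Hypothesis h0 : 0 < h.
Implicit Types (F G : R -> R[i]) (k l : 'I_4).

(* The indices 0, ..., 3 stand for the shifts - 2h, - h, 0, h of the rows of the
   pre-Gramian. *)
Definition shift4 k : R := (k%:R - 2) * h.
Let I0 : set R := `[0, h[%classic.

(** The indicator makes a fiber a function on the line supported in one period, as the lemmas on
    Fourier series require. *)
Definition fiber F k (y : R) : R[i] := (\1_I0 y)%:C * F (y + shift4 k).

Lemma sum_int_range2 (V : nmodType) (u : R -> V) :
  \sum_(k <- int_range 2) u (k%:~R * h) = \sum_(k < 4) u (shift4 k).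
Proof.
rewrite /int_range /= !big_cons big_nil !big_ord_recl big_ord0 /shift4 /= !addr0.
rewrite (_ : 0%:~R * h = ((bump 0 (bump 0 0))%:R - 2) * h); last by rewrite /= subrr.
rewrite (_ : 1%:~R * h = ((bump 0 (bump 0 (bump 0 0)))%:R - 2) * h); last first.
  by congr (_ * h); rewrite /bump /=; ring.
rewrite (_ : (Negz 0)%:~R * h = ((bump 0 0)%:R - 2) * h); last first.
  by congr (_ * h); rewrite /bump NegzE /=; ring.
rewrite (_ : (Negz 1)%:~R * h = (0%:R - 2) * h); last first.
  by congr (_ * h); rewrite NegzE; ring.
by rewrite addrA addrC [X in X + _]addrC -addrA.
Qed.

Lemma indic_sq (A : set R) y : (\1_A y)%:C * (\1_A y)%:C = (\1_A y)%:C :> R[i].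
Proof. by rewrite indicE; case: (y \in A); rewrite ?mulr1 ?mulr0. Qed.

Lemma mI0 : measurable I0. Proof. exact: measurable_itv. Qed.

Lemma L2_fiber F k : L2 F -> L2 (fiber F k).
Proof. by move=> lF; apply: L2_indic_mul mI0 _; exact: (L2_tau (shift4 k) lF). Qed.

Lemma cmeasurable_fiber F k : cmeasurable F -> cmeasurable (fiber F k).
Proof.
move=> mF; apply: cmeasurableM; first exact: cmeasurable_indic mI0.
exact: cmeasurable_shift.
Qed.

(** Exact rather than almost everywhere vanishing; it is obtained by passing to the representatives
    given by [cutoff] and [unfiber]. *)
Definition in_strip F := forall x, ~ (- (2%:R * h) <= x < 2%:R * h) -> F x = 0.

Lemma sum_nsqE (I : finType) (u : I -> R -> R[i]) : (forall i, L2 (u i)) ->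
  ((\sum_i nsq (u i))%:E = \int[mu]_x (\sum_i normc (u i x) ^+ 2)%:E)%E.
Proof.
move=> lu; rewrite -sumEFin.
under eq_bigr => i _ do rewrite -norm2sqE//.
rewrite -ge0_integral_sum//.
- by apply: eq_integral => x _; rewrite sumEFin.
- by move=> i; apply/measurable_EFinP; apply: measurable_normc2; case: (lu i).
- by move=> i x _; rewrite lee_fin sqr_ge0.
Qed.

Lemma nsq_fibers F : L2 F -> in_strip F -> nsq F = \sum_(k < 4) nsq (fiber F k).
Proof.
move=> lF sF.
have lf k : L2 (fiber F k) by exact: L2_fiber.
pose u x := normc (F x) ^+ 2.
have mu' : measurable_fun setT u by apply: measurable_normc2; case: lF.
have u0 x : 0 <= u x by exact: sqr_ge0.
apply: EFin_inj; rewrite -norm2sqE// sum_nsqE//.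
transitivity (\int[mu]_(x in `[(- (2%:R * h))%R, (2%:R * h)%R[) (u x)%:E)%E.
  rewrite integral_indic_mkcond; apply: eq_integral => x _.
  rewrite indicE; case: (boolP (x \in _)) => [_|xn]; first by rewrite mul1e.
  rewrite mul0e sF ?normc0 ?expr0n// => H; move/negP: xn; apply.
  by rewrite inE /= in_itv.
rewrite (ge0_integral_tile h0 2 mu' u0) integral_indic_mkcond; apply: eq_integral => y _.
rewrite (sum_int_range2 (fun a => u (y + a))) -EFinM; congr (_%:E).
rewrite mulr_sumr; apply: eq_bigr => k _.
rewrite /fiber normcM exprMn normcC /u -/I0; congr (_ * _).
by rewrite indicE; case: (_ \in _); rewrite ?normr1 ?normr0 ?expr1n ?expr0n.
Qed.

Lemma cintegral_fibers F : cintegrable F -> in_strip F ->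
  cintegral F = cintegral (fun y => \sum_(k < 4) fiber F k y).
Proof.
move=> cF sF; rewrite (cintegral_tile h0 cF sF); congr cintegral; apply/funext => y.
rewrite (_ : tile h 0 = I0); last by rewrite tile0E.
rewrite (sum_int_range2 (fun a => F (y + a))) mulr_sumr.
by apply: eq_bigr.
Qed.

(** Inverse of the cutting into fibers: the four pieces are put back side by side on [-2h, 2h). *)
Definition unfiber (G : 'I_4 -> R -> R[i]) (x : R) : R[i] :=
  \sum_(k < 4) (\1_I0 (x - shift4 k))%:C * G k (x - shift4 k).

Lemma L2_unfiber (G : 'I_4 -> R -> R[i]) : (forall k, L2 (G k)) -> L2 (unfiber G).
Proof.
move=> lG; apply: L2_sum => k _.
exact: (L2_tau (- shift4 k) (L2_indic_mul mI0 (lG k))).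
Qed.

Lemma in_strip_unfiber (G : 'I_4 -> R -> R[i]) : in_strip (unfiber G).
Proof.
move=> x xh; rewrite /unfiber big1// => k _; rewrite indicE memNset ?mul0r//.
rewrite /I0 /= in_itv/= => /andP[h1 h2]; apply: xh.
have k3 : (k : nat)%:R <= 3 :> R by rewrite (ler_nat _ _ 3) -ltnS.
have k0 : 0 <= (k : nat)%:R :> R by exact: ler0n.
by move: h1 h2; rewrite /shift4; move: (k : nat)%:R k3 k0 => q q3 q0 h1 h2; nra.
Qed.

Lemma shift4_tile k l y : y \in I0 ->
  (y + shift4 k - shift4 l \in I0) = (k == l).
Proof.
move=> yI; case: (eqVneq k l) => [->|kl]; first by rewrite addrK.
move: yI; rewrite inE /I0 /= in_itv/= => /andP[y0 yh]; apply: memNset.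
rewrite /= in_itv/= /shift4 => /andP[h1 h2].
move: kl; rewrite neq_ltn => /orP[] kl.
  have : (k.+1)%:R <= (l : nat)%:R :> R by rewrite ler_nat.
  by rewrite -natr1; move: (k : nat)%:R (l : nat)%:R h1 h2 => p q h1 h2 pq; nra.
have : (l.+1)%:R <= (k : nat)%:R :> R by rewrite ler_nat.
by rewrite -natr1; move: (k : nat)%:R (l : nat)%:R h1 h2 => p q h1 h2 pq; nra.
Qed.

Lemma fiber_unfiber (G : 'I_4 -> R -> R[i]) k y :
  fiber (unfiber G) k y = (\1_I0 y)%:C * G k y.
Proof.
rewrite /fiber /unfiber [in LHS]indicE [in RHS]indicE; case: (boolP (y \in I0)) => yI; last by rewrite !mul0r.
rewrite !mul1r (bigD1 k)//= big1 ?addr0 => [|l lk].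
  by rewrite indicE shift4_tile// eqxx mul1r addrK.
by rewrite indicE shift4_tile// eq_sym (negPf lk) mul0r.
Qed.

Lemma ae_fibers (Q : R -> Prop) : {ae mu, forall x, Q x} ->
  {ae mu, forall y, forall k, Q (y + shift4 k)}.
Proof.
move=> Qx; suff : forall s : seq 'I_4, {ae mu, forall y, forall k, k \in s -> Q (y + shift4 k)}.
  by move/(_ (enum 'I_4)); apply: filterS => y H k; apply: H; rewrite mem_enum.
elim=> [|l s IH]; first by apply: aeW => y k; rewrite in_nil.
apply: filterS2 (ae_shift (shift4 l) Qx) IH => y Ql H k; rewrite inE => /orP[/eqP->//|].
exact: H.
Qed.

Lemma ae_unfibers (Q : R -> Prop) : {ae mu, forall y, Q y} ->
  {ae mu, forall x, forall k, Q (x - shift4 k)}.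
Proof.
move=> Qx; suff : forall s : seq 'I_4, {ae mu, forall y, forall k, k \in s -> Q (y - shift4 k)}.
  by move/(_ (enum 'I_4)); apply: filterS => y H k; apply: H; rewrite mem_enum.
elim=> [|l s IH]; first by apply: aeW => y k; rewrite in_nil.
apply: filterS2 (ae_shift (- shift4 l) Qx) IH => y Ql H k; rewrite inE => /orP[/eqP->//|].
exact: H.
Qed.

Lemma sum_nsq_le (I J : finType) (u : I -> R -> R[i]) (v : J -> R -> R[i]) (C : R) :
  0 <= C -> (forall i, L2 (u i)) -> (forall j, L2 (v j)) ->
  {ae mu, forall x, \sum_i normc (u i x) ^+ 2 <= C * \sum_j normc (v j x) ^+ 2} ->
  \sum_i nsq (u i) <= C * \sum_j nsq (v j).
Proof.
move=> C0 lu lv uv; rewrite -lee_fin EFinM !sum_nsqE//.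
have mS (K : finType) (t : K -> R -> R[i]) : (forall a, L2 (t a)) ->
    measurable_fun setT (fun x => \sum_a normc (t a x) ^+ 2).
  by move=> lt; apply: measurable_sum => a; apply: measurable_normc2; case: (lt a).
  rewrite -ge0_integralZl//.
  - apply: ae_ge0_le_integral => //.
    + by move=> x _; rewrite lee_fin sumr_ge0// => i _; exact: sqr_ge0.
    + by apply/measurable_EFinP; exact: mS.
    + by move=> x _; rewrite -EFinM lee_fin mulr_ge0// sumr_ge0// => i _; exact: sqr_ge0.
    + by apply/measurable_EFinP; apply: measurable_funM; [exact: measurable_cst|exact: mS].
    + by apply: filterS uv => x H _; rewrite -EFinM lee_fin.
  - by apply/measurable_EFinP; exact: mS.
  - by move=> x _; rewrite lee_fin sumr_ge0// => i _; exact: sqr_ge0.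
Qed.

End Fibers.

(** * Representatives supported in the frequency band *)

Section CutOff.
Context {R : realType}.
Local Notation mu := (@lebesgue_measure R).
Implicit Types (f F : R -> R[i]).

Lemma ae_neq (a : R) : {ae mu, forall x, x != a}.
Proof.
exists [set a]; split => //; first exact: lebesgue_measure_set1.
by move=> x /= /negP; rewrite negbK => /eqP.
Qed.

(** The open interval differs from the closed one of [bandlimited] by two points, a null set. *)
Definition cutoff (omega : R) F (x : R) : R[i] :=
  (\1_(`]- omega, omega[%classic : set R) x)%:C * F x.

Lemma L2_cutoff omega F : L2 F -> L2 (cutoff omega F).
Proof. by move=> lF; apply: L2_indic_mul => //; exact: measurable_itv. Qed.

Lemma cutoff_out omega F x : x \notin `]- omega, omega[ -> cutoff omega F x = 0.
Proof. by move=> /negP xn; rewrite /cutoff indicE memNset ?mul0r. Qed.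

Lemma cutoff_in omega F x : x \in `]- omega, omega[ -> cutoff omega F x = F x.
Proof. by move=> xi; rewrite /cutoff indicE mem_set ?mul1r. Qed.

Lemma cutoff_fourier omega f : bandlimited omega f ->
  {ae mu, forall x, fourier f x = cutoff omega (fourier f) x}.
Proof.
move=> [lf fo]; apply: filterS3 (ae_neq omega) (ae_neq (- omega)) fo => x x1 x2 H.
 case: (boolP (x \in `]- omega, omega[)) => xi; first by rewrite cutoff_in.
rewrite cutoff_out// H//; apply: contra xi; rewrite !in_itv/= !lt_neqAle => /andP[-> ->].
by rewrite x1 eq_sym x2.
Qed.

Lemma bandlimitedP omega f F : L2 f -> {ae mu, forall x, fourier f x = F x} ->
  (forall x, x \notin `]- omega, omega[ -> F x = 0) -> bandlimited omega f.
Proof.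
move=> lf fF F0; split => //; apply: filterS fF => x -> xn; apply: F0.
by apply: contra xn; exact: subset_itv_oo_cc.
Qed.

Lemma in_strip_cutoff (h omega : R) F : omega <= 2 * h -> in_strip h (cutoff omega F).
Proof.
move=> wh x xn; apply: cutoff_out; apply/negP; rewrite in_itv/= => /andP[h1 h2]; apply: xn.
by apply/andP; split; lra.
Qed.

End CutOff.

(** * The frame coefficients and the frame operator on fibers *)

Section FrameFibers.
Context {R : realType}.
Local Notation mu := (@lebesgue_measure R).
Variables (omega t0 gamma : R) (phi : 'I_4 -> R -> R[i]).
Hypothesis t00 : 0 < t0.
Let h : R := step t0.
Hypothesis wh : omega <= 2 * h.
Hypothesis bphi : forall j, bandlimited omega (phi j).
Hypothesis gamma0 : 0 < gamma.
Implicit Types (f F : R -> R[i]) (j k l : 'I_4).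

Let psi j := cutoff omega (fourier (phi j)).
Hypothesis psi_le : {ae mu, forall x, forall j, normc (psi j x) ^+ 2 <= gamma}.

Let h0 : 0 < h. Proof. by rewrite /h /step divr_gt0// mulr_gt0 ?pi_gt0. Qed.
Let L2phi j : L2 (phi j). Proof. by case: (bphi j). Qed.
Let L2psi j : L2 (psi j). Proof. by apply: L2_cutoff; apply: L2_fourier. Qed.
Let strip_psi j : in_strip h (psi j). Proof. exact: in_strip_cutoff. Qed.
Let fourier_phi j : {ae mu, forall x, fourier (phi j) x = psi j x}.
Proof. exact: cutoff_fourier. Qed.

Definition bracket F j y : R[i] :=
  \sum_(k < 4) fiber h F k y * conjc (fiber h (psi j) k y).

Lemma freq_step : 2 * pi / h = t0.
Proof.
have p0 : 0 < pi :> R by exact: pi_gt0.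
by rewrite /h /step invf_div mulrCA divff ?mulr1// mulf_neq0 ?gt_eqF.
Qed.

(** The exponentials of frequency n t0 have period [h], so the same factor comes out of all four
    fibers. *)
Lemma fiber_modulation (n : int) F k y :
  fiber h (fun x => expi (n%:~R * t0 * x) * F x) k y = expi (n%:~R * t0 * y) * fiber h F k y.
Proof.
rewrite /fiber mulrCA; congr (_ * (_ * _)).
have := fexp_period h0 n y (Posz k - 2); rewrite /fexp freq_step /shift4 => <-.
by congr (expi (_ * (_ + _ * _))); rewrite intrB.
Qed.

Lemma fiber_psi_le k j : {ae mu, forall y, normc (fiber h (psi j) k y) ^+ 2 <= gamma}.
Proof.
apply: filterS (ae_fibers h psi_le) => y /(_ k j) H.
rewrite /fiber normcM exprMn (le_trans _ H)//.
by rewrite -[leRHS]mul1r ler_wpM2r ?sqr_ge0 ?normc2_indic.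
Qed.

Lemma L2_bracket F j : L2 F -> L2 (bracket F j).
Proof.
move=> lF; apply: L2_sum => k _.
rewrite (_ : (fun x => _) = (fun x => conjc (fiber h (psi j) k x) * fiber h F k x)); last first.
  by apply/funext => x; rewrite mulrC.
apply: (@L2_bounded_mul _ _ _ gamma).
- by apply: cmeasurableJ; apply: cmeasurable_fiber; case: (L2psi j).
- by apply: filterS (fiber_psi_le k j) => y; rewrite normcJ2.
- exact: L2_fiber.
Qed.

Lemma bracket_supp F j y : ~ (`[0, 0 + h[%classic y : Prop) -> bracket F j y = 0.
Proof.
rewrite add0r => yn; rewrite /bracket big1// => k _.
by rewrite /fiber indicE memNset// !mul0r.
Qed.

Lemma L2_translate j n : L2 (translate t0 phi j n).
Proof. exact: L2_tau. Qed.

Lemma fourier_translate j n : {ae mu, forall x,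
  fourier (translate t0 phi j n) x = expi (n%:~R * t0 * x) * psi j x}.
Proof.
by apply: filterS2 (fourier_tau (n%:~R * t0) (L2phi j)) (fourier_phi j) => x -> ->.
Qed.

Let L2mod n F : L2 F -> L2 (fun x => expi (n%:~R * t0 * x) * F x).
Proof.
move=> lF; apply: (@L2_bounded_mul _ _ _ 1) => //.
  by apply: cmeasurable_expi; apply: measurable_funM => //; exact: measurable_cst.
by apply: aeW => x; rewrite normc2_expi.
Qed.

Lemma inner_translate f F j n : L2 f -> L2 F -> in_strip h F ->
  {ae mu, forall x, fourier f x = F x} ->
  inner f (translate t0 phi j n) = fcoef 0 h (bracket F j) n.
Proof.
move=> lf lF sF fF; have lT := L2_translate j n; have lm := L2mod n (L2psi j).
rewrite -(inner_fourier lf lT) innerE.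
have -> : cintegral (fun x => fourier f x * conjc (fourier (translate t0 phi j n) x)) =
    cintegral (fun x => F x * conjc (expi (n%:~R * t0 * x) * psi j x)).
  apply: cintegral_ae.
  - by apply: cintegrable_cmeasurable; apply: L2_cintegrable; exact: L2_fourier.
  - by apply: cintegrable_cmeasurable; apply: L2_cintegrable.
  - by apply: filterS2 fF (fourier_translate j n) => x -> ->.
rewrite (cintegral_fibers h0); first last.
- by move=> x xn; rewrite sF// mul0r.
- exact: L2_cintegrable.
rewrite /fcoef innerE; congr cintegral; apply/funext => y.
rewrite /bracket mulr_suml; apply: eq_bigr => k _.
rewrite /fbasis add0r /fexp freq_step.
have E := fiber_modulation n (psi j) k y.
transitivity (fiber h F k y * conjc (fiber h (fun x => expi (n%:~R * t0 * x) * psi j x) k y)).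
  rewrite /fiber (conjM (\1_ _ y)%:C (expi _ * _)); set i1 := (\1_ _ y)%:C.
  have ii : i1 * conjc i1 = i1 by rewrite /i1 indicE; case: (_ \in _); rewrite ?conjc1 ?conjc0 ?mulr1 ?mulr0.
  by rewrite [RHS]mulrACA ii.
have pi1 : fiber h (psi j) k y * (\1_(`[0, h[%classic : set R) y)%:C = fiber h (psi j) k y.
  by rewrite /fiber mulrAC indic_sq.
rewrite E [in RHS]conjM -[in LHS]pi1 !conjM; ring.
Qed.

Lemma frame_sum_fibers f F : L2 f -> L2 F -> in_strip h F ->
  {ae mu, forall x, fourier f x = F x} ->
  (\sum_(j < 4) \esum_(n in [set: int])
     ((normc (inner f (translate t0 phi j n))) ^+ 2)%:E)%E =
  (h * \sum_(j < 4) nsq (bracket F j))%:E.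
Proof.
move=> lf lF sF fF; rewrite mulr_sumr -sumEFin; apply: eq_bigr => j _.
rewrite -(parseval h0 (L2_bracket j lF) (@bracket_supp F j)).
by apply: eq_esum => n _; rewrite (inner_translate j n lf lF sF fF).
Qed.

Lemma fourier_sum (I : Type) (s : seq I) (u U : I -> R -> R[i]) :
  (forall i, L2 (u i)) -> (forall i, {ae mu, forall x, fourier (u i) x = U i x}) ->
  {ae mu, forall x, fourier (fun t => \sum_(i <- s) u i t) x = \sum_(i <- s) U i x}.
Proof.
move=> lu uU; elim: s => [|i s IH].
  have l0 := @L20 R.
  rewrite (_ : (fun t => _) = (fun t => 0 * (fun=> 0) t)); last first.
    by apply/funext => t; rewrite big_nil mul0r.
  by apply: filterS (fourierZ 0 l0) => x ->; rewrite big_nil mul0r.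
rewrite (_ : (fun t => _) = (fun t => u i t + (fun t => \sum_(i <- s) u i t) t)); last first.
  by apply/funext => t; rewrite big_cons.
have lS : L2 (fun t => \sum_(i <- s) u i t) by apply: L2_sum => k _.
by apply: filterS3 (fourierD (lu i) lS) (uU i) IH => x -> -> ->; rewrite big_cons.
Qed.

(** Cauchy-Schwarz against the vector with four entries 1; the defect is a sum of squared
    differences. *)
Lemma normc2_sum4_le (a : 'I_4 -> R[i]) :
  normc (\sum_j a j) ^+ 2 <= 4 * \sum_j normc (a j) ^+ 2.
Proof.
have h2 : 0 <= normc (\sum_j a j) by exact: normc_ge0.
have h1 : normc (\sum_j a j) <= \sum_j normc (a j) by exact: normc_sum_le.
apply: (@le_trans _ _ ((\sum_j normc (a j)) ^+ 2)).
  by rewrite ler_pXn2r// nnegrE (le_trans h2).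
rewrite !big_inord4; move: (normc _) (normc _) (normc _) (normc _) => p q r t.
have := sqr_ge0 (p - q); have := sqr_ge0 (p - r); have := sqr_ge0 (p - t).
have := sqr_ge0 (q - r); have := sqr_ge0 (q - t); have := sqr_ge0 (r - t); nra.
Qed.

Lemma fiber_sum (I : Type) (s : seq I) (u : I -> R -> R[i]) k y :
  fiber h (fun x => \sum_(i <- s) u i x) k y = \sum_(i <- s) fiber h (u i) k y.
Proof. by rewrite /fiber mulr_sumr. Qed.

Lemma fiberZ c F k y : fiber h (fun x => c * F x) k y = c * fiber h F k y.
Proof. by rewrite /fiber mulrCA. Qed.

(** On the fibers, a finite partial sum of the frame series is the expression for [G] with each
    bracket replaced by a partial sum of its Fourier series. As the fibers of the [psi j] are
    bounded, the error is controlled by those of four Fourier series, which converge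
    unconditionally. *)
Lemma is_frame_operator_fibers f F g G : L2 f -> L2 F -> in_strip h F ->
  {ae mu, forall x, fourier f x = F x} ->
  L2 g -> L2 G -> in_strip h G -> {ae mu, forall x, fourier g x = G x} ->
  (forall k, {ae mu, forall y, fiber h G k y =
     h%:C * \sum_j bracket F j y * fiber h (psi j) k y}) ->
  is_frame_operator t0 phi f g.
Proof.
move=> lf lF sF fF lg lG sG gG fibG; split => // e e0.
pose c j n := inner f (translate t0 phi j n).
pose P j := bracket F j.
pose tau_ s x := \sum_j \sum_(n <- s) c j n * (expi (n%:~R * t0 * x) * psi j x).
have lP j : L2 (P j) by exact: L2_bracket.
have ltau s : L2 (tau_ s) by do 2!(apply: L2_sum => ? _); apply: L2Z; exact: L2mod.
have fT s : {ae mu, forall x, fourier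
    (fun t => \sum_(j < 4) \sum_(n <- s) c j n * translate t0 phi j n t) x = tau_ s x}.
  apply: fourier_sum => j; first by apply: L2_sum => n _; apply: L2Z; exact: L2_translate.
  apply: fourier_sum => n; first by apply: L2Z; exact: L2_translate.
  by apply: filterS2 (fourierZ (c j n) (L2_translate j n)) (fourier_translate j n) => x -> ->.
have hC : h%:C != 0 :> R[i] by rewrite eq_complex /= gt_eqF.
have fibtau s k y : fiber h (tau_ s) k y =
    h%:C * \sum_j fsum 0 h (P j) s y * fiber h (psi j) k y.
  rewrite fiber_sum mulr_sumr; apply: eq_bigr => j _; rewrite fiber_sum /fsum mulr_suml mulr_sumr.
  apply: eq_bigr => n _; rewrite fiberZ fiber_modulation /c (inner_translate j n lf lF sF fF).
  rewrite -/(P j) /fbasis /fexp freq_step add0r.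
  have pi1 : (\1_(`[0, h[%classic : set R) y)%:C * fiber h (psi j) k y = fiber h (psi j) k y.
    by rewrite /fiber mulrA indic_sq.
  rewrite -{1}pi1; move: (fcoef _ _ _ _) (expi _) (fiber _ _ _ _) => u v w.
  by rewrite -!mulrA [RHS]mulrCA [X in _ = _ * X]mulrA divff ?mul1r//; ring.
(* One factor 4 comes from squaring a sum over the four generators, the other from summing over the
   four fibers. *)
pose C := 16 * gamma * h ^+ 2.
have C0 : 0 <= C by apply: mulr_ge0; [apply: mulr_ge0 => //; exact: ltW|exact: sqr_ge0].
have key s : nsq (fun x => (\sum_(j < 4) \sum_(n <- s) c j n * translate t0 phi j n x) - g x) <=
    C * \sum_j nsq (fun y => P j y - fsum 0 h (P j) s y).
  rewrite -nsq_fourierB//; last first.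
    by do 2!(apply: L2_sum => ? _); apply: L2Z; exact: L2_translate.
  have lB : L2 (fun x => tau_ s x - G x) by exact: L2B.
  rewrite (nsq_ae _ (f := fun xi => _) (g := fun x => tau_ s x - G x)); first last.
  - by apply: filterS2 (fT s) gG => x -> ->.
  - by case: lB.
  - apply: cmeasurableB; last by case: (L2_fourier lg).
    by apply: (proj1 (L2_fourier _)); do 2!(apply: L2_sum => ? _); apply: L2Z; exact: L2_translate.
  rewrite (nsq_fibers h0 lB); last first.
    move=> x xn; rewrite sG// subr0 /tau_ big1// => j _; rewrite big1// => n _.
    by rewrite (strip_psi j xn) !mulr0.
  have ld j : L2 (fun y => P j y - fsum 0 h (P j) s y) by apply: L2B => //; exact: L2_fsum.
  apply: sum_nsq_le => //; first by move=> k; exact: L2_fiber.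
  have fG : {ae mu, forall y, forall k, fiber h G k y =
      h%:C * \sum_j bracket F j y * fiber h (psi j) k y} by exact: filter_forall.
  have fp : {ae mu, forall y, forall k j, normc (fiber h (psi j) k y) ^+ 2 <= gamma}.
    by apply: filter_forall => k; apply: filter_forall => j; exact: fiber_psi_le.
  apply: filterS2 fG fp => y HG Hp.
  set W := \sum_j normc (P j y - _) ^+ 2.
  have Ek k : normc (fiber h (fun x => tau_ s x - G x) k y) ^+ 2 <= 4 * gamma * h ^+ 2 * W.
    rewrite (_ : fiber _ _ _ _ =
      h%:C * - \sum_j (P j y - fsum 0 h (P j) s y) * fiber h (psi j) k y); last first.
      transitivity (fiber h (tau_ s) k y - fiber h G k y); first by rewrite /fiber mulrBr.
      rewrite fibtau HG -mulrBr; congr (_ * _); rewrite -sumrB -sumrN.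
      by apply: eq_bigr => j _; rewrite -/(P j); ring.
    rewrite normcM normcN normcC exprMn real_normK ?num_real//.
    rewrite (_ : 4 * gamma * h ^+ 2 * W = h ^+ 2 * (4 * gamma * W)); last by ring.
    rewrite ler_wpM2l ?sqr_ge0//.
    rewrite (le_trans (normc2_sum4_le _))// -mulrA ler_wpM2l// /W mulr_sumr ler_sum// => j _.
    by rewrite normcM exprMn mulrC ler_wpM2r ?sqr_ge0.
  rewrite (le_trans (ler_sum _ (fun k _ => Ek k)))// sumr_const card_ord -[leLHS]mulr_natl /C.
  by rewrite le_eqVlt; apply/orP; left; apply/eqP; ring.
have [N HN] : exists N, forall j s, uniq s -> {subset int_range N <= s} ->
    nsq (fun y => P j y - fsum 0 h (P j) s y) <= e / (4 * (C + 1)).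
  (* The four errors add up to at most e / (C + 1), and [C + 1] is positive where [C] is only known
     to be nonnegative. *)
  have e' : 0 < e / (4 * (C + 1)) by rewrite divr_gt0// mulr_gt0// ltr_wpDl.
  have [N HN] := choice (fun j => fsum_uncond h0 (lP j) (@bracket_supp F j) e').
  exists (\max_j N j)%N => j s us sub; apply: HN => // n nj; apply: sub.
  by apply: sub_int_range nj; exact: leq_bigmax.
exists [fset n in int_range N]%fset => A NA.
have uA : uniq A by exact: fset_uniq.
have lT : L2 (fun x => (\sum_(j < 4) \sum_(n <- A) c j n * translate t0 phi j n x) - g x).
  apply: L2B => //; do 2!(apply: L2_sum => ? _); apply: L2Z; exact: L2_translate.
rewrite (norm2sqE lT) lee_fin (le_trans (key A))//.
have HA j : nsq (fun y => P j y - fsum 0 h (P j) A y) <= e / (4 * (C + 1)).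
  apply: (HN j A uA) => n nN; apply: (fsubsetP NA).
  by apply/imfsetP; exists n.
rewrite (le_trans (ler_wpM2l C0 (ler_sum _ (fun j _ => HA j))))// sumr_const card_ord -[_ *+ 4]mulr_natl.
have C1 : 0 < C + 1 by rewrite ltr_wpDl.
rewrite (_ : C * _ = e * (C / (C + 1))); last by field; rewrite gt_eqF.
rewrite -[leRHS]mulr1 ler_wpM2l ?(ltW e0)//.
by rewrite ler_pdivrMr ?mul1r ?lerDl// ltr_wpDl.
Qed.

(** Both limits are approximated by the partial sum over the union of the two finite sets. *)
Lemma is_frame_operator_unique f g g' :
  is_frame_operator t0 phi f g -> is_frame_operator t0 phi f g' ->
  {ae mu, forall x, g x = g' x}.
Proof.
move=> [lg Hg] [lg' Hg']; have lB := L2B lg lg'.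
suff : nsq (fun x => g x - g' x) = 0.
  by move/(nsq_eq0 lB); apply: filterS => x /eqP; rewrite subr_eq0 => /eqP.
apply/eqP; rewrite eq_le nsq_ge0 andbT; apply/ler_addgt0Pr => e e0; rewrite add0r.
have [|A HA] := Hg (e / 4); first by rewrite divr_gt0.
have [|A' HA'] := Hg' (e / 4); first by rewrite divr_gt0.
have := HA _ (fsubsetUl A A'); have := HA' _ (fsubsetUr A A').
set S := (A `|` A')%fset; pose T x := \sum_(j < 4) \sum_(n <- S)
  inner f (translate t0 phi j n) * translate t0 phi j n x.
have lT : L2 T by do 2!(apply: L2_sum => ? _); apply: L2Z; exact: L2_translate.
rewrite (norm2sqE (L2B lT lg)) (norm2sqE (L2B lT lg')) !lee_fin => h1 h2.
rewrite (le_trans (nsqB_tri lg lg' lT))// (nsq_subC lg lT).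
by move: h1 h2; move: (nsq _) (nsq _) => p q; lra.
Qed.

Lemma frame_operatorE f g : is_frame_operator t0 phi f g ->
  is_frame_operator t0 phi f (frame_operator t0 phi f) /\
  {ae mu, forall x, frame_operator t0 phi f x = g x}.
Proof.
move=> Hg.
have H : is_frame_operator t0 phi f (frame_operator t0 phi f).
  exact: (@xgetPex _ (fun=> 0) [set k | is_frame_operator t0 phi f k] (ex_intro _ g Hg)).
by split => //; exact: is_frame_operator_unique H Hg.
Qed.

Lemma surj_strip G : L2 G -> in_strip h G ->
  exists g, L2 g /\ {ae mu, forall x, fourier g x = G x}.
Proof.
move=> lG sG; apply: (@fourier_surj _ (- (2 * h)) (4 * h)) => //; first by rewrite mulr_gt0.
move=> x xn; apply: sG => /andP[h1 h2]; apply: xn; rewrite /= in_itv/= h1/=.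
by move: h2; lra.
Qed.

(** The limit of the frame series is constructed: the expected fibers are glued together and the
    Fourier transform is inverted. The value chosen by [xget] then agrees with it. *)
Lemma frame_operator_fibers f F : L2 f -> L2 F -> in_strip h F ->
  {ae mu, forall x, fourier f x = F x} ->
  L2 (frame_operator t0 phi f) /\
  {ae mu, forall y, forall k, fiber h (fourier (frame_operator t0 phi f)) k y =
     h%:C * \sum_j bracket F j y * fiber h (psi j) k y}.
Proof.
move=> lf lF sF fF.
pose V k y := h%:C * \sum_j bracket F j y * fiber h (psi j) k y.
have lV k : L2 (V k).
  apply: L2Z; apply: L2_sum => j _.
  rewrite (_ : (fun x => _) = (fun x => fiber h (psi j) k x * bracket F j x)); last first.
    by apply/funext => x; rewrite mulrC.
  apply: (L2_bounded_mul _ (fiber_psi_le k j)); last exact: L2_bracket.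
  by apply: cmeasurable_fiber; case: (L2psi j).
have fV k y : fiber h (unfiber h V) k y = V k y.
  rewrite fiber_unfiber /V mulrCA; congr (_ * _); rewrite mulr_sumr; apply: eq_bigr => j _.
  by rewrite mulrCA; congr (_ * _); rewrite /fiber mulrA indic_sq.
have [g [lg gG]] := surj_strip (L2_unfiber h lV) (@in_strip_unfiber _ h V).
have Hg : is_frame_operator t0 phi f g.
  apply: (is_frame_operator_fibers lf lF sF fF lg (L2_unfiber h lV) (@in_strip_unfiber _ h V) gG).
  by move=> k; apply: aeW => y; rewrite fV.
have [[lS _] Sg] := frame_operatorE Hg; split => //.
have SG : {ae mu, forall x, fourier (frame_operator t0 phi f) x = unfiber h V x}.
  by apply: filterS2 (fourier_ae lS lg Sg) gG => x -> ->.
by apply: filterS (ae_fibers h SG) => y H k; rewrite -[RHS]/(V k y) -fV /fiber H.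
Qed.

Definition fiber_mx y : 'M[R[i]]_4 := \matrix_(k, j) fiber h (psi j) k y.

(** The rows of [fiber_mx y] that vanish because their frequency lies outside of the open band. *)
Definition out_band y : pred 'I_4 := fun k => y + shift4 h k \notin `]- omega, omega[.

Lemma row_fiber_mx y k : out_band y k -> row k (fiber_mx y) = 0.
Proof. by move=> yk; apply/rowP => j; rewrite !mxE /fiber /psi cutoff_out ?mulr0. Qed.

Lemma bracket_mulmx (n : nat) (U : 'I_n -> R -> R[i]) k i y :
  h%:C * \sum_j bracket (U i) j y * fiber h (psi j) k y =
  (h%:C *: (fiber_mx y *m (conj_trmx (fiber_mx y) *m \matrix_(l, m) fiber h (U m) l y))) k i.
Proof.
rewrite [RHS]mxE; congr (_ * _); rewrite mxE; apply: eq_bigr => j _.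
rewrite mulrC !mxE; congr (_ * _); apply: eq_bigr => l _; rewrite !mxE mulrC.
by [].
Qed.

End FrameFibers.

Section MatrixMeasurability.
Context {R : realType}.

Lemma cmeasurable_det n (U : R -> 'M[R[i]]_n) :
  (forall i j, cmeasurable (fun y => U y i j)) -> cmeasurable (fun y => \det (U y)).
Proof.
move=> mU; apply: cmeasurable_sum => s _; apply: cmeasurableM; first exact: cmeasurable_cst.
by apply: cmeasurable_prod => i _; exact: mU.
Qed.

Lemma cmeasurable_mulmx n m p (U : R -> 'M[R[i]]_(n, m)) (V : R -> 'M[R[i]]_(m, p)) :
  (forall i j, cmeasurable (fun y => U y i j)) -> (forall i j, cmeasurable (fun y => V y i j)) ->
  forall i j, cmeasurable (fun y => (U y *m V y) i j).
Proof.
move=> mU mV i j; rewrite (_ : (fun y => _) = (fun y => \sum_k U y i k * V y k j)); last first.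
  by apply/funext => y; rewrite mxE.
by apply: cmeasurable_sum => k _; exact: cmeasurableM.
Qed.

End MatrixMeasurability.

(** * The frame bounds and the dual generators *)

Section DualFibers.
Context {R : realType}.
Local Notation mu := (@lebesgue_measure R).
Variables (omega t0 gamma c : R) (phi : 'I_4 -> R -> R[i]).
Hypothesis t00 : 0 < t0.
Let h : R := step t0.
Hypothesis wh : omega <= 2 * h.
Hypothesis bphi : forall j, bandlimited omega (phi j).
Hypothesis gamma0 : 0 < gamma.
Hypothesis c0 : 0 < c.
Implicit Types (f F : R -> R[i]) (i j k l : 'I_4).

Let psi j := cutoff omega (fourier (phi j)).
Hypothesis psi_le : {ae mu, forall x, forall j, normc (psi j x) ^+ 2 <= gamma}.

Local Notation M := (fiber_mx omega t0 phi).
Local Notation z := (out_band omega t0).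
Hypothesis det_ge : {ae mu, forall y, y \in `[0, h[ -> c <= normc (\det (gramz (M y) (z y)))}.

Let h0 : 0 < h. Proof. by rewrite /h /step divr_gt0// mulr_gt0 ?pi_gt0. Qed.
Let L2phi j : L2 (phi j). Proof. by case: (bphi j). Qed.
Let L2psi j : L2 (psi j). Proof. by apply: L2_cutoff; apply: L2_fourier. Qed.
Let Mz y k : z y k -> row k (M y) = 0. Proof. exact: row_fiber_mx. Qed.
Let fourier_phi j : {ae mu, forall x, fourier (phi j) x = psi j x}.
Proof. exact: cutoff_fourier. Qed.
Let g := Num.sqrt gamma.
Let g0 : 0 <= g. Proof. exact: sqrtr_ge0. Qed.

Lemma fiber_out F k y : y \notin `[0, h[ -> fiber h F k y = 0.
Proof. by move=> /negP yn; rewrite /fiber indicE memNset ?mul0r. Qed.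

Lemma normc_fiber_mx_le : {ae mu, forall y, forall k j, normc (M y k j) <= g}.
Proof.
have fp : {ae mu, forall y, forall k j, normc (fiber h (psi j) k y) ^+ 2 <= gamma}.
  by apply: filter_forall => k; apply: filter_forall => j; exact: fiber_psi_le.
apply: filterS fp => y H k j; rewrite mxE -(@ler_pXn2r _ 2)// ?nnegrE ?normc_ge0//.
by rewrite /g sqr_sqrtr ?(ltW gamma0)// H.
Qed.

Let C1 := 4 * (c^-1 * (6 * (4 * g ^+ 2 + 1) ^+ 3) * g).

Lemma gramz_fiber_ae : {ae mu, forall y, y \in `[0, h[ ->
  gramz (M y) (z y) \in unitmx /\
  forall k j, normc ((invmx (gramz (M y) (z y)) *m M y) k j) <= C1}.
Proof.
apply: filterS2 normc_fiber_mx_le det_ge => y H1 H2 yI; split; first exact: gramz_unit (H2 yI).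
by apply: normc_gramz_solution_le => //; exact: H2.
Qed.

Let C10 : 0 <= C1.
Proof.
rewrite mulr_ge0// mulr_ge0// mulr_ge0// ?invr_ge0 ?(ltW c0)// mulr_ge0// exprn_ge0//.
by rewrite addr_ge0// mulr_ge0// sqr_ge0.
Qed.

(** The factor 16 is 4 for the sum over the generators times 4 for that over the fibers. Adding 1
    keeps the denominator positive, and the maximum in [B] ensures that [A <= B]. *)
Let A := h / (16 * C1 ^+ 2 + 1).
Let B := Num.max A (16 * gamma * h).

(** The upper bound holds because the fibers of the [psi j] are bounded, the lower one because the
    fibers of [f] are recovered from its brackets by a matrix with entries bounded by [C1]. *)
Lemma is_frame_fibers : is_frame omega t0 phi.
Proof.
have D0 : 0 < 16 * C1 ^+ 2 + 1 by rewrite ltr_wpDl// mulr_ge0// sqr_ge0.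
have A0 : 0 < A by rewrite divr_gt0.
exists A, B; split => //; first by rewrite /B le_max lexx.
move=> f bf s; have [lf _] := bf.
pose F := cutoff omega (fourier f).
have lF : L2 F by apply: L2_cutoff; exact: L2_fourier.
have sF : in_strip h F by exact: in_strip_cutoff.
have fF : {ae mu, forall x, fourier f x = F x} by exact: cutoff_fourier.
have lP j : L2 (bracket omega t0 phi F j) by exact: (L2_bracket t0 bphi psi_le j lF).
have lfib k : L2 (fiber h F k) by exact: L2_fiber.
have -> : s = (h * \sum_(j < 4) nsq (bracket omega t0 phi F j))%:E
  by exact: (frame_sum_fibers t00 bphi psi_le lf lF sF fF).
have nf : nsq f = \sum_k nsq (fiber h F k).
  rewrite -(nsq_fibers h0 lF sF) -(nsq_fourier lf); apply: nsq_ae => //.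
    by case: (L2_fourier lf).
  by case: lF.
rewrite (norm2sqE lf) -!EFinM !lee_fin nf; split.
  have : \sum_k nsq (fiber h F k) <= 16 * C1 ^+ 2 * \sum_j nsq (bracket omega t0 phi F j).
    apply: sum_nsq_le => //; first by rewrite mulr_ge0// sqr_ge0.
    apply: filterS gramz_fiber_ae => y H.
    case: (boolP (y \in `[0, h[)) => yI; last first.
      rewrite big1 => [|k _]; last by rewrite fiber_out// normc0 expr0n.
      apply: mulr_ge0; first by rewrite mulr_ge0// sqr_ge0.
      by apply: sumr_ge0 => j _; exact: sqr_ge0.
    have [uG HC] := H yI.
    pose U := \matrix_(k < 4, i < 1) fiber h F k y.
    pose P := \matrix_(j < 4, i < 1) bracket omega t0 phi F j y.
    have EP : conj_trmx (M y) *m U = P.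
      by apply/matrixP => j i; rewrite !mxE; apply: eq_bigr => k _; rewrite !mxE mulrC.
    have Uz k : z y k -> row k U = 0.
      by move=> zk; apply/rowP => i; rewrite !mxE /fiber /F cutoff_out ?mulr0.
    (* As [U] vanishes outside of the band, the completed Gram matrix G satisfies G U = M M^* U = M
       P. *)
    have EU : U = invmx (gramz (M y) (z y)) *m M y *m P.
      by rewrite -EP -mulmxA -(gramz_mul _ Uz) mulmxA mulVmx// mul1mx.
    set W := \sum_j normc (bracket _ _ _ _ _ _) ^+ 2.
    have Ek k : normc (fiber h F k y) ^+ 2 <= 4 * C1 ^+ 2 * W.
      have -> : fiber h F k y = \sum_j (invmx (gramz (M y) (z y)) *m M y) k j * bracket omega t0 phi F j y.
        transitivity (U k 0); first by rewrite mxE.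
        by rewrite [in LHS]EU mxE; apply: eq_bigr => j _; rewrite [P _ _]mxE.
      rewrite (le_trans (normc2_sum4_le _))// -mulrA ler_wpM2l// /W mulr_sumr ler_sum// => j _.
      by rewrite normcM exprMn ler_wpM2r ?sqr_ge0// ler_pXn2r// nnegrE normc_ge0.
    rewrite (le_trans (ler_sum _ (fun k _ => Ek k)))// sumr_const card_ord -[leLHS]mulr_natl.
    by rewrite le_eqVlt; apply/orP; left; apply/eqP; ring.
  set S := \sum_k _; set T := \sum_j _ => ST.
  have T0 : 0 <= T by apply: sumr_ge0 => j _; exact: nsq_ge0.
  apply: (@le_trans _ _ (A * ((16 * C1 ^+ 2 + 1) * T))).
    by rewrite ler_wpM2l ?(ltW A0)// (le_trans ST)// ler_wpM2r// lerDl.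
  by rewrite mulrA /A divfK// gt_eqF.
have : \sum_j nsq (bracket omega t0 phi F j) <= 16 * gamma * \sum_k nsq (fiber h F k).
  apply: sum_nsq_le => //; first by rewrite mulr_ge0// ltW.
  have fp : {ae mu, forall y, forall k j, normc (fiber h (psi j) k y) ^+ 2 <= gamma}.
    by apply: filter_forall => k; apply: filter_forall => j; exact: fiber_psi_le.
  apply: filterS fp => y Hp; set W := \sum_k normc (fiber _ _ _ _) ^+ 2.
  have Ej j : normc (bracket omega t0 phi F j y) ^+ 2 <= 4 * gamma * W.
    rewrite (le_trans (normc2_sum4_le _))// -mulrA ler_wpM2l// /W mulr_sumr ler_sum// => k _.
    rewrite normcM exprMn mulrC normcJ2 ler_wpM2r ?sqr_ge0//; exact: Hp.
  rewrite (le_trans (ler_sum _ (fun j _ => Ej j)))// sumr_const card_ord -[leLHS]mulr_natl.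
  by rewrite le_eqVlt; apply/orP; left; apply/eqP; ring.
set S := \sum_k _; set T := \sum_j _ => ST.
have S0 : 0 <= T by apply: sumr_ge0 => j _; exact: nsq_ge0.
rewrite (@le_trans _ _ (16 * gamma * h * T))//; last by rewrite ler_wpM2r// /B le_max lexx orbT.
rewrite (_ : 16 * gamma * h * T = h * (16 * gamma * T)); last by ring.
by rewrite ler_wpM2l ?(ltW h0).
Qed.

Let hC0 : h%:C != 0 :> R[i]. Proof. by rewrite eq_complex /= gt_eqF. Qed.

Lemma dual_fibers_unique (D : 'I_4 -> R -> R[i]) :
  (forall i, bandlimited omega (D i)) ->
  (forall i, {ae mu, forall x, frame_operator t0 phi (D i) x = phi i x}) ->
  {ae mu, forall y, y \in `[0, h[ -> forall k i,
    fourier (D i) (y + shift4 h k) = gramz_solution (M y) (z y) h%:C k i}.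
Proof.
move=> bD SD.
pose F i := cutoff omega (fourier (D i)).
have lD i : L2 (D i) by case: (bD i).
have lF i : L2 (F i) by apply: L2_cutoff; exact: L2_fourier.
have sF i : in_strip h (F i) by exact: in_strip_cutoff.
have fF i : {ae mu, forall x, fourier (D i) x = F i x} by exact: cutoff_fourier.
have Hi i := frame_operator_fibers t00 wh bphi gamma0 psi_le (lD i) (lF i) (sF i) (fF i).
have psiE i : {ae mu, forall y, forall k, fiber h (fourier (frame_operator t0 phi (D i))) k y =
    fiber h (psi i) k y}.
  have E : {ae mu, forall x, fourier (frame_operator t0 phi (D i)) x = psi i x}.
    by apply: filterS2 (fourier_ae (proj1 (Hi i)) (L2phi i) (SD i)) (fourier_phi i) => x -> ->.
  by apply: filterS (ae_fibers h E) => y H k; rewrite /fiber H.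
have main i : {ae mu, forall y, forall k, fiber h (psi i) k y =
    h%:C * \sum_j bracket omega t0 phi (F i) j y * fiber h (psi j) k y}.
  by apply: filterS2 (psiE i) (proj2 (Hi i)) => y H1 H2 k; exact: etrans (esym (H1 k)) (H2 k).
have mainA : {ae mu, forall y, forall i k, fiber h (psi i) k y =
    h%:C * \sum_j bracket omega t0 phi (F i) j y * fiber h (psi j) k y} by exact: filter_forall.
have FA : {ae mu, forall y, forall i k, fourier (D i) (y + shift4 h k) = F i (y + shift4 h k)}.
  by apply: filter_forall => i; exact: ae_fibers (fF i).
apply: filterS3 mainA FA gramz_fiber_ae => y H1 H2 H3 yI k i.
have [uG _] := H3 yI.
pose X : 'M[R[i]]_4 := \matrix_(l, m) fiber h (F m) l y.
have Xz l : z y l -> row l X = 0.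
  by move=> zl; apply/rowP => m; rewrite !mxE /fiber /F cutoff_out ?mulr0.
have EX : h%:C *: (M y *m (conj_trmx (M y) *m X)) = M y.
  by apply/matrixP => l m; rewrite -bracket_mulmx -H1 mxE.
rewrite -(gramz_solution_unique uG hC0 Xz EX) mxE H2 /fiber indicE mem_set ?mul1r//.
Qed.

(** The linear system is solved in each fiber, the solutions are glued and the transform is
    inverted; what has to be checked is that the solutions are measurable and square-integrable. *)
Lemma dual_generators_exist : exists D : 'I_4 -> R -> R[i],
  (forall i, bandlimited omega (D i)) /\
  (forall i, {ae mu, forall x, frame_operator t0 phi (D i) x = phi i x}).
Proof.
pose G y := gramz (M y) (z y).
(* The adjugate formula makes sense at every point and shows measurability; it agrees with the
   inverse where the matrix is invertible. *)
pose Y y := (h%:C)^-1 *: ((\det (G y))^-1 *: (\adj (G y) *m M y)).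
have YE y : G y \in unitmx -> Y y = gramz_solution (M y) (z y) h%:C.
  by move=> uG; rewrite /Y /gramz_solution /invmx uG -scalemxAl.
have mM k j : cmeasurable (fun y => M y k j).
  rewrite (_ : (fun y => _) = fiber h (psi j) k); last by apply/funext => y; rewrite mxE.
  by apply: cmeasurable_fiber; case: (L2psi j).
have mz k : cmeasurable (fun y => (z y k)%:R : R[i]).
  rewrite (_ : (fun y => _) = (fun y => 1 -
    tau (shift4 h k) (fun x => (\1_(`]- omega, omega[%classic : set R) x)%:C) y)); last first.
    apply/funext => y; rewrite /tau indicE /out_band -/h.
    case: (boolP (_ \in `]- omega, omega[)) => yi; first by rewrite mem_set ?subrr.
    by rewrite memNset ?subr0//; apply/negP.
  apply: cmeasurableB; first exact: cmeasurable_cst.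
  by apply: cmeasurable_shift; apply: cmeasurable_indic; exact: measurable_itv.
have mG k l : cmeasurable (fun y => G y k l).
  rewrite (_ : (fun y => _) = (fun y => (M y *m conj_trmx (M y)) k l + (k == l)%:R * (z y k)%:R)).
    apply: cmeasurableD; last by apply: cmeasurableM; [exact: cmeasurable_cst|exact: mz].
    apply: cmeasurable_mulmx => // i j.
    rewrite (_ : (fun y => _) = (fun y => conjc (M y j i))); last by apply/funext => y; rewrite !mxE.
    exact: cmeasurableJ.
  by apply/funext => y; rewrite /G /gramz mxE [in X in _ + X]mxE -mulnb natrM.
have madj k l : cmeasurable (fun y => (\adj (G y)) k l).
  rewrite (_ : (fun y => _) = (fun y => (-1) ^+ (l + k) * \det (row' l (col' k (G y))))); last first.
    by apply/funext => y; rewrite mxE.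
  apply: cmeasurableM; first exact: cmeasurable_cst.
  apply: cmeasurable_det => i j; rewrite (_ : (fun y => _) = (fun y => G y (lift l i) (lift k j)))//.
  by apply/funext => y; rewrite !mxE.
have mY k i : cmeasurable (fun y => Y y k i).
  rewrite (_ : (fun y => _) =
    (fun y => (h%:C)^-1 * ((\det (G y))^-1 * (\adj (G y) *m M y) k i))); last first.
    by apply/funext => y; rewrite !mxE.
  apply: cmeasurableM; first exact: cmeasurable_cst.
  apply: cmeasurableM; last exact: cmeasurable_mulmx.
  by apply: cmeasurableV; exact: cmeasurable_det.
have l1 : L2 (fun y => (\1_(`[0, h[%classic : set R) y)%:C : R[i]).
  have := L2_fbasis 0 h 0; rewrite /fbasis /fexp add0r.
  by rewrite (_ : (fun y => _) = (fun y => (\1_(`[0, h[%classic : set R) y)%:C))//;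
    apply/funext => y; rewrite !mul0r expi0 mulr1.
pose E i k y := (\1_(`[0, h[%classic : set R) y)%:C * Y y k i.
(* The cut-off forces the band limitation everywhere. Where the matrix is invertible it changes
   nothing, as the rows outside of the band are zero there. *)
pose V i := cutoff omega (unfiber h (E i)).
have lE i k : L2 (E i k).
  (* The entries of the solution are bounded by C1 / h almost everywhere, on an interval of finite
     length. *)
  apply: (@L2_dom _ _ (fun y => (C1 / h) ^+ 2 * normc ((\1_(`[0, h[%classic : set R) y)%:C : R[i]) ^+ 2)).
  - by apply: cmeasurableM => //; case: l1.
  - by apply: integrableZl'; exact: L2_integrable.
  - apply: filterS gramz_fiber_ae => y H; rewrite /E normcM exprMn mulrC.
    case: (boolP (y \in `[0, h[)) => yI; last first.
      by rewrite indicE memNset ?normc0 ?expr0n ?mulr0//; apply/negP.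
    have [uG HC] := H yI; rewrite ler_wpM2r ?sqr_ge0// (YE _ uG) /gramz_solution mxE.
    rewrite normcM ler_pXn2r ?nnegrE//;
      [|by rewrite mulr_ge0 ?normc_ge0|by rewrite divr_ge0// ltW].
    by rewrite normcV normcC (gtr0_norm h0) mulrC ler_wpM2r ?invr_ge0 ?(ltW h0).
have lV i : L2 (V i) by apply: L2_cutoff; exact: L2_unfiber.
have sV i : in_strip h (V i) by exact: in_strip_cutoff.
have [D HD] := choice (fun i => surj_strip t00 (lV i) (sV i)).
have lD i : L2 (D i) by case: (HD i).
have DV i : {ae mu, forall x, fourier (D i) x = V i x} by case: (HD i).
exists D; split => i; first by apply: (bandlimitedP (lD i) (DV i)) => x xn; rewrite /V cutoff_out.
have fibV y l m : y \in `[0, h[ -> G y \in unitmx ->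
    fiber h (V m) l y = gramz_solution (M y) (z y) h%:C l m.
  move=> yI uG; have YM := YE _ uG.
  case: (boolP (z y l)) => zl.
    rewrite /fiber /V cutoff_out// mulr0.
    by have /rowP/(_ m) := row_gramz_solution h%:C (@Mz y) uG zl; rewrite !mxE => ->.
  move: zl; rewrite negbK => zl; rewrite /fiber /V cutoff_in//.
  have := fiber_unfiber h (E m) l y; rewrite /fiber => ->.
  by rewrite /E indicE mem_set// !mul1r YM.
suff H : is_frame_operator t0 phi (D i) (phi i) by case: (frame_operatorE bphi H).
have sP : in_strip h (psi i) by exact: in_strip_cutoff.
apply: (is_frame_operator_fibers t00 wh bphi gamma0 psi_le (lD i) (lV i) (sV i) (DV i)
  (L2phi i) (L2psi i) sP (fourier_phi i)) => k.
apply: filterS gramz_fiber_ae => y H.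
case: (boolP (y \in `[0, h[)) => yI; last first.
  have fo F l : fiber (step t0) F l y = 0 by exact: fiber_out.
  apply: (etrans (fo _ _)); rewrite [X in _ * X]big1 ?mulr0// => j _.
  exact: (etrans (congr1 (fun u => bracket omega t0 phi (V i) j y * u) (fo _ _)) (mulr0 _)).
have [uG _] := H yI.
rewrite -/psi bracket_mulmx (_ : \matrix_(l, m) fiber h (V m) l y = gramz_solution (M y) (z y) h%:C).
  by rewrite (gramz_solutionP (@Mz y) uG hC0) mxE.
by apply/matrixP => l m; rewrite mxE fibV.
Qed.

Lemma dual_generator_fibers : {ae mu, forall y, y \in `[0, h[ -> forall k i,
  fourier (dual_generator omega t0 phi i) (y + shift4 h k) =
  gramz_solution (M y) (z y) h%:C k i}.
Proof.
have [D [bD SD]] := dual_generators_exist.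
have H i : bandlimited omega (dual_generator omega t0 phi i) /\
    {ae mu, forall x, frame_operator t0 phi (dual_generator omega t0 phi i) x = phi i x}.
  exact: (@xgetPex _ (fun=> 0) [set k | bandlimited omega k /\
    {ae mu, forall x, frame_operator t0 phi k x = phi i x}]
    (ex_intro _ (D i) (conj (bD i) (SD i)))).
by apply: dual_fibers_unique => i; case: (H i).
Qed.

End DualFibers.

(** * Explicit formulas *)

Section DualVectors.
Context {R : realType}.
Implicit Types (M : 'M[R[i]]_4) (q : R[i]).

Lemma minors_sqZ M (a : R) : 0 <= a ->
  minors_sq 3 ((Num.sqrt a)%:C *: M) = a ^+ 3 * minors_sq 3 M.
Proof.
move=> a0; rewrite /minors_sq mulr_sumr; apply: eq_bigr => r _; rewrite mulr_sumr.
apply: eq_bigr => c _.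
rewrite (_ : mxsub r c (_ *: M) = (Num.sqrt a)%:C *: mxsub r c M); last first.
  by apply/matrixP => i j; rewrite !mxE.
rewrite detZ normcM exprMn; congr (_ * _).
rewrite !exprS expr0 mulr1 !normcM normcC ger0_norm ?sqrtr_ge0//.
by have := sqr_sqrtr a0; move: (Num.sqrt a) => s <-; ring.
Qed.

Lemma det_conj_rows M : \det (conj_entries M) =
  det4 (conj_entries (row (inord 0) M)) (conj_entries (row (inord 1) M))
       (conj_entries (row (inord 2) M)) (conj_entries (row (inord 3) M)).
Proof.
rewrite /det4 -det_laplace; congr (\det _); apply/matrixP => i j.
case: i => [[|[|[|[|//]]]] i4]; rewrite !mxE /= ?mxE inord_val;
  by congr (conjc (M _ _)); apply/val_inj; rewrite /= inordK.
Qed.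

(** The rows of the solution are, up to the factor 1 / q, the basis dual to the conjugated rows of
    [M]. *)
Lemma square_dual_rows M q : gramz M pred0 \in unitmx ->
  let X := gramz_solution M pred0 q in
  let r k := conj_entries (row (inord k) M) in
  let d := q^-1 / \det (conj_entries M) in
  [/\ row (inord 0) X = - d *: cross (r 3%N) (r 2%N) (r 1%N),
      row (inord 1) X = d *: cross (r 3%N) (r 2%N) (r 0%N),
      row (inord 2) X = d *: cross (r 0%N) (r 1%N) (r 3%N) &
      row (inord 3) X = - d *: cross (r 0%N) (r 1%N) (r 2%N)].
Proof.
move=> uG X r d.
have d0 : det4 (r 0%N) (r 1%N) (r 2%N) (r 3%N) != 0.
  rewrite -det_conj_rows -conj_det conjc_eq0; apply: contraTneq uG => d0.
  by rewrite unitmxE unitfE det_gramz0 d0 normc0 expr0n eqxx.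
have Xr (k l : nat) : (k < 4)%N -> (l < 4)%N ->
    dotp (row (inord k) X) (r l) = q^-1 * (k == l)%:R.
  move=> k4 l4; rewrite gramz_solution_dual//= andbT; congr (_ * _%:R).
  by rewrite -val_eqE /= !inordK.
have X0 (k l : nat) : (k < 4)%N -> (l < 4)%N -> k != l -> dotp (row (inord k) X) (r l) = 0.
  by move=> k4 l4 kl; rewrite Xr// (negPf kl) mulr0.
have X1 (k : nat) : (k < 4)%N -> dotp (row (inord k) X) (r k) = q^-1.
  by move=> k4; rewrite Xr// eqxx mulr1.
rewrite /d det_conj_rows; split.
- by apply: (dual_vector0 d0); rewrite ?X1 ?X0.
- by apply: (dual_vector1 d0); rewrite ?X1 ?X0.
- by apply: (dual_vector2 d0); rewrite ?X1 ?X0.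
- by apply: (dual_vector3 d0); rewrite ?X1 ?X0.
Qed.

(** [lift i (inord k)] enumerates the rows other than the vanishing one. Products with the
    conjugated rows determine the solution only up to one direction, which orthogonality to the
    cross product of the rows removes. *)
Lemma rectangular_dual_rows M i q : row i M = 0 -> gramz M (pred1 i) \in unitmx ->
  let X := gramz_solution M (pred1 i) q in
  let r (k : nat) := row (lift i (inord k)) M in
  let e := - (q^-1 / \det (row' i M *m conj_trmx (row' i M))) in
  [/\ row (lift i (inord 0)) X =
        e *: cross (conj_entries (r 2%N)) (conj_entries (r 1%N)) (cross (r 2%N) (r 1%N) (r 0%N)),
      row (lift i (inord 1)) X =
        e *: cross (conj_entries (r 0%N)) (cross (r 0%N) (r 1%N) (r 2%N)) (conj_entries (r 2%N)) &
      row (lift i (inord 2)) X =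
        e *: cross (conj_entries (r 0%N)) (conj_entries (r 1%N)) (cross (r 0%N) (r 1%N) (r 2%N))].
Proof.
move=> Mi uG X r e.
have rE (k : nat) : row (inord k) (row' i M) = r k.
  by apply/rowP => j; rewrite !mxE.
have NE : \det (row' i M *m conj_trmx (row' i M)) = dotp (cross (r 0%N) (r 1%N) (r 2%N))
    (cross (conj_entries (r 0%N)) (conj_entries (r 1%N)) (conj_entries (r 2%N))).
  by rewrite conj_trmxE det_mul_trmx34 cross_rows_conj /cross_rows !rE conj_cross.
have N0 : dotp (cross (r 0%N) (r 1%N) (r 2%N))
    (cross (conj_entries (r 0%N)) (conj_entries (r 1%N)) (conj_entries (r 2%N))) != 0.
  by rewrite -NE -det_gramz1// -unitfE -unitmxE.
have Mz k : pred1 i k -> row k M = 0 by move=> /eqP ->.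
have Xr (k l : nat) : (k < 3)%N -> (l < 3)%N ->
    dotp (row (lift i (inord k)) X) (conj_entries (r l)) = q^-1 * (k == l)%:R.
  move=> k4 l4; rewrite gramz_solution_dual//= [lift i _ == i]eq_sym neq_lift andbT; congr (_ * _%:R).
  by rewrite (inj_eq lift_inj) -val_eqE /= !inordK.
have X0 (k l : nat) : (k < 3)%N -> (l < 3)%N -> k != l ->
    dotp (row (lift i (inord k)) X) (conj_entries (r l)) = 0.
  by move=> k4 l4 kl; rewrite Xr// (negPf kl) mulr0.
have X1 (k : nat) : (k < 3)%N -> dotp (row (lift i (inord k)) X) (conj_entries (r k)) = q^-1.
  by move=> k4; rewrite Xr// eqxx mulr1.
(* Each entry is a determinant with a repeated row, or involves the zero row. *)
have Mn : M *m (cross (r 0%N) (r 1%N) (r 2%N))^T = 0.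
  apply/matrixP => k j; rewrite dotp_mulmx [RHS]mxE (ord1 j) row_id dotp_cross.
  case: (unliftP i k) => [l ->|->]; last first.
    by rewrite Mi -dotp_cross /dotp big1// => m _; rewrite mxE mul0r.
  rewrite -[l]inord_val; case: l => [[|[|[|//]]] l3] /=; rewrite -/(r _).
  - exact: det4_alt12.
  - by rewrite det4_swap23 det4_alt12 oppr0.
  - by rewrite det4_swap34 det4_swap23 det4_alt12 !oppr0.
have Xn k : dotp (row k X) (cross (r 0%N) (r 1%N) (r 2%N)) = 0 by exact: gramz_solution_orth.
rewrite /e NE; split.
- by apply: (dual_vector_first N0 (Xn _)); rewrite ?X1 ?X0.
- by apply: (dual_vector_mid N0 (Xn _)); rewrite ?X1 ?X0.
- by apply: (dual_vector_last N0 (Xn _)); rewrite ?X1 ?X0.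
Qed.

End DualVectors.

(** * The intervals of the theorem and the fibers over them *)

Section Regions.
Context {R : realType}.
Local Notation mu := (@lebesgue_measure R).
Variables (omega t0 : R) (phi : 'I_4 -> R -> R[i]).
Hypothesis t00 : 0 < t0.
Let h : R := step t0.
Hypothesis wh1 : omega / 2 <= h.
Hypothesis wh2 : h < 2 / 3 * omega.

Local Notation M := (fiber_mx omega t0 phi).
Local Notation z := (out_band omega t0).
Local Notation hatPhi := (fourier_vec phi).
Local Notation hatPhiDual := (fourier_vec (dual_generator omega t0 phi)).
Local Notation D := (dual_coefD t0 phi).
Local Notation E := (dual_coefE omega t0 phi).

Let h0 : 0 < h. Proof. by rewrite /h /step divr_gt0// mulr_gt0 ?pi_gt0. Qed.
Let hC0 : h%:C != 0 :> R[i]. Proof. by rewrite eq_complex /= gt_eqF. Qed.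

Lemma conj_realC (r : R) : conjc r%:C = r%:C :> R[i].
Proof. by rewrite /= oppr0. Qed.

Lemma modstep_shift4 y k : y \in `[0, h[ -> modstep t0 (y + shift4 h k) = y.
Proof.
rewrite in_itv/= => /andP[y0 yh]; rewrite /modstep -/h.
have e : (Posz k - 2)%:~R = (k : nat)%:R - 2 :> R by rewrite intrB.
rewrite (@floor_def _ _ (Posz k - 2)); first by rewrite e /shift4 addrK.
rewrite ler_pdivlMr// ltr_pdivrMr// [(_ + 1)%:~R]intrD e /shift4.
by move: ((k : nat)%:R) => p; apply/andP; split; nra.
Qed.

Lemma sqrt_stepX2 : (Num.sqrt h)%:C * (Num.sqrt h)%:C = h%:C :> R[i].
Proof. by rewrite -rmorphM -expr2 sqr_sqrtr// ltW. Qed.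

Lemma shift4E y : [/\ y - 2 * h = y + shift4 h (inord 0), y - h = y + shift4 h (inord 1),
  y = y + shift4 h (inord 2) & y + h = y + shift4 h (inord 3)].
Proof. by rewrite /shift4 !inordK//; split; ring. Qed.

(* The points at which the almost everywhere identities between fibers hold. *)
Definition regular y := [/\ y \in `[0, h[, forall k, hatPhi (y + shift4 h k) = row k (M y),
  forall k, hatPhiDual (y + shift4 h k) = row k (gramz_solution (M y) (z y) h%:C) &
  gramz (M y) (z y) \in unitmx].

Lemma preGramian_fibers y k : y \in `[0, h[ ->
  (forall l, hatPhi (y + shift4 h l) = row l (M y)) ->
  preGramian t0 phi (y + shift4 h k) = (Num.sqrt h)%:C *: M y.
Proof.
move=> yI HP; rewrite /preGramian modstep_shift4//; congr (_ *: _).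
have [e0 e1 e2 e3] := shift4E y.
apply/matrixP => i j.
have rE l : (M y) l j = hatPhi (y + shift4 h l) 0 j by rewrite HP [RHS]mxE.
rewrite -/h /tau e0 e1 -[fourier_vec phi y]/(hatPhi y) [in hatPhi y]e2 e3 rE mxE.
case: (@splitP 1 3 i) => [i1 e|i1 e].
  by rewrite (ord1 i1); congr (hatPhi (y + shift4 h _) 0 j); apply/val_inj; rewrite /= inordK// e (ord1 i1).
rewrite mxE; case: (@splitP 1 2 i1) => [i2 f|i2 f].
  rewrite (ord1 i2); congr (hatPhi (y + shift4 h _) 0 j); apply/val_inj.
  by rewrite /= inordK// e f (ord1 i2).
rewrite mxE; case: (@splitP 1 1 i2) => [i3 g|i3 g]; rewrite (ord1 i3);
  by congr (hatPhi (y + shift4 h _) 0 j); apply/val_inj; rewrite /= inordK// e f g (ord1 i3).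
Qed.

(** The factor sqrt h of the four rows contributes h^2 to the determinant, so that h / h^2 = 1 / h
    is left. By periodicity the value is the same on all four shifts. *)
Lemma dual_coefD_fibers y k : y \in `[0, h[ ->
  (forall l, hatPhi (y + shift4 h l) = row l (M y)) ->
  D (y + shift4 h k) = (h%:C)^-1 / \det (conj_entries (M y)).
Proof.
move=> yI HP; rewrite /dual_coefD preGramian_fibers// -/h.
rewrite (_ : conj_entries (_ *: _) = (Num.sqrt h)%:C *: conj_entries (M y)); last first.
  by apply/matrixP => i j; rewrite !mxE conjM conj_realC.
rewrite detZ (_ : (Num.sqrt h)%:C ^+ 4 = h%:C ^+ 2); last first.
  by rewrite -sqrt_stepX2; move: (Num.sqrt h)%:C => u; ring.
by rewrite invfM mulrA; congr (_ / _); move: (h%:C) hC0 => u u0; field.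
Qed.

(** The Gram matrix of three rows carries a factor h, hence h^3 in the determinant, and h^2 / h^3 =
    1 / h is left. *)
Lemma dual_coefE_fibers y k (i : 'I_4) : y \in `[0, h[ ->
  (forall l, hatPhi (y + shift4 h l) = row l (M y)) ->
  i = (if y < 2 * h - omega then ord0 else ord_max) ->
  E (y + shift4 h k) = (h%:C)^-1 / \det (row' i (M y) *m conj_trmx (row' i (M y))).
Proof.
move=> yI HP iE; rewrite /dual_coefE /reduced_preGramian (modstep_shift4 k yI) (preGramian_fibers k yI HP) -/h.
rewrite (_ : (if _ then _ else _) = (Num.sqrt h)%:C *: row' i (M y)); last first.
  by rewrite iE; case: ifP => _; apply/matrixP => a b; rewrite !mxE.
rewrite (_ : conj_trmx (_ *: _) = (Num.sqrt h)%:C *: conj_trmx (row' i (M y))); last first.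
  by apply/matrixP => a b; rewrite !mxE conjM conj_realC.
rewrite -scalemxAl -scalemxAr scalerA sqrt_stepX2 detZ.
rewrite rmorphXn /= invfM mulrA; congr (_ / _).
by move: (h%:C) hC0 => u u0; field.
Qed.

Lemma out_band_minus y : y \in `]0, 2 * h - omega[ -> z y = pred1 ord0.
Proof.
have [w1 w2] := (wh1, wh2); rewrite in_itv/= => /andP[y0 y1]; apply/funext => k.
rewrite [RHS](_ : _ = (k == 0 :> nat)%N)//; rewrite /out_band in_itv/= /shift4 -/h.
case: k => [[|[|[|[|//]]]] k4] /=; [apply/negP|apply/negbF|apply/negbF|apply/negbF].
- by move=> /andP[]; lra.
- by apply/andP; split; lra.
- by apply/andP; split; lra.
- by apply/andP; split; lra.
Qed.

Lemma out_band_mid y : y \in `]2 * h - omega, omega - h[ -> z y = pred0.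
Proof.
have [w1 w2] := (wh1, wh2); rewrite in_itv/= => /andP[y0 y1]; apply/funext => k.
rewrite /out_band in_itv/= /shift4 -/h; apply/negbF.
by case: k => [[|[|[|[|//]]]] k4] /=; apply/andP; split; lra.
Qed.

Lemma out_band_plus y : y \in `]omega - h, h[ -> z y = pred1 ord_max.
Proof.
have [w1 w2] := (wh1, wh2); rewrite in_itv/= => /andP[y0 y1]; apply/funext => k.
rewrite [RHS](_ : _ = (k == 3 :> nat)%N)//; rewrite /out_band in_itv/= /shift4 -/h.
case: k => [[|[|[|[|//]]]] k4] /=; [apply/negbF|apply/negbF|apply/negbF|apply/negP].
- by apply/andP; split; lra.
- by apply/andP; split; lra.
- by apply/andP; split; lra.
- by move=> /andP[]; lra.
Qed.

Lemma preGramian_base y : y \in `[0, h[ ->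
  (forall l, hatPhi (y + shift4 h l) = row l (M y)) ->
  preGramian t0 phi y = (Num.sqrt h)%:C *: M y.
Proof.
by move=> yI HP; have [_ _ e _] := shift4E y; rewrite [in LHS]e (preGramian_fibers _ yI HP).
Qed.

Lemma minors_sq_preGramian_le y i : y \in `[0, h[ ->
  (forall l, hatPhi (y + shift4 h l) = row l (M y)) -> z y = pred1 i ->
  minors_sq 3 (preGramian t0 phi y) <= h ^+ 3 * 4 ^+ 6 * normc (\det (gramz (M y) (z y))).
Proof.
move=> yI HP zi; rewrite preGramian_base// minors_sqZ ?(ltW h0)// -mulrA ler_wpM2l ?exprn_ge0 ?(ltW h0)//.
by rewrite zi minors_sq_le//; apply: row_fiber_mx; rewrite zi /= eqxx.
Qed.

Lemma det_preGramian y : y \in `[0, h[ ->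
  (forall l, hatPhi (y + shift4 h l) = row l (M y)) -> z y = pred0 ->
  normc (\det (preGramian t0 phi y)) ^+ 2 = h ^+ 4 * normc (\det (gramz (M y) (z y))).
Proof.
move=> yI HP z0; rewrite preGramian_base// z0 det_gramz0 detZ normcM exprMn normcC.
rewrite ger0_norm ?sqr_ge0//; congr (_ * _).
rewrite !exprS expr0 mulr1 !normcM normcC ger0_norm ?sqrtr_ge0//.
by have := sqr_sqrtr (ltW h0); move: (Num.sqrt h) => s <-; ring.
Qed.

Section MidRegion.
Variables (x0 x1 x2 x3 y : R).
Hypotheses (ry : regular y) (yI : y \in `]2 * h - omega, omega - h[).
Hypotheses (e0 : x0 = y - 2 * h) (e1 : x1 = y - h) (e2 : x2 = y) (e3 : x3 = y + h).

(** The four points are variables tied to [y] by equations, so that any of them can be the point at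
    which a formula is wanted, with the others written as shifts of it. *)
Lemma dual_mid : let c x := conj_entries (hatPhi x) in
  [/\ hatPhiDual x0 = - D x0 *: cross (c x3) (c x2) (c x1),
      hatPhiDual x1 = D x1 *: cross (c x3) (c x2) (c x0),
      hatPhiDual x2 = D x2 *: cross (c x0) (c x1) (c x3) &
      hatPhiDual x3 = - D x3 *: cross (c x0) (c x1) (c x2)].
Proof.
move=> c; have [s0 s1 s2 s3] := shift4E y; have [yh HP HX uG] := ry.
rewrite out_band_mid// in HX uG.
have [f0 f1 f2 f3] := square_dual_rows h%:C uG.
have HD k := dual_coefD_fibers k yh HP.
rewrite /c (etrans e0 s0) (etrans e1 s1) (etrans e2 s2) (etrans e3 s3).
move: hatPhi hatPhiDual (dual_coefD _ _) HP HX HD => P X d HP HX HD.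
by rewrite !HX !HD !HP; split; [exact: f0|exact: f1|exact: f2|exact: f3].
Qed.

End MidRegion.

Lemma lift0_inord : [/\ lift (ord0 : 'I_4) (inord 0 : 'I_3) = inord 1,
  lift (ord0 : 'I_4) (inord 1 : 'I_3) = inord 2 & lift (ord0 : 'I_4) (inord 2 : 'I_3) = inord 3].
Proof. by split; apply/val_inj; rewrite /= !inordK. Qed.

Lemma lift_max_inord : [/\ lift (ord_max : 'I_4) (inord 0 : 'I_3) = inord 0,
  lift (ord_max : 'I_4) (inord 1 : 'I_3) = inord 1 & lift (ord_max : 'I_4) (inord 2 : 'I_3) = inord 2].
Proof. by split; apply/val_inj; rewrite /= !inordK. Qed.

Section BoundaryRegions.
Variables (xa xb xc y : R).
Hypothesis ry : regular y.

(** Common to both boundary intervals: [i] is the index of the shift that leaves the band, and the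
    points [xa], [xb], [xc] are the remaining ones in increasing order. *)
Lemma dual_boundary (i : 'I_4) : z y = pred1 i ->
  i = (if y < 2 * h - omega then ord0 else ord_max) ->
  xa = y + shift4 h (lift i (inord 0)) -> xb = y + shift4 h (lift i (inord 1)) ->
  xc = y + shift4 h (lift i (inord 2)) ->
  let c x := conj_entries (hatPhi x) in
  [/\ hatPhiDual xa = - E xa *: cross (c xc) (c xb) (cross (hatPhi xc) (hatPhi xb) (hatPhi xa)),
      hatPhiDual xb = - E xb *: cross (c xa) (cross (hatPhi xa) (hatPhi xb) (hatPhi xc)) (c xc) &
      hatPhiDual xc = - E xc *: cross (c xa) (c xb) (cross (hatPhi xa) (hatPhi xb) (hatPhi xc))].
Proof.
move=> zi iE ea eb ec c; have [yh HP HX uG] := ry.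
have Mi : row i (M y) = 0 by apply: row_fiber_mx; rewrite zi /= eqxx.
rewrite zi in HX uG.
have [fa fb fc] := rectangular_dual_rows h%:C Mi uG.
have HE k := dual_coefE_fibers k yh HP iE.
rewrite /c ea eb ec.
move: hatPhi hatPhiDual (dual_coefE _ _ _) HP HX HE => P X e HP HX HE.
by rewrite !HX !HE !HP; split; [exact: fa|exact: fb|exact: fc].
Qed.

Lemma dual_minus : y \in `]0, 2 * h - omega[ -> xa = y - h -> xb = y -> xc = y + h ->
  let c x := conj_entries (hatPhi x) in
  [/\ hatPhiDual xa = - E xa *: cross (c xc) (c xb) (cross (hatPhi xc) (hatPhi xb) (hatPhi xa)),
      hatPhiDual xb = - E xb *: cross (c xa) (cross (hatPhi xa) (hatPhi xb) (hatPhi xc)) (c xc) &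
      hatPhiDual xc = - E xc *: cross (c xa) (c xb) (cross (hatPhi xa) (hatPhi xb) (hatPhi xc))].
Proof.
move=> yI ea eb ec; have [l0 l1 l2] := lift0_inord; have [s0 s1 s2 s3] := shift4E y.
apply: (@dual_boundary ord0); rewrite ?l0 ?l1 ?l2; first exact: out_band_minus.
- by move: yI; rewrite in_itv/= => /andP[_ ->].
- exact: etrans ea s1.
- exact: etrans eb s2.
- exact: etrans ec s3.
Qed.

Lemma dual_plus : y \in `]omega - h, h[ -> xa = y - 2 * h -> xb = y - h -> xc = y ->
  let c x := conj_entries (hatPhi x) in
  [/\ hatPhiDual xa = - E xa *: cross (c xc) (c xb) (cross (hatPhi xc) (hatPhi xb) (hatPhi xa)),
      hatPhiDual xb = - E xb *: cross (c xa) (cross (hatPhi xa) (hatPhi xb) (hatPhi xc)) (c xc) &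
      hatPhiDual xc = - E xc *: cross (c xa) (c xb) (cross (hatPhi xa) (hatPhi xb) (hatPhi xc))].
Proof.
move=> yI ea eb ec; have [l0 l1 l2] := lift_max_inord; have [s0 s1 s2 s3] := shift4E y.
apply: (@dual_boundary ord_max); rewrite ?l0 ?l1 ?l2; first exact: out_band_plus.
- have [w1 w2] := (wh1, wh2); rewrite ifN// -leNgt.
  by move: yI; rewrite in_itv/= => /andP[y1 _]; lra.
- exact: etrans ea s0.
- exact: etrans eb s1.
- exact: etrans ec s2.
Qed.

End BoundaryRegions.

End Regions.

(** * Frame property and formulas on the eight intervals *)

Theorem theorem4p5 (R : realType) (omega t0 : R) (phi : 'I_4 -> R -> R[i])
    (delta gamma sigma eta : R) :
  let mu := @lebesgue_measure R in
  let h := step t0 in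
  let J := preGramian t0 phi in
  let D := dual_coefD t0 phi in
  let E := dual_coefE omega t0 phi in
  let hatPhi := fourier_vec phi in
  let hatPhiDual := fourier_vec (dual_generator omega t0 phi) in
  0 < omega -> 0 < t0 ->
  omega / 2 <= h -> h < 2 / 3 * omega ->
  (forall j, bandlimited omega (phi j)) ->
  0 < delta -> 0 < gamma -> 0 < sigma -> 0 < eta ->
  {ae mu, forall x, x \in `]- omega, omega[ ->
     delta <= \sum_(j < 4) normc (fourier (phi j) x) ^+ 2 <= gamma} ->
  {ae mu, forall x, (x \in `]0, 2 * h - omega[) || (x \in `]omega - h, h[) ->
     sigma <= minors_sq 3 (J x)} ->
  {ae mu, forall x, x \in `]2 * h - omega, omega - h[ ->
     eta <= normc (\det (J x))} ->
  is_frame omega t0 phi /\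
  (* s = 1 gives the expression in (0, omega), s = - 1 its reflection *)
  forall s : R, s = 1 \/ s = - 1 ->
    let T (k : R) := tau (s * (k * h)) hatPhi in
    let cT (k : R) (x : R) := conj_entries (T k x) in
    [/\ {ae mu, forall x, s * x \in `]0, 2 * h - omega[ ->
           hatPhiDual x =
           - E x *: cross (cT (- 1) x)
                          (cross (T (- 1) x) (T 0 x) (T 1 x))
                          (cT 1 x)},
        {ae mu, forall x, s * x \in `]2 * h - omega, omega - h[ ->
           hatPhiDual x =
           D x *: cross (cT (- 2) x) (cT (- 1) x) (cT 1 x)},
        {ae mu, forall x, s * x \in `]omega - h, 3 * h - omega[ ->
           hatPhiDual x =
           - E x *: cross (cT (- 2) x) (cT (- 1) x)
                          (cross (T (- 2) x) (T (- 1) x) (T 0 x))} &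
        {ae mu, forall x, s * x \in `]3 * h - omega, omega[ ->
           hatPhiDual x =
           - D x *: cross (cT (- 3) x) (cT (- 2) x) (cT (- 1) x)}].
Proof.
move=> mu h J D E hatPhi hatPhiDual w0 t00 wh1 wh2 bphi delta0 gamma0 sigma0 eta0 Hg Hm Hd.
have h0 : 0 < h by rewrite /h /step divr_gt0// mulr_gt0 ?pi_gt0.
have wh : omega <= 2 * h by lra.
pose M := fiber_mx omega t0 phi; pose z := out_band omega t0.
have psi_le : {ae mu, forall x, forall j, normc (cutoff omega (fourier (phi j)) x) ^+ 2 <= gamma}.
  apply: filterS Hg => x H j; case: (boolP (x \in `]- omega, omega[)) => xi; last first.
    by rewrite cutoff_out// normc0 expr0n/= ltW.
  rewrite cutoff_in//; have /andP[_] := H xi; apply: le_trans.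
  by rewrite (bigD1 j)//= lerDl sumr_ge0// => k _; exact: sqr_ge0.
have Pfib : {ae mu, forall y, forall k j,
    fourier (phi j) (y + shift4 h k) = cutoff omega (fourier (phi j)) (y + shift4 h k)}.
  have : {ae mu, forall x, forall j, fourier (phi j) x = cutoff omega (fourier (phi j)) x}.
    by apply: filter_forall => j; exact: cutoff_fourier.
  exact: ae_fibers.
have HP : {ae mu, forall y, y \in `[0, h[ -> forall k, hatPhi (y + shift4 h k) = row k (M y)}.
  apply: filterS Pfib => y H yI k; apply/rowP => j; rewrite !mxE H.
  by rewrite /fiber indicE mem_set ?mul1r.
(* A common lower bound for the completed Gram determinant: |det J|^2 is h^4 times it in the middle
   interval, and the sum of squared minors is at most h^3 4^6 times it in the outer ones. *)
pose c := Num.min (eta ^+ 2 / h ^+ 4) (sigma / (h ^+ 3 * 4 ^+ 6)).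
have hp n : 0 < h ^+ n by apply: exprn_gt0.
have hp4 : 0 < h ^+ 3 * 4 ^+ 6 by apply: mulr_gt0 => //; apply: exprn_gt0.
have c0 : 0 < c by rewrite /c lt_min !divr_gt0//; apply: exprn_gt0.
have det_ge : {ae mu, forall y, y \in `[0, h[ -> c <= normc (\det (gramz (M y) (z y)))}.
  have Hall : {ae mu, forall x,
      [/\ (x \in `]0, 2 * h - omega[) || (x \in `]omega - h, h[) -> sigma <= minors_sq 3 (J x),
          x \in `]2 * h - omega, omega - h[ -> eta <= normc (\det (J x)) &
          x \in `[0, h[ -> forall k, hatPhi (x + shift4 h k) = row k (M x)]}.
    by apply: filterS3 Hm Hd HP => x *; split.
  (* The endpoints separating the three intervals are discarded as null sets. *)
  have n12 : {ae mu, forall y, y != 0 /\ y != 2 * h - omega}.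
    by apply: filterS2 (ae_neq 0) (ae_neq (2 * h - omega)) => x *; split.
  apply: filterS3 n12 (ae_neq (omega - h)) Hall.
  move=> y [n1 n2] n3 [Hm' Hd' HP'] yI; have {}HP' := HP' yI.
  have boundary i : z y = pred1 i -> sigma <= minors_sq 3 (J y) -> c <= normc (\det (gramz (M y) (z y))).
    move=> zi sm; apply: (@le_trans _ _ (sigma / (h ^+ 3 * 4 ^+ 6))); first by rewrite ge_min lexx orbT.
    rewrite ler_pdivrMr// mulrC (le_trans sm)//.
    exact: (minors_sq_preGramian_le t00 yI HP' zi).
  move: (yI); rewrite in_itv/= => /andP[y0 yh].
  have {}y0 : 0 < y by rewrite lt_neqAle eq_sym n1.
  have [y1|y1|y1] := ltgtP y (2 * h - omega); last by rewrite y1 eqxx in n2.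
    have yr : y \in `]0, 2 * h - omega[ by rewrite in_itv/= y0.
    by apply: (boundary ord0); [exact: out_band_minus|apply: Hm'; rewrite yr].
  have [y2|y2|y2] := ltgtP y (omega - h); last by rewrite y2 eqxx in n3.
    have yr : y \in `]2 * h - omega, omega - h[ by rewrite in_itv/= y1.
    apply: (@le_trans _ _ (eta ^+ 2 / h ^+ 4)); first by rewrite ge_min lexx.
    rewrite ler_pdivrMr// mulrC.
    have E4 := det_preGramian t00 yI HP' (out_band_mid wh1 wh2 yr).
    by rewrite -E4 ler_pXn2r ?nnegrE ?normc_ge0 ?(ltW eta0)//; exact: Hd'.
  have yr : y \in `]omega - h, h[ by rewrite in_itv/= y2.
  by apply: (boundary ord_max); [exact: out_band_plus|apply: Hm'; rewrite yr orbT].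
have isf := is_frame_fibers t00 wh bphi gamma0 c0 psi_le det_ge.
have HX := dual_generator_fibers t00 wh bphi gamma0 c0 psi_le det_ge.
have reg : {ae mu, forall x, forall k, x - shift4 h k \in `[0, h[ ->
    regular omega t0 phi (x - shift4 h k)}.
  apply: (ae_unfibers h (Q := fun y => y \in `[0, h[ -> regular omega t0 phi y)).
  apply: filterS3 HP HX det_ge => y H1 H2 H3 yI; split => //.
  - exact: H1.
  - by move=> k; apply/rowP => i; rewrite [LHS]mxE [RHS]mxE (H2 yI).
  - exact: gramz_unit (H3 yI).
split => // s s1 T cT.
have TE k x : T k x = hatPhi (x + s * (k * h)) by [].
have sh0 : shift4 h (inord 0) = - (2 * h) by rewrite /shift4 inordK//; ring.
have sh1 : shift4 h (inord 1) = - h by rewrite /shift4 inordK//; ring.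
have sh2 : shift4 h (inord 2) = 0 by rewrite /shift4 inordK//; ring.
have sh3 : shift4 h (inord 3) = h by rewrite /shift4 inordK//; ring.
(* The shifts [p] are those that bring a point of one of the four tiles back to [0, h). *)
have regx (p : R) : {ae mu, forall x, (p \in [:: 2 * h; h; 0; - h]) -> x + p \in `[0, h[ ->
    regular omega t0 phi (x + p)}.
  apply: filterS reg => x H pI.
  have [k ->] : exists k, p = - shift4 h k.
    move: pI; rewrite !inE => /or4P[] /eqP ->.
    - by exists (inord 0); rewrite sh0 opprK.
    - by exists (inord 1); rewrite sh1 opprK.
    - by exists (inord 2); rewrite sh2 oppr0.
    - by exists (inord 3); rewrite sh3.
  exact: H.
have reg0 : {ae mu, forall x, x \in `[0, h[ -> regular omega t0 phi x}.
  by apply: filterS (regx 0) => x; rewrite addr0 => H; apply: H; rewrite !inE eqxx !orbT.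
have reg1 : {ae mu, forall x, x + h \in `[0, h[ -> regular omega t0 phi (x + h)}.
  by apply: filterS (regx h) => x H; apply: H; rewrite !inE eqxx !orbT.
have reg2 : {ae mu, forall x, x + 2 * h \in `[0, h[ -> regular omega t0 phi (x + 2 * h)}.
  by apply: filterS (regx (2 * h)) => x H; apply: H; rewrite !inE eqxx.
have regN : {ae mu, forall x, x - h \in `[0, h[ -> regular omega t0 phi (x - h)}.
  by apply: filterS (regx (- h)) => x H; apply: H; rewrite !inE eqxx !orbT.
have Tx k x p : x + s * (k * h) = p -> T k x = hatPhi p by move=> <-.
(* Each formula is a row of the fiber through the point of [0, h) congruent to [x]: this is [x] or
   [x - h] when s = 1, and [x + h] or [x + 2 * h] when s = - 1. *)
case: s1 => s1; split.
- apply: filterS reg0 => x rx; rewrite s1 mul1r => xI.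
  have yI : x \in `[0, h[ by move: xI; rewrite !in_itv/= => /andP[? ?]; apply/andP; split; lra.
  have [_ e _] := dual_minus t00 wh1 wh2 (rx yI) xI (erefl (x - h)) erefl (erefl (x + h)).
  rewrite /cT (Tx (-1) x (x - h)) ?(Tx 0 x x) ?(Tx 1 x (x + h)) ?s1; [|ring|ring|ring].
  exact: e.
- apply: filterS reg0 => x rx; rewrite s1 mul1r => xI.
  have yI : x \in `[0, h[ by move: xI; rewrite !in_itv/= => /andP[? ?]; apply/andP; split; lra.
  have [_ _ e _] := dual_mid t00 wh1 wh2 (rx yI) xI (erefl (x - 2 * h)) (erefl (x - h)) erefl (erefl (x + h)).
  rewrite /cT (Tx (-2) x (x - 2 * h)) ?(Tx (-1) x (x - h)) ?(Tx 1 x (x + h)) ?s1; [|ring|ring|ring].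
  exact: e.
(* The third interval contains [h]. Below it the base point is [x], in the last interval of the
   period; above it, [x - h], in the first one. In both cases [x] is the last of the three points,
   so the formula is the same. *)
- apply: filterS3 (ae_neq h) reg0 regN => x xh rx rN; rewrite s1 mul1r => xI.
  rewrite /cT (Tx (-2) x (x - 2 * h)) ?(Tx (-1) x (x - h)) ?(Tx 0 x x) ?s1; [|ring|ring|ring].
  move: xI; rewrite in_itv/= => /andP[x1 x2].
  have [x3|x3|x3] := ltgtP x h; last by rewrite x3 eqxx in xh.
    have yI : x \in `[0, h[ by rewrite in_itv/=; apply/andP; split; lra.
    have yr : x \in `]omega - h, h[ by rewrite in_itv/=; apply/andP; split; lra.
    have [_ _ e] := dual_plus t00 wh1 wh2 (rx yI) yr (erefl (x - 2 * h)) (erefl (x - h)) erefl.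
    exact: e.
  have yI : x - h \in `[0, h[ by rewrite in_itv/=; apply/andP; split; lra.
  have yr : x - h \in `]0, 2 * h - omega[ by rewrite in_itv/=; apply/andP; split; lra.
  have ea : x - 2 * h = x - h - h by ring.
  have ec : x = x - h + h by ring.
  have [_ _ e] := dual_minus t00 wh1 wh2 (rN yI) yr ea erefl ec.
  exact: e.
- apply: filterS regN => x rx; rewrite s1 mul1r in_itv/= => /andP[x1 x2].
  have yI : x - h \in `[0, h[ by rewrite in_itv/=; apply/andP; split; lra.
  have yr : x - h \in `]2 * h - omega, omega - h[ by rewrite in_itv/=; apply/andP; split; lra.
  have ea : x - 3 * h = x - h - 2 * h by ring.
  have eb : x - 2 * h = x - h - h by ring.
  have ec : x = x - h + h by ring.
  have [_ _ _ e] := dual_mid t00 wh1 wh2 (rx yI) yr ea eb erefl ec.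
  rewrite /cT (Tx (-3) x (x - 3 * h)) ?(Tx (-2) x (x - 2 * h)) ?(Tx (-1) x (x - h)) ?s1; [|ring|ring|ring].
  exact: e.
- apply: filterS reg1 => x rx; rewrite s1 mulN1r in_itv/= => /andP[x1 x2].
  have yI : x + h \in `[0, h[ by rewrite in_itv/=; apply/andP; split; lra.
  have yr : x + h \in `]omega - h, h[ by rewrite in_itv/=; apply/andP; split; lra.
  have ea : x - h = x + h - 2 * h by ring.
  have eb : x = x + h - h by ring.
  have [_ e _] := dual_plus t00 wh1 wh2 (rx yI) yr ea eb erefl.
  rewrite /cT (Tx (-1) x (x + h)) ?(Tx 0 x x) ?(Tx 1 x (x - h)) ?s1; [|ring|ring|ring].
  (* The fiber lists the points in increasing order, the reflected formula in decreasing order. *)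
  rewrite cross_cross_rev; exact: e.
- apply: filterS reg1 => x rx; rewrite s1 mulN1r in_itv/= => /andP[x1 x2].
  have yI : x + h \in `[0, h[ by rewrite in_itv/=; apply/andP; split; lra.
  have yr : x + h \in `]2 * h - omega, omega - h[ by rewrite in_itv/=; apply/andP; split; lra.
  have ea : x - h = x + h - 2 * h by ring.
  have eb : x = x + h - h by ring.
  have ec : x + 2 * h = x + h + h by ring.
  have [_ e _ _] := dual_mid t00 wh1 wh2 (rx yI) yr ea eb erefl ec.
  rewrite /cT (Tx (-2) x (x + 2 * h)) ?(Tx (-1) x (x + h)) ?(Tx 1 x (x - h)) ?s1; [|ring|ring|ring].
  exact: e.
(* The reflected interval is likewise split at [- h], and [x] is now the first of the three points
   on both sides. *)
- apply: filterS3 (ae_neq (- h)) reg1 reg2 => x xh rx rN; rewrite s1 mulN1r => xI.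
  rewrite /cT (Tx (-2) x (x + 2 * h)) ?(Tx (-1) x (x + h)) ?(Tx 0 x x) ?s1; [|ring|ring|ring].
  move: xI; rewrite in_itv/= => /andP[x1 x2].
  have [x3|x3|x3] := ltgtP x (- h); last by rewrite x3 eqxx in xh.
    have yI : x + 2 * h \in `[0, h[ by rewrite in_itv/=; apply/andP; split; lra.
    have yr : x + 2 * h \in `]omega - h, h[ by rewrite in_itv/=; apply/andP; split; lra.
    have ea : x = x + 2 * h - 2 * h by ring.
    have eb : x + h = x + 2 * h - h by ring.
    have [e _ _] := dual_plus t00 wh1 wh2 (rN yI) yr ea eb erefl.
    exact: e.
  have yI : x + h \in `[0, h[ by rewrite in_itv/=; apply/andP; split; lra.
  have yr : x + h \in `]0, 2 * h - omega[ by rewrite in_itv/=; apply/andP; split; lra.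
  have ea : x = x + h - h by ring.
  have ec : x + 2 * h = x + h + h by ring.
  have [e _ _] := dual_minus t00 wh1 wh2 (rx yI) yr ea erefl ec.
  exact: e.
- apply: filterS reg2 => x rx; rewrite s1 mulN1r in_itv/= => /andP[x1 x2].
  have yI : x + 2 * h \in `[0, h[ by rewrite in_itv/=; apply/andP; split; lra.
  have yr : x + 2 * h \in `]2 * h - omega, omega - h[ by rewrite in_itv/=; apply/andP; split; lra.
  have ea : x = x + 2 * h - 2 * h by ring.
  have eb : x + h = x + 2 * h - h by ring.
  have ec : x + 3 * h = x + 2 * h + h by ring.
  have [e _ _ _] := dual_mid t00 wh1 wh2 (rx yI) yr ea eb erefl ec.
  rewrite /cT (Tx (-3) x (x + 3 * h)) ?(Tx (-2) x (x + 2 * h)) ?(Tx (-1) x (x + h)) ?s1; [|ring|ring|ring].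
  exact: e.
Qed.
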